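(* Let $a$ and $b$ be two free random variables with the same distribution in a non-commutative probability space, and denote $\lambda_n:=\kappa_n(a)=\kappa_n(b)$. Then $$\kappa_n(ab+ba)=\sum_{\substack{(\mathcal{G},C)\in OCG_n\\ \mathcal{G}\text{ is bipartite}}}2^{f_C+1}\prod_{v\in V_{\mathcal{G}}}\lambda_{d(v)}\qquad\text{for all } n\ge1,$$ where $V_{\mathcal{G}}$ is the vertex set of $\mathcal{G}$, $f_C$ is the number of flexible edges of $\mathcal{G}$ without counting the first edge of $C$, and $d(v)$ is the degree of the vertex $v$ in $\mathcal{G}$.
   Context: A non-commutative probability space $(\mathcal{A},\varphi)$ is a unital algebra over $\mathbb{C}$ with a linear functional $\varphi$, $\varphi(1)=1$. The free cumulants are the multilinear functionals $\kappa_n:\mathcal{A}^n\to\mathbb{C}$ determined recursively by $\varphi(a_1\cdots a_n)=\sum_{\pi\in\mathcal{NC}(n)}\prod_{V\in\pi}\kappa_{|V|}(a_V)$, where $\mathcal{NC}(n)$ is the set of non-crossing partitions of $\{1,\dots,n\}$ and for $V=\{v_1<\dots<v_k\}$, $\kappa_{|V|}(a_V)=\kappa_k(a_{v_1},\dots,a_{v_k})$; $\kappa_n(a):=\kappa_n(a,\dots,a)$. Freeness is free independence, equivalently vanishing of mixed free cumulants in $a,b$. ''Same distribution'' means $\varphi(a^n)=\varphi(b^n)$ for all $n\ge1$, equivalently $\kappa_n(a)=\kappa_n(b)$ for all $n\ge1$. Cacti. In a graph with loops and multiple edges allowed, a cycle is a finite sequence $(v_1,e_1,\dots,v_j,e_j)$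 of vertices and edges such that $e_i$ connects $v_i$ with $v_{i+1}$ for $i=1,\dots,j$ (with $v_{j+1}=v_1$); repetitions are allowed. A simple cycle is a cycle with pairwise distinct vertices and pairwise distinct edges, considered up to cyclic rotation and reversal (a loop gives one with $j=1$, a pair of parallel edges one with $j=2$). A cactus is a connected graph in which every edge belongs to at most one simple cycle; an edge is rigid if it belongs to a simple cycle and flexible otherwise. An outercycle (orientation) of a cactus $\mathcal{G}$ is a cycle $C$ passing exactly once through every rigid edge and exactly twice through every flexible edge. Outercycles $C=(v_1,e_1,\dots,v_j,e_j)$ and $C'=(v_1',e_1',\dots,v_j',e_j')$ of $\mathcal{G}$ are considered the same if some automorphism $g$ of $\mathcal{G}$ (acting on vertices and edges) satisfies $g(v_i)=v_i'$, $g(e_i)=e_i'$ for all $i$ (cyclic rotations are not otherwise identified). $OCG_n$ is the set of oriented cacti $(\mathcal{G},C)$ ($\mathcal{G}$ a cactus, $C$ an outercycle) with exactly $n$ edges, taken up to isomorphism (a graph isomorphism carrying one outercycle entrywise to the other). Loops count twice in the degree. *)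

(* Defs.v *)
From HB Require Import structures.
From mathcomp Require Import all_boot all_order all_algebra zify.
From mathcomp Require Import generic_quotient.
From mathcomp Require Import boolp reals.
From mathcomp Require Import complex.

Set Implicit Arguments.
Unset Strict Implicit.
Unset Printing Implicit Defensive.

Import GRing.Theory.
Local Open Scope ring_scope.

Definition noncrossing n (P : {set {set 'I_n}}) : bool :=
  [forall V in P, forall W in P, (V != W) ==>
    ~~ [exists i in V, exists j in W, exists k in V, exists l in W,
          [&& (i < j)%N, (j < k)%N & (k < l)%N]]].

Definition NC n : {set {set {set 'I_n}}} :=
  [set P | partition P [set: 'I_n] && noncrossing P].

(* [enum V] lists the ordinals of V in increasing order. *)
Definition subword (T : Type) (s : seq T) (V : {set 'I_(size s)}) : seq T :=
  [seq tnth (in_tuple s) i | i <- enum V].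

Section FreeProbability.

Variables (K : comNzRingType) (A : algType K) (phi : {scalar A}).

(* The moment-cumulant formula solved for the cumulant of the one-block
   partition [set setT]; the other partitions only involve shorter words, so
   [size s] is enough fuel (see [moment_cumulant]). *)
Fixpoint free_cumulant_rec (fuel : nat) (s : seq A) : K :=
  if fuel is fuel'.+1 then
    phi (\prod_(x <- s) x)
    - \sum_(P in NC (size s) | P != [set setT])
        \prod_(V in P) free_cumulant_rec fuel' (subword V)
  else 0.

(* kappa_n(a_1, ..., a_n) is [free_cumulant [:: a_1; ...; a_n]]; only
   nonempty words are meaningful. *)
Definition free_cumulant (s : seq A) : K := free_cumulant_rec (size s) s.

Definition cumulant (n : nat) (x : A) : K := free_cumulant (nseq n x).

Definition in_alg1 (x y : A) : Prop := exists p : {poly K}, y = horner_alg x p.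

(* Free independence of the unital subalgebras generated by a (tag true) and
   by b (tag false): products of centred elements taken alternately from the
   two subalgebras are centred. *)
Definition free_indep (a b : A) : Prop :=
  forall s : seq (bool * A),
    s != [::] ->
    sorted (fun x y => x.1 != y.1) s ->
    (forall x, x \in s -> in_alg1 (if x.1 then a else b) x.2 /\ phi x.2 = 0) ->
    phi (\prod_(x <- s) x.2) = 0.

Definition same_distribution (a b : A) : Prop :=
  forall n, (0 < n)%N -> phi (a ^+ n) = phi (b ^+ n).

Lemma size_subword (s : seq A) (V : {set 'I_(size s)}) :
  size (subword V) = #|V|.
Proof. by rewrite size_map cardE. Qed.

Lemma subword_setT (s : seq A) : subword [set: 'I_(size s)] = s.
Proof.
rewrite /subword (@eq_enum _ _ 'I_(size s)) => [|i]; last by rewrite !inE.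
exact: (map_tnth_enum (in_tuple s)).
Qed.

Lemma NC1 n : (0 < n)%N -> [set [set: 'I_n]] \in NC n.
Proof.
move=> n0; rewrite inE; apply/andP; split.
  apply/and3P; split; first by rewrite /cover big_set1.
    by apply/trivIsetP => X Y /set1P-> /set1P->; rewrite eqxx.
  apply/negP => /set1P /esym /setP /(_ (Ordinal n0)).
  by rewrite in_setT in_set0.
apply/forall_inP => X /set1P->; apply/forall_inP => Y /set1P->.
by rewrite eqxx.
Qed.

Lemma free_cumulant_recS m (s : seq A) : (0 < size s)%N ->
  (forall t, (0 < size t < size s)%N ->
     free_cumulant_rec m t = free_cumulant t) ->
  free_cumulant_rec m.+1 s =
  phi (\prod_(x <- s) x)
  - \sum_(P in NC (size s) | P != [set setT])
      \prod_(V in P) free_cumulant (subword V).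
Proof.
move=> s0 IH /=; congr (_ - _).
apply: eq_bigr => P /andP[]; rewrite inE => /andP[/and3P[_ tP nP] _] PT.
apply: eq_bigr => V VP; apply: IH; rewrite size_subword.
rewrite card_gt0; apply/andP; split; first by apply: contraNneq nP => <-.
rewrite -[X in (_ < X)%N]card_ord -cardsT proper_card // properT.
apply: contraNneq PT => VT.
rewrite eqEsubset sub1set -VT VP andbT; apply/subsetP => W WP.
rewrite inE; apply/negPn/negP => WV; move/trivIsetP: tP => tP.
move: (tP _ _ WP VP WV); rewrite VT -setI_eq0 setIT => /eqP W0.
by move: nP; rewrite -W0 WP.
Qed.

Lemma free_cumulant_fuel m (s : seq A) :
  (size s <= m)%N -> (0 < size s)%N ->
  free_cumulant_rec m s = free_cumulant s.
Proof.
have [k] := ubnP (size s); elim: k m s => // k IH [|m] s szk szm s0.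
  by case: (size s) s0 szm.
have [l E] : exists l, size s = l.+1 by case: (size s) s0 => // l; exists l.
have R p : (l <= p)%N -> forall t, (0 < size t < size s)%N ->
    free_cumulant_rec p t = free_cumulant t.
  by move=> lp t /andP[t0 ts]; apply: IH => //; lia.
rewrite /free_cumulant E !free_cumulant_recS //; apply: R; lia.
Qed.

Lemma moment_cumulant (s : seq A) : (0 < size s)%N ->
  phi (\prod_(x <- s) x) =
  \sum_(P in NC (size s)) \prod_(V in P) free_cumulant (subword V).
Proof.
move=> s0; rewrite (bigD1 _ (NC1 s0)) /= big_set1 subword_setT.
rewrite -{1}(@free_cumulant_fuel (size s).+1) // free_cumulant_recS ?subrK //.
by move=> t /andP[t0 ts]; apply: free_cumulant_fuel => //; lia.
Qed.

End FreeProbability.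

Section Multigraphs.

(* Loops and parallel edges are allowed: an edge has one end (loop) or two. *)
Record mgraph (V E : finType) := MGraph {
  ends :> {ffun E -> {set V}};
  _ : [forall e, (0 < #|ends e| <= 2)%N] }.

HB.instance Definition _ (V E : finType) := [isSub for @ends V E].
HB.instance Definition _ (V E : finType) := [Finite of mgraph V E by <:].

Variables (V E : finType) (G : mgraph V E).

Definition joins (e : E) (u v : V) : bool := G e == [set u; v].

Definition mdegree (v : V) : nat :=
  (#|[set e | v \in G e]| + #|[set e | G e == [set v]]|)%N.

Definition mconnected : Prop :=
  (0 < #|V|)%N /\ forall u v, connect (fun x y => [exists e, joins e x y]) u v.

Definition bipartite : bool :=
  [exists f : {ffun V -> bool},
     [forall e, forall u, forall v, joins e u v ==> (f u != f v)]].

(* The cycle (v_1, e_1, ..., v_j, e_j) is the sequence of pairs (v_i, e_i);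
   [cycle] closes it up by v_{j+1} = v_1. *)
Definition is_cycle (c : seq (V * E)) : bool :=
  cycle (fun x y => joins x.2 x.1 y.1) c.

Definition simple_cycle (c : seq (V * E)) : bool :=
  [&& is_cycle c, uniq (unzip1 c) & uniq (unzip2 c)].

(* (v_1, e_j, v_j, e_{j-1}, ..., v_2, e_1) *)
Definition rev_cycle (c : seq (V * E)) : seq (V * E) :=
  zip (rotr 1 (rev (unzip1 c))) (rev (unzip2 c)).

Definition same_cycle (c c' : seq (V * E)) : Prop :=
  exists k, c' = rot k c \/ c' = rot k (rev_cycle c).

Definition cactus : Prop :=
  mconnected /\
  forall e c c', simple_cycle c -> simple_cycle c' ->
    e \in unzip2 c -> e \in unzip2 c' -> same_cycle c c'.

Definition rigid (e : E) : bool :=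
  `[< exists2 c, simple_cycle c & e \in unzip2 c >].

Definition flexible (e : E) : bool := ~~ rigid e.

Definition outercycle (c : seq (V * E)) : bool :=
  is_cycle c &&
  [forall e, count_mem e (unzip2 c) == if rigid e then 1%N else 2%N].

Definition nflex (c : seq (V * E)) : nat :=
  #|[set e | flexible e & Some e != ohead (unzip2 c)]|.

End Multigraphs.

Definition oriented_iso (V V' E E' : finType)
    (G : mgraph V E) (c : seq (V * E))
    (G' : mgraph V' E') (c' : seq (V' * E')) : Prop :=
  exists (fV : V -> V') (fE : E -> E'),
    [/\ bijective fV, bijective fE,
        forall e, G' (fE e) = fV @: G e &
        c' = [seq (fV x.1, fE x.2) | x <- c]].

(* A connected graph with n edges has at most n + 1 vertices and an outercycle
   has length at most 2n, so every oriented cactus with n edges is isomorphic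
   to one with edge set 'I_n and vertex set 'I_m, where m < n + 2. *)
Definition pre_ocactus (n : nat) : finType :=
  {m : 'I_n.+2 & (mgraph 'I_m 'I_n * (n.*2).-bseq ('I_m * 'I_n))%type}.

Definition is_ocactus n (x : pre_ocactus n) : bool :=
  `[< cactus (tagged x).1 /\ outercycle (tagged x).1 (tagged x).2 >].

Definition ocactus (n : nat) : finType := {x : pre_ocactus n | is_ocactus x}.

Section OrientedCacti.

Variable n : nat.
Implicit Types x y z : ocactus n.

Definition oc_order x : nat := tag (val x).
Definition oc_graph x : mgraph 'I_(oc_order x) 'I_n := (tagged (val x)).1.
Definition oc_cycle x : seq ('I_(oc_order x) * 'I_n) := (tagged (val x)).2.

Definition oc_iso x y : bool :=
  `[< oriented_iso (oc_graph x) (oc_cycle x) (oc_graph y) (oc_cycle y) >].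

Lemma oc_iso_refl : reflexive oc_iso.
Proof.
move=> x; apply/asboolP; exists id, id; split; try by exists id.
  by move=> e; rewrite imset_id.
by rewrite -[LHS]map_id; apply: eq_map => -[].
Qed.

Lemma oc_iso_imp x y : oc_iso x y -> oc_iso y x.
Proof.
move=> /asboolP[fV [fE [[gV fgV gfV] [gE fgE gfE] eG ec]]]; apply/asboolP.
exists gV, gE; split; [by exists fV|by exists fE| |].
  by move=> e; rewrite -{2}[e]gfE eG -imset_comp (eq_imset _ fgV) imset_id.
rewrite ec -map_comp -[LHS]map_id; apply: eq_map => -[v e] /=.
by rewrite fgV fgE.
Qed.

Lemma oc_iso_sym : symmetric oc_iso.
Proof. by move=> x y; apply/idP/idP; apply: oc_iso_imp. Qed.

Lemma oc_iso_trans : transitive oc_iso.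
Proof.
move=> y x z /asboolP[fV [fE [bV bE eG ec]]] /asboolP[gV [gE [cV cE fG fc]]].
apply/asboolP; exists (gV \o fV), (gE \o fE); split; try exact: bij_comp.
  by move=> e /=; rewrite fG eG -imset_comp.
by rewrite fc ec -map_comp.
Qed.

Canonical oc_equiv := EquivRel oc_iso oc_iso_refl oc_iso_sym oc_iso_trans.

End OrientedCacti.

Definition OCG (n : nat) := {eq_quot @oc_iso n}%qT.

HB.instance Definition _ (n : nat) := EqQuotient.on (OCG n).
HB.instance Definition _ (n : nat) := Choice.on (OCG n).
HB.instance Definition _ (n : nat) :=
  isCountable.Build (OCG n) (pcan_pickleK (can_pcan (@reprK _ (OCG n)))).
HB.instance Definition _ (n : nat) :=
  isFinite.Build (OCG n) (pcan_enumP (can_pcan (@reprK _ (OCG n)))).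

(* Degrees, bipartiteness and flexible edges are invariant under [oc_iso], so
   they may be read off a representative of the class. *)
Definition OCG_graph n (q : OCG n) := oc_graph (repr q).
Definition OCG_cycle n (q : OCG n) := oc_cycle (repr q).

(* Main.v *)
Require Import Defs.
From HB Require Import structures.
From mathcomp Require Import all_boot all_order all_algebra zify ring.
From mathcomp Require Import generic_quotient qpoly.
From mathcomp Require Import boolp reals complex.

(* The moments of ab + ba are sums over words in a and b, and freeness expresses
   the moment of a word by a stack automaton in which a letter either opens a
   block of size k + 1, pushing k tokens of its colour with weight lambda_(k+1),
   or pops a token of its colour.  For a single colour the automaton enumerates
   non-crossing partitions, so it suffices to exhibit numbers mu_k whose
   one-colour automaton gives the moments of ab + ba; these are then the
   cumulants.

   An oriented cactus is a closed walk obtained from the empty walk by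
   successively inserting either a traversal back and forth of a new pendant
   edge or a new simple cycle; isomorphism classes of oriented cacti thus
   correspond to plane trees built from these two kinds of primitives.  The
   generating function of the trees, with weight y for each edge, satisfies
   algebraic equations in which the degrees of the vertices appear through
   L1 = sum_d lambda_(d+1) A_d and L2 = sum_d lambda_(d+2) A_d, where A_d
   enumerates the trees with root degree d.  If mu is the cactus sum and M
   solves M = 1 + sum_k mu_k (z M)^k, then with y = z M these equations make an
   explicit 3 x 3 matrix, with entries in M, y, L1, L2, the matrix of
   excursions of the two-colour automaton read two letters at a time (modulo
   z^(N+1)); hence M is also the generating function of the moments of
   ab + ba. *)

Set Implicit Arguments.
Unset Strict Implicit.
Unset Printing Implicit Defensive.

Import GRing.Theory.

(** * Closed walks and cacti *)

(** No bijection between words and cacti is built: the matrix of excursions is written down and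
    checked against the first-step equations of the automaton, which determine it because each pair
    of letters carries a factor z. The check succeeds because of one recursion. Popping a token [c]
    acts on the two states [None] and [Some (~~ c)] by a 2 x 2 matrix of trace 2 y L1 and
    determinant - y t q, where t = y L2 and q = 1 + t^2 q. Its powers, needed when a block of k + 1
    letters is opened, are therefore governed by A_(k+2) = 2 y L1 A_(k+1) + y t q A_k. The same
    recursion enumerates plane trees by root degree: a bridge raises the degree by 1 with weight 2 y
    L1, a cycle raises it by 2 with weight y t q. Here t q enumerates chains with an odd number of
    links, that is, even cycles; so bipartiteness mirrors the two colours, the entry from [Some c]
    to [Some d] containing q if c = d and t q otherwise. *)

Lemma mem_map_split (T : eqType) (S : Type) (f : S -> T) (s : seq S) t :
  t \in map f s ->
  exists s1 x s2, [/\ s = s1 ++ x :: s2, f x = t & t \notin map f s1].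
Proof.
elim: s => //= a s IH; rewrite inE; case: eqP => [->|ne] /=.
  by exists [::], a, s.
move=> /IH [s1 [x [s2 [-> fx n]]]]; exists (a :: s1), x, s2; split => //=.
by rewrite inE negb_or n andbT; apply/eqP.
Qed.

Lemma not_uniq_split (T : eqType) (S : Type) (f : S -> T) (s : seq S) :
  ~~ uniq (map f s) ->
  exists s1 x s2 y s3, s = s1 ++ x :: s2 ++ y :: s3 /\ f x = f y.
Proof.
elim: s => //= a s IH; rewrite negb_and negbK => /orP[|/IH].
  move=> /mem_map_split [s1 [x [s2 [-> fx _]]]].
  by exists [::], a, s1, x, s2.
move=> [s1 [x [s2 [y [s3 [-> fxy]]]]]].
by exists (a :: s1), x, s2, y, s3.
Qed.

Lemma has_first (S : Type) (a : pred S) (s : seq S) : has a s ->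
  exists s1 x s2, [/\ s = s1 ++ x :: s2, a x & ~~ has a s1].
Proof.
elim: s => //= y s IH; case ay: (a y) => /=.
  by exists [::], y, s.
move=> /IH [s1 [x [s2 [-> ax n]]]].
by exists (y :: s1), x, s2; split; rewrite //= ay.
Qed.

Section ClosedWalks.
Variables (V E : finType) (G : mgraph V E).
Implicit Types (C D N X Y c : seq (V * E)) (u v w x y : V) (e : E).

Definition target C w := head w (unzip1 C).

(** A walk lists the vertices it leaves, each with the edge taken; its last vertex is not in the
    list, hence the argument [w]. [target C' w] is the vertex at which the rest [C'] begins, and [w]
    itself when nothing is left. *)
Fixpoint walk v C w : bool :=
  if C is (x, e) :: C' then
    [&& x == v, joins G e x (target C' w) & walk (target C' w) C' w]
  else v == w.

Lemma walk_cons v x e C w : walk v ((x, e) :: C) w =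
  [&& x == v, joins G e x (target C w) & walk (target C w) C w].
Proof. by []. Qed.

Lemma walk_target v C w : walk v C w -> target C w = v.
Proof. by case: C => [|[x e] C] /=; [move/eqP | case/and3P => /eqP]. Qed.

Lemma target_cat X Y w : target (X ++ Y) w = target X (target Y w).
Proof. by case: X. Qed.

Lemma walk_cat v X Y w :
  walk v (X ++ Y) w = walk v X (target Y w) && walk (target Y w) Y w.
Proof.
elim: X v => [|[x e] X IH] v /=.
  case: Y => [|[x e] Y]; first by rewrite /= eqxx andbT.
  by rewrite [target _ _]/= [v == x]eq_sym /=; case: (x =P v) => [->|//]; rewrite eqxx.
by rewrite target_cat IH !andbA.
Qed.

Lemma walk_catP v X Y w :
  reflect (exists2 u, walk v X u & walk u Y w) (walk v (X ++ Y) w).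
Proof.
rewrite walk_cat; apply: (iffP andP) => [[]|[u wX wY]]; first by exists (target Y w).
by rewrite (walk_target wY).
Qed.

Lemma joins_sym e u v : joins G e u v = joins G e v u.
Proof. by rewrite /joins setUC. Qed.

Lemma joins_eq e u v x y : joins G e u v -> joins G e x y ->
  (x = u /\ y = v) \/ (x = v /\ y = u).
Proof.
rewrite /joins => /eqP-> /eqP S.
have: x \in [set u; v] by rewrite S !inE eqxx.
have: y \in [set u; v] by rewrite S !inE eqxx orbT.
have: u \in [set x; y] by rewrite -S !inE eqxx.
have: v \in [set x; y] by rewrite -S !inE eqxx orbT.
by rewrite !inE; do 4! [case/orP => /eqP ?]; subst; auto.
Qed.

Lemma walk_path v x e C w :
  walk v ((x, e) :: C) w =
  (x == v) && path (fun p q => joins G p.2 p.1 q.1) (x, e) C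
  && joins G (last (x, e) C).2 (last (x, e) C).1 w.
Proof.
elim: C v x e => [|[y f] C IH] v x e; first by rewrite /= eqxx !andbT.
by rewrite walk_cons [target _ _]/= IH /= eqxx /= !andbA.
Qed.

Lemma is_cycleE x e C : is_cycle G ((x, e) :: C) = walk x ((x, e) :: C) x.
Proof.
rewrite /is_cycle walk_path eqxx andTb.
by rewrite (cycle_path (x, e)) /= andbC.
Qed.

Lemma is_cycle_walk C v : walk v C v -> is_cycle G C.
Proof.
case: C => [//|[x e] C] H; have /eqP E1 : x == v by case/and3P: H.
by subst v; rewrite is_cycleE.
Qed.

Lemma mem_unzip1_split C x :
  x \in unzip1 C ->
  exists C1 e C2, C = C1 ++ (x, e) :: C2 /\ x \notin unzip1 C1.
Proof.
by move/mem_map_split => [C1 [[y e] [C2 [-> /= -> n]]]]; exists C1, e, C2.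
Qed.

(** The stretch between two visits of the same vertex is again a closed walk, and a shorter one, so
    shrinking ends at a closed piece without repeated vertices. *)
Lemma simple_subwalk v C : walk v C v -> C != [::] ->
  exists X N Y u, [/\ C = X ++ N ++ Y, N != [::], walk u N u,
    uniq (unzip1 N) & walk v X u /\ walk u Y v].
Proof.
move=> wC C0.
suff: forall k X N Y u, (size N <= k)%N -> C = X ++ N ++ Y -> N != [::] ->
    walk u N u -> walk v X u -> walk u Y v ->
  exists X N Y u, [/\ C = X ++ N ++ Y, N != [::], walk u N u,
    uniq (unzip1 N) & walk v X u /\ walk u Y v].
  by move/(_ (size C) [::] C [::] v (leqnn _)); apply => //=; rewrite ?cats0.
elim=> [|k IH] X N Y u szN CE N0 wN wX wY; first by case: N N0 szN {CE wN}.
case un: (uniq (unzip1 N)); first by exists X, N, Y, u.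
have := negbT un => /not_uniq_split [N1 [[x e] [N2 [[y f] [N3 [NE /= xy]]]]]].
subst y; move: wN; rewrite NE => /walk_catP [x' w1].
rewrite -cat_cons => /walk_catP [x'' w2 w3].
have E1 := walk_target w2; have E2 := walk_target w3.
rewrite /target /= in E1 E2; subst x' x''.
apply: (IH (X ++ N1) ((x, e) :: N2) ((x, f) :: N3 ++ Y) x) => //.
- by move: szN; rewrite NE !size_cat /= size_cat /=; lia.
- by rewrite CE NE -!catA /= -catA.
- by apply/walk_catP; exists u.
- by rewrite -cat_cons; apply/walk_catP; exists u.
Qed.

Definition prim v N :=
  [/\ walk v N v, N <> [::], uniq (unzip1 N) &
      uniq (unzip2 N) \/ exists u e, N = [:: (v, e); (u, e)]].

(** An edge used twice must be run in opposite directions, since the same direction would repeat its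
    starting vertex. Any further step between or around the two uses would then leave from one of
    its two ends a second time. *)
Lemma simple_closed_prim v N :
  walk v N v -> N != [::] -> uniq (unzip1 N) -> prim v N.
Proof.
move=> wN N0 uN; split=> //; first exact/eqP.
case u2: (uniq (unzip2 N)); [by left | right].
have := negbT u2 => /not_uniq_split [N1 [[x e] [N2 [[y f] [N3 [NE /= ef]]]]]].
subst f; move: wN uN; rewrite NE => /walk_catP [x' w1 w2].
have E1 := walk_target w2; rewrite /target /= in E1; subst x'.
move: w2; rewrite -cat_cons => /walk_catP [y' w2 w3].
have E2 := walk_target w3; rewrite /target /= in E2; subst y'.
move: w3; rewrite /= => /and3P[_ J2 w3].
move: w2; rewrite /= => /and3P[_ J1 w2].
rewrite /unzip1 map_cat /= map_cat /= => uN.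
have xy : x <> y.
  move=> xy; move: uN; rewrite cat_uniq /= xy mem_cat inE eqxx orbT /=.
  by rewrite !andbF.
have [[]|[T1 T2]] := joins_eq J1 J2; first by move=> yx; case: xy.
rewrite /target in T1 T2.
have N20 : N2 = [::].
  case: N2 {NE w2 J1 T2} T1 uN => [//|[z g] N2] /= -> uN.
  by move: uN; rewrite cat_uniq /= !mem_cat !inE !eqxx !orbT !andbF.
subst N2.
have N30 : N3 = [::].
  case: N3 {NE w3 J2 T1} T2 uN => [//|[z g] N3] /= -> uN.
  by move: uN; rewrite cat_uniq /= !inE !eqxx !orbT !andbF.
subst N3; rewrite /= in T2 *.
case: N1 {NE} w1 uN => [|[z g] N1] //=.
  by move=> _ _; exists y, e; rewrite T2.
by case/and3P => /eqP-> _ _; rewrite T2 mem_cat inE eqxx orbT.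
Qed.

(** Loop erasure; [P] keeps pairs of [D], so its edges are edges of [D]. *)
Lemma simple_path a D b : walk a D b ->
  exists P, [/\ walk a P b, uniq (unzip1 P), {subset P <= D} & b \notin unzip1 P].
Proof.
elim: D a => [|[x e] D IH] a /=.
  by move=> /eqP->; exists [::]; rewrite /= eqxx.
case/and3P => /eqP-> J /IH [P [wP uP sP bP]].
have [->|ab] := eqVneq a b; first by exists [::]; rewrite /= eqxx.
case aP: (a \in unzip1 P).
  have [P1 [f [P2 [PE n]]]] := mem_unzip1_split aP.
  exists ((a, f) :: P2); split.
  - move: wP; rewrite PE => /walk_catP[z w1 w2].
    by have Ez := walk_target w2; rewrite /target /= in Ez; subst z.
  - by move: uP; rewrite PE /unzip1 map_cat cat_uniq => /and3P[].
  - by move=> p pP; rewrite inE sP ?orbT // PE mem_cat pP orbT.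
  - by move: bP; rewrite PE /unzip1 map_cat mem_cat negb_or => /andP[].
exists ((a, e) :: P); split => /=.
- by rewrite eqxx (walk_target wP) J.
- by rewrite aP.
- by move=> p; rewrite !inE => /orP[->//|/sP->]; rewrite orbT.
- by rewrite inE negb_or eq_sym ab bP.
Qed.

Lemma simple_path_edges a P b : walk a P b -> uniq (unzip1 P) ->
  b \notin unzip1 P -> uniq (unzip2 P).
Proof.
move=> wP uP bP; case u2: (uniq (unzip2 P)) => //.
have := negbT u2 => /not_uniq_split [N1 [[x e] [N2 [[y f] [N3 [NE /= ef]]]]]].
subst f; move: wP uP bP; rewrite NE => /walk_catP [x' w1 w2].
have E1 := walk_target w2; rewrite /target /= in E1; subst x'.
move: w2; rewrite -cat_cons => /walk_catP [y' w2 w3].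
have E2 := walk_target w3; rewrite /target /= in E2; subst y'.
move: w3; rewrite /= => /and3P[_ J2 w3].
move: w2; rewrite /= => /and3P[_ J1 w2].
rewrite /unzip1 map_cat /= map_cat /= => uN bN.
have [[yx _]|[T1 T2]] := joins_eq J1 J2; last rewrite /target in T1 T2.
  by move: uN; rewrite cat_uniq /= yx !mem_cat !inE !eqxx !orbT /= !andbF.
case: N3 {w3 J2 NE} T2 uN bN => [|[z g] N3] /= ->.
  by rewrite !mem_cat !inE !eqxx !orbT.
by rewrite cat_uniq /= !mem_cat !inE !eqxx !orbT /= !andbF.
Qed.

Lemma same_cycle_edges c c' : same_cycle c c' -> unzip2 c' =i unzip2 c.
Proof.
case=> k [->|->] e; rewrite /unzip2 map_rot mem_rot //.
rewrite /rev_cycle -/(unzip2 _) unzip2_zip ?mem_rev //.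
by rewrite size_rotr !size_rev !size_map.
Qed.

Lemma walk_vertices_subset u N w : walk u N w -> N != [::] -> u \in unzip1 N.
Proof. by case: N => [//|[x e] N] /= /and3P[/eqP-> _ _]; rewrite inE eqxx. Qed.

(* A simple path leaving the closed walk [N] and meeting it again at another
   vertex would close up, with a part of [N], to a second simple cycle *)
Lemma second_cycle u N D x :
  prim u N -> walk u D u -> {in unzip2 N, forall e, e \notin unzip2 D} ->
  x \in unzip1 (behead N) -> x \in unzip1 D ->
  exists c, [/\ simple_cycle G c, exists2 e, e \in unzip2 c & e \in unzip2 N,
     exists2 e, e \in unzip2 c & e \notin unzip2 N & 
     uniq (unzip2 N) \/ exists2 e, e \in unzip2 c & count_mem e (unzip2 N) = 2%N].
Proof.
move=> [wN /eqP N0 uN pN] wD eND xN xD.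
have /has_first [D1 [[y f] [D2 [DE /= yN D1N]]]] :
    has (fun p => p.1 \in unzip1 (behead N)) D.
  by apply/hasP; case/mapP: xD => p pD xp; exists p; rewrite // -xp.
have wD1 : walk u D1 y.
  move: wD; rewrite DE => /walk_catP [z w1 w2].
  by have Ez := walk_target w2; rewrite /target /= in Ez; subst z.
have [P [wP uP sP yP]] := simple_path wD1.
case: N N0 => [//|[u' e0] N'] _ in wN uN pN eND xN yN D1N *.
have Eu : u' = u by case/and3P: (wN) => /eqP.
subst u'; rewrite /= in xN yN D1N.
have [N1 [g [N2 [NE yN1]]]] := mem_unzip1_split yN.
have eP e : e \in unzip2 P -> e \notin unzip2 ((u, e0) :: N').
  move=> /mapP [p pP ->]; apply: contraL (map_f snd (sP _ pP)) => /eND.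
  by rewrite DE /unzip2 map_cat mem_cat negb_or => /andP[].
have w2 : walk y ((y, g) :: N2) u.
  move: wN; rewrite NE -cat_cons => /walk_catP [z w1 w2].
  by have Ez := walk_target w2; rewrite /target /= in Ez; subst z.
have P0 : P != [::].
  case: P wP {uP sP yP eP} => //= /eqP uy.
  by move: uN; rewrite /= uy yN.
exists (P ++ (y, g) :: N2); split.
- apply/and3P; split.
  + by apply: (is_cycle_walk (v := u)); apply/walk_catP; exists y.
  + rewrite /unzip1 map_cat cat_uniq uP andTb; apply/andP; split.
      apply/hasPn => z zN2; apply: contraNN D1N => /mapP [p pP zp].
      apply/hasP; exists p; first exact: sP.
      by rewrite -zp NE /unzip1 map_cat mem_cat zN2 orbT.
    by move: uN; rewrite NE /unzip1 /= map_cat cat_uniq => /and4P[].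
  + rewrite /unzip2 map_cat cat_uniq (simple_path_edges wP) // andTb; apply/andP; split.
      apply/hasPn => z zN2; apply/negP => /eP; rewrite NE /unzip2 /= map_cat.
      by rewrite inE mem_cat zN2 !orbT.
    case: pN => [u2|[u' [e Ee]]].
      by move: u2; rewrite NE /unzip2 /= map_cat cat_uniq => /and4P[].
    move: Ee; rewrite NE; by case: (N1) => [|? []] //= [] // _ _ _ ->.
- exists g; first by rewrite /unzip2 map_cat mem_cat inE eqxx orbT.
  by rewrite NE /unzip2 /= map_cat inE mem_cat inE eqxx !orbT.
- case: P P0 eP {wP uP sP yP} => [//|[a e] P] _ /(_ e); rewrite inE eqxx.
  by move=> /(_ isT) H; exists e; rewrite //= inE eqxx.
- case: pN => [?|[u' [e Ee]]]; [by left | right; exists e].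
    move: Ee => [_ Ee]; move: Ee NE => -> /=; case: N1 {yN1} => [|? []] //= [] // _ <- _.
    by rewrite /unzip2 map_cat mem_cat inE eqxx orbT.
  by rewrite Ee /= !eqxx.
Qed.

(** The multiplicities of an outercycle are required only for the edges of [C], so that the property
    passes to the walk left after removing a primitive. *)
Definition good v C := walk v C v /\
  forall e, e \in unzip2 C ->
    count_mem e (unzip2 C) = if rigid G e then 1%N else 2%N.

Inductive cac v : seq (V * E) -> Prop :=
| cac0 : cac v [::]
| cac_ins X N Y u : cac v (X ++ Y) -> prim u N -> walk v X u -> walk u Y v ->
    {in unzip2 N, forall e, e \notin unzip2 (X ++ Y)} ->
    {in unzip1 (behead N), forall x, x \notin v :: unzip1 (X ++ Y)} ->
    cac v (X ++ N ++ Y).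

(** An innermost closed piece [N] is the last primitive inserted. Its edges do not recur, by the
    multiplicities in [good]. Its vertices other than [u] do not recur either: otherwise
    [second_cycle] yields another simple cycle through an edge of [N], which contradicts the cactus
    property if [N] is a cycle, and makes an edge used twice rigid if [N] runs back and forth. *)
Lemma good_cac v C : cactus G -> good v C -> cac v C.
Proof.
move=> [_ cacG]; have [k] := ubnP (size C); elim: k C => // k IH C szC [wC gC].
have [->|C0] := eqVneq C [::]; first exact: cac0.
have [X [N [Y [u [CE N0 wN uN [wX wY]]]]]] := simple_subwalk wC C0.
have pN := simple_closed_prim wN N0 uN.
have eC e : count_mem e (unzip2 C) =
    (count_mem e (unzip2 N) + count_mem e (unzip2 (X ++ Y)))%N.
  by rewrite CE /unzip2 !map_cat !count_cat; lia.
have eN e : e \in unzip2 N -> e \notin unzip2 (X ++ Y).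
  move=> eN; have eC' : e \in unzip2 C.
    by rewrite CE /unzip2 !map_cat !mem_cat eN orbT.
  rewrite -has_pred1 has_count -leqNgt leqn0; apply/eqP.
  have := gC e eC'; rewrite eC.
  have : (0 < count_mem e (unzip2 N))%N by rewrite -has_count has_pred1.
  case: pN => _ _ _ [u2|[u' [f NE]]].
    have -> : rigid G e.
      apply/asboolP; exists N => //; apply/and3P; split=> //.
      exact: is_cycle_walk wN.
    lia.
  move: eN; rewrite NE /= !inE orbb => /eqP->; rewrite !eqxx.
  by case: ifP; lia.
have gXY : good v (X ++ Y).
  split; first by apply/walk_catP; exists u.
  move=> e eXY; have := gC e; rewrite eC.
  rewrite (count_memPn _) ?add0n; last by apply: contraTN eXY; apply: eN.
  apply; move: eXY; rewrite CE /unzip2 !map_cat !mem_cat.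
  by move=> /orP[->|->]; rewrite ?orbT.
rewrite CE; apply: (cac_ins _ pN wX wY) => //.
  by apply: IH => //; move: szC; rewrite CE !size_cat; case: (N) N0 => //= ? ?; lia.
move=> x xN; suff xXY : x \notin unzip1 (X ++ Y).
  rewrite inE negb_or xXY andbT.
  have [XY0|XY0] := eqVneq (X ++ Y) [::].
    have uv : v = u by case: (X) XY0 wX => //= _ /eqP.
    case: N N0 {CE pN eC eN} wN uN xN => //= -[y f] N _ /and3P[/eqP-> _ _].
    by rewrite uv => /andP[yN _] xN; apply: contraNneq yN => <-.
  by apply: contraNneq xXY => ->; apply: walk_vertices_subset gXY.1 XY0.
apply/negP => xXY.
have wD : walk u (Y ++ X) u by apply/walk_catP; exists v.
have [||c [sc [e ec eN'] [e' ec' eN''] H]] := second_cycle pN wD _ xN.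
- by move=> e /eN; rewrite /unzip2 !map_cat !mem_cat orbC.
- by move: xXY; rewrite /unzip1 !map_cat !mem_cat orbC.
case: H => [u2|[f fc fN]].
  have sN : simple_cycle G N.
    by apply/and3P; split=> //; apply: is_cycle_walk wN.
  have := same_cycle_edges (cacG e N c sN sc eN' ec).
  by move/(_ e'); rewrite ec' (negbTE eN'').
have fN' : f \in unzip2 N by rewrite -has_pred1 has_count fN.
have := gC f; rewrite eC fN (_ : rigid G f); last by apply/asboolP; exists c.
rewrite CE /unzip2 !map_cat !mem_cat fN' orbT => /(_ isT) /eqP; by rewrite !addSn eqSS.
Qed.

End ClosedWalks.

(** * Simple cycles up to rotation and reversal, and those passing through a newly inserted
    primitive *)

Section SimpleCycles.
Variables (V E : finType) (G : mgraph V E).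
Implicit Types (C D N X Y c : seq (V * E)) (u v w x y : V) (e : E) (p q : V * E).

Lemma rot_rot_ex (T : Type) (s : seq T) a b : exists k, rot a (rot b s) = rot k s.
Proof.
have [sb|bs] := leqP (size s) b; first by exists a; rewrite (rot_oversize sb).
have [sa|as_] := leqP (size s) a; first by exists b; rewrite rot_oversize // size_rot.
by exists (if (a + b <= size s)%N then (a + b)%N else (a + b - size s)%N); rewrite rot_add_mod // ltnW.
Qed.

Lemma rot_inv (T : Type) (s t : seq T) a : t = rot a s -> exists b, s = rot b t.
Proof.
move=> ->; exists (size s - a)%N.
by rewrite -[LHS](rotK a) /rotr size_rot.
Qed.

Lemma zip_rot (T S : Type) k (s : seq T) (t : seq S) : size s = size t ->
  zip (rot k s) (rot k t) = rot k (zip s t).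
Proof.
move=> st; rewrite -[RHS]zip_unzip /unzip1 /unzip2 !map_rot.
by rewrite -/(unzip1 _) -/(unzip2 _) unzip1_zip ?unzip2_zip // st.
Qed.

Lemma uniq_map_inj (T : eqType) (S : eqType) (f : T -> S) (s : seq T) :
  uniq (map f s) -> {in s &, injective f}.
Proof.
elim: s => //= x s IH /andP[xs us] y z; rewrite !inE.
move=> /predU1P[->|ys] /predU1P[->|zs] // fyz; last exact: IH.
- by move: xs; rewrite fyz map_f.
- by move: xs; rewrite -fyz map_f.
Qed.

Lemma rev_cycle_rot k c : exists l, Defs.rev_cycle (rot k c) = rot l (Defs.rev_cycle c).
Proof.
rewrite /Defs.rev_cycle.
have -> : unzip1 (rot k c) = rot k (unzip1 c) by rewrite /unzip1 map_rot.
have -> : unzip2 (rot k c) = rot k (unzip2 c) by rewrite /unzip2 map_rot.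
rewrite !rev_rot; exists (size c - k)%N.
rewrite -zip_rot; last by rewrite size_rotr !size_rev !size_map.
by rewrite {2 3}/rotr -rot_rotr !size_rev !size_map.
Qed.

Lemma rev_cycleK c : Defs.rev_cycle (Defs.rev_cycle c) = c.
Proof.
rewrite {1}/Defs.rev_cycle.
have sz : size (rotr 1 (rev (unzip1 c))) = size (rev (unzip2 c)).
  by rewrite size_rotr !size_rev !size_map.
have -> : unzip1 (Defs.rev_cycle c) = rotr 1 (rev (unzip1 c)).
  by rewrite /Defs.rev_cycle unzip1_zip // sz.
have -> : unzip2 (Defs.rev_cycle c) = rev (unzip2 c).
  by rewrite /Defs.rev_cycle unzip2_zip // sz.
by rewrite rev_rotr !revK rotK zip_unzip.
Qed.

Lemma same_cycle_sym c c' : same_cycle c c' -> same_cycle c' c.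
Proof.
case=> k [/rot_inv|/rot_inv] [l H]; first by exists l; left.
have : c = Defs.rev_cycle (rot l c') by rewrite -H rev_cycleK.
by have [j ->] := rev_cycle_rot l c'; exists j; right.
Qed.

Lemma same_cycle_trans c c' c'' :
  same_cycle c c' -> same_cycle c' c'' -> same_cycle c c''.
Proof.
case=> k [->|->] [l [->|->]].
- by have [j ->] := rot_rot_ex c l k; exists j; left.
- have [i ->] := rev_cycle_rot k c.
  by have [j ->] := rot_rot_ex (Defs.rev_cycle c) l i; exists j; right.
- by have [j ->] := rot_rot_ex (Defs.rev_cycle c) l k; exists j; right.
- have [i ->] := rev_cycle_rot k (Defs.rev_cycle c); rewrite rev_cycleK.
  by have [j ->] := rot_rot_ex c l i; exists j; left.
Qed.

Fixpoint rev_walk C w :=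
  if C is (x, e) :: C' then rcons (rev_walk C' w) (target C' w, e) else [::].

Lemma walk_rev v C w : walk G v C w -> walk G w (rev_walk C w) v.
Proof.
elim: C v => [|[x e] C IH] v /=; first by rewrite eq_sym.
case/and3P => /eqP-> J /IH W; rewrite -cats1; apply/walk_catP.
by exists (target C w); rewrite //= eqxx joins_sym J /= eqxx.
Qed.

Lemma rev_walkE C w : rev_walk C w =
  zip (rev (rcons (behead (unzip1 C)) w)) (rev (unzip2 C)).
Proof.
elim: C => //= -[x e] C IH; rewrite IH.
case: C {IH} => [|[y f] C] //=.
rewrite (rev_cons e) [in RHS]rev_cons zip_rcons //.
by rewrite size_rev size_rcons size_rev /= !size_map.
Qed.

Lemma rev_cycle_walk x e C :
  Defs.rev_cycle ((x, e) :: C) = rev_walk ((x, e) :: C) x.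
Proof.
rewrite rev_walkE /Defs.rev_cycle /= rev_rcons; congr zip.
by rewrite rev_cons rotr1_rcons.
Qed.

Lemma rev_cycle_is_cycle c : is_cycle G c -> is_cycle G (Defs.rev_cycle c).
Proof.
case: c => [//|[x e] C]; rewrite is_cycleE => /walk_rev.
by rewrite -rev_cycle_walk => /is_cycle_walk.
Qed.

Lemma rev_cycle_simple c : simple_cycle G c -> simple_cycle G (Defs.rev_cycle c).
Proof.
case/and3P => /rev_cycle_is_cycle cc u1 u2; apply/and3P; split=> //.
  by rewrite /Defs.rev_cycle unzip1_zip ?rotr_uniq ?rev_uniq // size_rotr !size_rev !size_map.
by rewrite /Defs.rev_cycle unzip2_zip ?rev_uniq // size_rotr !size_rev !size_map.
Qed.

Lemma mem_rev_walk v C w a f : walk G v C w -> (a, f) \in C ->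
  exists2 b, joins G f a b & (b, f) \in rev_walk C w.
Proof.
elim: C v => //= -[z g] C IH v /=.
case/and3P => /eqP-> J W; rewrite inE => /orP[/eqP[-> ->]|/(IH _ W)].
  by exists (target C w); rewrite // mem_rcons inE eqxx.
by case=> b Jb Hb; exists b; rewrite // mem_rcons inE Hb orbT.
Qed.

Lemma mem_rev_cycle c a f : is_cycle G c -> (a, f) \in c ->
  exists2 b, joins G f a b & (b, f) \in Defs.rev_cycle c.
Proof.
by case: c => [//|[x e] C]; rewrite is_cycleE rev_cycle_walk => /mem_rev_walk; apply.
Qed.

Lemma rot_simple k c : simple_cycle G (rot k c) = simple_cycle G c.
Proof. by rewrite /simple_cycle /is_cycle rot_cycle /unzip1 /unzip2 !map_rot !rot_uniq. Qed.

Lemma simple_uniq c : simple_cycle G c -> uniq c.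
Proof. by case/and3P => _ /map_uniq. Qed.

Lemma simple_vinj c p q : simple_cycle G c -> p \in c -> q \in c -> p.1 = q.1 -> p = q.
Proof. by case/and3P => _ u _ pc qc; apply: (uniq_map_inj u). Qed.

Lemma simple_einj c p q : simple_cycle G c -> p \in c -> q \in c -> p.2 = q.2 -> p = q.
Proof. by case/and3P => _ _ u pc qc; apply: (uniq_map_inj u). Qed.

Lemma joins_next c p : simple_cycle G c -> p \in c -> joins G p.2 p.1 (next c p).1.
Proof. by case/and3P => cc _ _ pc; apply: (next_cycle cc pc). Qed.

Lemma joins_prev c p : simple_cycle G c -> p \in c ->
  joins G (prev c p).2 (prev c p).1 p.1.
Proof. by case/and3P => cc _ _ pc; apply: (prev_cycle cc pc). Qed.

Lemma joins_r e x y z : joins G e x y -> joins G e x z -> y = z.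
Proof. by move=> J1 J2; case: (joins_eq J1 J2) => [[_ ->]|[-> ->]]. Qed.

Lemma joins_mem e x y z : joins G e x y -> (z \in G e) = (z == x) || (z == y).
Proof. by rewrite /joins => /eqP->; rewrite !inE. Qed.

Lemma simple_edge_at N q e : simple_cycle G N -> q \in N -> e \in unzip2 N ->
  q.1 \in G e -> e = q.2 \/ e = (prev N q).2.
Proof.
move=> sN qN /mapP [p pN ->] /=; rewrite (joins_mem _ (joins_next sN pN)).
case/orP => /eqP E1; [left | right]; first by rewrite (simple_vinj sN pN qN).
have -> : q = next N p by apply: (simple_vinj sN); rewrite ?mem_next.
by rewrite prev_next // (simple_uniq sN).
Qed.

Lemma pair_eta p q : p.1 = q.1 -> p.2 = q.2 -> p = q.
Proof. by case: p q => [? ?] [? ?] /= -> ->. Qed.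

Section NewCycle.
Variables (N c : seq (V * E)) (h : V * E) (N' : seq (V * E)).
Hypotheses (NE : N = h :: N') (sN : simple_cycle G N) (sc : simple_cycle G c).
Hypothesis fresh : forall e x, e \in unzip2 c -> x \in unzip1 N' -> x \in G e ->
  e \in unzip2 N.

(** By [fresh], at a vertex of [N] other than that of [h] the cycle [c] finds only edges of [N].
    Having arrived there along [N], it can leave only by the next edge of [N]. *)
Lemma simple_next p : p \in c -> p \in N -> next N p != h -> next N p \in c.
Proof.
move=> pc pN nh; set r := next N p; set q := next c p.
have qc : q \in c by rewrite mem_next.
have rN : r \in N by rewrite mem_next.
have Jq := joins_next sc pc; have Jr := joins_next sN pN.
have qr : q.1 = r.1 by apply: joins_r Jq Jr.
have rN' : r.1 \in unzip1 N'.
  by move: rN; rewrite NE inE (negbTE nh) => /(map_f fst).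
have qe : r.1 \in G q.2 by rewrite -qr (joins_mem _ (joins_next sc qc)) eqxx.
have qN : q.2 \in unzip2 N by apply: fresh rN' qe; apply: map_f.
case: (simple_edge_at sN rN qN qe) => E2.
  by rewrite -(pair_eta qr E2).
rewrite prev_next ?(simple_uniq sN) // in E2.
have qp := simple_einj sc qc pc E2.
by rewrite (simple_vinj sN rN pN) // -qr qp.
Qed.

Lemma simple_prev p : p \in c -> p \in N -> p != h -> prev N p \in c.
Proof.
move=> pc pN nh; set r := prev N p; set q := prev c p.
have qc : q \in c by rewrite mem_prev.
have rN : r \in N by rewrite mem_prev.
have Jq := joins_prev sc pc; have Jr := joins_prev sN pN.
have pN' : p.1 \in unzip1 N'.
  by move: pN; rewrite NE inE (negbTE nh) => /(map_f fst).
have qe : p.1 \in G q.2 by rewrite (joins_mem _ Jq) eqxx orbT.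
have qN : q.2 \in unzip2 N by apply: fresh pN' qe; apply: map_f.
case: (simple_edge_at sN pN qN qe) => E2.
  have qp := simple_einj sc qc pc E2.
  have Jn := joins_next sN pN; rewrite -/q qp in Jq.
  have np : next N p = p.
    by apply: (simple_vinj sN); rewrite ?mem_next // (joins_r Jn Jq).
  have rp : prev N (next N p) = p by rewrite prev_next ?(simple_uniq sN).
  by rewrite /r; rewrite np in rp; rewrite rp.
have qr : q.1 = r.1.
  rewrite -/q in Jq; rewrite joins_sym E2 -/r in Jq; rewrite joins_sym -/r in Jr.
  exact: joins_r Jq Jr.
by rewrite -(pair_eta qr E2).
Qed.

(** A common pair propagates backwards along [N] as far as [h], and from [h] forwards around all of
    [N]. The detour is needed because neither [simple_prev] nor [simple_next] passes across [h]. *)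
Lemma simple_subset p : p \in c -> p \in N -> {subset N <= c}.
Proof.
move=> pc pN; have uN := simple_uniq sN.
have hc : h \in c.
  have [k] := ubnP (index p N); elim: k p pc pN => // k IH p pc pN ip.
  have [<-//|ph] := eqVneq p h.
  apply: (IH (prev N p)); rewrite ?simple_prev ?mem_prev //.
  rewrite -ltnS (leq_trans _ ip) // ltnS.
  move: pN uN ph; rewrite NE prev_nth => pN uN ph; rewrite pN.
  rewrite index_uniq //=; first by rewrite eq_sym (negbTE ph).
  by move: pN; rewrite inE (negbTE ph) -index_mem ltnS => /ltnW.
suff: forall k, (k < size N)%N -> nth h N k \in c.
  by move=> H q qN; rewrite -(nth_index h qN) H // index_mem.
elim=> [|k IH] kN; first by rewrite NE.
have kN' := ltnW kN; have nkN := mem_nth h kN'.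
have E1 : next N (nth h N k) = nth h N k.+1.
  by rewrite next_nth nkN index_uniq // NE /=.
rewrite -E1; apply: simple_next; rewrite ?IH // E1.
move: uN kN; rewrite NE /= ltnS => /andP[hN' _] kN.
by apply: contraNneq hN' => <-; rewrite mem_nth.
Qed.

(** On [N] the successor maps of [N] and of [c] agree, as an edge and one of its ends determine the
    other end; both cycles are then the orbit of [h] under one map. *)
Lemma simple_rot : {subset N <= c} -> exists k, N = rot k c.
Proof.
move=> Nc; have hN : h \in N by rewrite NE inE eqxx.
have [k d E1] := rot_to (Nc h hN); exists k; rewrite E1.
have sd : simple_cycle G (h :: d) by rewrite -E1 rot_simple.
have Nd : {subset N <= h :: d} by move=> p /Nc; rewrite -E1 mem_rot.
have nN p : p \in N -> next (h :: d) p = next N p.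
  move=> pN; have pd := Nd _ pN.
  apply: (simple_vinj sd); rewrite ?mem_next ?Nd ?mem_next //.
  exact: joins_r (joins_next sd pd) (joins_next sN pN).
have fN : fcycle (next (h :: d)) N.
  apply: cycle_from_next; first exact: simple_uniq sN.
  by move=> p pN; apply/eqP/nN.
have fd : fcycle (next (h :: d)) (h :: d) by apply: cycle_next; apply: simple_uniq sd.
have ud := simple_uniq sd; have uN := simple_uniq sN.
have := orbitE fN uN hN; rewrite (orbitE fd ud (mem_head h d)).
by rewrite NE /= eqxx !rot0 => ->.
Qed.

End NewCycle.

(** A simple cycle through a new edge has to follow the inserted primitive. If [N] is a cycle, then
    [c] or its reversal shares a pair of a vertex and an edge with [N]. If [N] runs back and forth
    along [f], then [c] would reach the new end [w] and could both arrive and leave only by [f],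
    making [f] a loop. *)
Lemma new_cycle u N c : prim G u N -> simple_cycle G c ->
  (forall e x, e \in unzip2 c -> x \in unzip1 (behead N) -> x \in G e ->
     e \in unzip2 N) ->
  (exists2 e, e \in unzip2 c & e \in unzip2 N) ->
  simple_cycle G N /\ same_cycle N c.
Proof.
move=> [wN N0 uN pN] sc fresh [e ec eN].
case: pN => [u2|[w [f NE]]].
  have sN : simple_cycle G N by apply/and3P; split=> //; apply: is_cycle_walk wN.
  split=> //; case: N N0 => [//|h N'] _ in wN uN fresh eN u2 sN *.
  case/mapP: eN => [[x e'] pN Ee]; rewrite /= in Ee; subst e'.
  case/mapP: ec => [[a e'] pc Ee]; rewrite /= in Ee; subst e'.
  have Jc := joins_next sc pc; have JN := joins_next sN pN.
  apply: same_cycle_sym.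
  case: (joins_eq JN Jc) => /= -[ax E2].
    subst a; have [k Hk] := simple_rot erefl sN sc (simple_subset erefl sN sc fresh pc pN).
    by exists k; left.
  have [b Jb pb] := mem_rev_cycle (proj1 (andP sc)) pc.
  have bx : b = x by apply: joins_r Jb _; rewrite joins_sym -E2 joins_sym.
  subst b; have sr := rev_cycle_simple sc.
  have fresh' e1 x1 : e1 \in unzip2 (Defs.rev_cycle c) ->
      x1 \in unzip1 (behead (h :: N')) -> x1 \in G e1 -> e1 \in unzip2 (h :: N').
    move=> H; apply: fresh; have sE : same_cycle c (Defs.rev_cycle c).
      by exists 0; right; rewrite rot0.
    by rewrite -(same_cycle_edges sE).
  have [k Hk] := simple_rot erefl sN sr (simple_subset erefl sN sr fresh' pb pN).
  by exists k; right.
subst N; exfalso; rewrite /= in fresh uN; move: wN uN; rewrite /= /target /= => wN uN.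
have {eN}ef : e = f by move: eN; rewrite !inE orbb => /eqP.
subst e; case/and3P: wN => _ J1 /and3P[_ J2 _].
have wf e : e \in unzip2 c -> w \in G e -> e = f.
  by move=> ec' /(fresh _ _ ec'); rewrite !inE eqxx orbb => /(_ isT) /eqP.
have uw : u <> w by move=> uw; move: uN; rewrite uw inE eqxx.
case/mapP: ec => [[a e'] pc Ee]; rewrite /= in Ee; subst e'.
have [q qc qw] : exists2 q, q \in c & q.1 = w.
  have Jn := joins_next sc pc.
  case: (joins_eq J1 Jn) => -[E1 E2]; last by exists (a, f).
  by exists (next c (a, f)); rewrite ?mem_next.
have qf : q.2 = f.
  by apply: wf; rewrite ?map_f // (joins_mem _ (joins_next sc qc)) qw eqxx.
have rc : prev c q \in c by rewrite mem_prev.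
have rf : (prev c q).2 = f.
  by apply: wf; rewrite ?map_f // (joins_mem _ (joins_prev sc qc)) qw eqxx orbT.
have := joins_prev sc qc; rewrite (simple_einj sc rc qc) ?rf ?qf // qw => Jw.
by case: (joins_eq J1 Jw) => -[? ?]; apply: uw.
Qed.

End SimpleCycles.

(** * Walks built by insertions are outercycles of cacti *)

Section CactusOfWalk.
Variables (V E : finType) (G : mgraph V E).
Implicit Types (C D N X Y c : seq (V * E)) (u v w x y : V) (e : E).

Lemma walk_ends v C w e x : walk G v C w -> e \in unzip2 C -> x \in G e ->
  x \in w :: unzip1 C.
Proof.
elim: C v => //= -[y f] C IH v /= /and3P[/eqP-> J W].
rewrite inE => /orP[/eqP->|eC xe].
  rewrite (joins_mem _ J) => /orP[] /eqP->; first by rewrite !inE eqxx orbT.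
  by rewrite /target; case: (C) => [|p D]; rewrite /= !inE eqxx ?orbT.
by have := IH _ W eC xe; rewrite !inE => /orP[->|->]; rewrite ?orbT.
Qed.

Lemma cac_walk v C : cac G v C -> walk G v C v.
Proof.
elim=> [|X N Y u _ W [wN _ _ _] wX wY _ _]; first exact: eqxx.
by apply/walk_catP; exists u => //; apply/walk_catP; exists u.
Qed.

(** The graph also contains the edges of later insertions, so both claims concern only cycles within
    the edges of [C]. When [N] is inserted, such a cycle either is [N] up to rotation and reversal
    or uses old edges only, because old edges do not meet the new vertices. *)
Lemma cac_cycles v C : cac G v C ->
  (forall e c c', simple_cycle G c -> simple_cycle G c' ->
    {subset unzip2 c <= unzip2 C} -> {subset unzip2 c' <= unzip2 C} ->
    e \in unzip2 c -> e \in unzip2 c' -> same_cycle c c') /\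
  (forall e, e \in unzip2 C ->
    (exists c, [/\ simple_cycle G c, {subset unzip2 c <= unzip2 C} & e \in unzip2 c])
    /\ count_mem e (unzip2 C) = 1%N \/
    (forall c, simple_cycle G c -> {subset unzip2 c <= unzip2 C} -> e \notin unzip2 c)
    /\ count_mem e (unzip2 C) = 2%N).
Proof.
elim=> [|X N Y u cXY [IH1 IH2] pN wX wY fE fV].
  by split=> // e c c' sc _ sub _ /sub.
have wXY := cac_walk cXY.
have memN e : (e \in unzip2 (X ++ N ++ Y)) = (e \in unzip2 N) || (e \in unzip2 (X ++ Y)).
  by rewrite /unzip2 !map_cat !mem_cat orbCA.
have cntN e : count_mem e (unzip2 (X ++ N ++ Y)) =
    (count_mem e (unzip2 N) + count_mem e (unzip2 (X ++ Y)))%N.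
  by rewrite /unzip2 !map_cat !count_cat addnCA.
have fresh c : {subset unzip2 c <= unzip2 (X ++ N ++ Y)} ->
    forall e x, e \in unzip2 c -> x \in unzip1 (behead N) -> x \in G e -> e \in unzip2 N.
  move=> sub e x /sub; rewrite memN => /orP[//|eXY] xN xe.
  by have := fV _ xN; rewrite (walk_ends wXY eXY xe).
have alt c : simple_cycle G c -> {subset unzip2 c <= unzip2 (X ++ N ++ Y)} ->
    simple_cycle G N /\ same_cycle N c \/ {subset unzip2 c <= unzip2 (X ++ Y)}.
  move=> sc sub; have [/hasP [e ec eN]|/hasPn H] := boolP (has (mem (unzip2 N)) (unzip2 c)).
    by left; apply: new_cycle pN sc (fresh c sub) _; exists e.
  by right=> e ec; have := sub _ ec; rewrite memN => /orP[|//]; move/H: ec => /= /negbTE->.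
split.
  move=> e c c' sc sc' sub sub' ec ec'.
  have [[_ s1]|s1] := alt c sc sub; have [[_ s2]|s2] := alt c' sc' sub'.
  - exact: same_cycle_trans (same_cycle_sym s1) s2.
  - by move: ec; rewrite (same_cycle_edges s1) => /fE; rewrite s2.
  - by move: ec'; rewrite (same_cycle_edges s2) => /fE; rewrite s1.
  - exact: IH1 ec ec'.
move=> e; rewrite memN cntN; case eN: (e \in unzip2 N) => /=.
  move=> _; rewrite (count_memPn (fE _ eN)) addn0.
  have [wN _ uN p2] := pN; case: p2 => [u2|[w [f NE]]].
    left; split; last by rewrite count_uniq_mem // eN.
    exists N; split=> //; last by move=> g; rewrite memN => ->.
    by apply/and3P; split=> //; apply: is_cycle_walk wN.
  right; split; last by move: eN; rewrite NE !inE orbb => /eqP->; rewrite /= !eqxx.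
  move=> c sc sub; have [[sN _]|s2] := alt c sc sub.
    by case/and3P: sN => _ _; rewrite NE /= inE eqxx.
  by apply/negP => /s2; apply/negP; apply: fE.
move=> eXY; rewrite (count_memPn (negbT eN)) add0n.
have [[[c [sc sub ec]] ->]|[H ->]] := IH2 e eXY; [left | right]; split=> //.
  by exists c; split=> // g /sub; rewrite memN orbC => ->.
move=> c sc sub; have [[sN s1]|s2] := alt c sc sub; last exact: H.
by rewrite (same_cycle_edges s1) eN.
Qed.

Lemma walk_connect v C w : walk G v C w ->
  {in unzip1 C, forall x, connect (fun x y => [exists e, joins G e x y]) v x}.
Proof.
elim: C v => //= -[y f] C IH v /= /and3P[/eqP-> J W] x.
rewrite inE => /orP[/eqP->|xC]; first exact: connect0.
apply: connect_trans (IH _ W _ xC).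
by apply: connect1; apply/existsP; exists f.
Qed.

Lemma cac_cactus v C : cac G v C -> (forall x, x \in v :: unzip1 C) ->
  (forall e, e \in unzip2 C) -> cactus G /\ outercycle G C.
Proof.
move=> cC allV allE; have wC := cac_walk cC; have [H1 H2] := cac_cycles cC.
split; first split; first split.
- by apply/card_gt0P; exists v.
- have cs : connect_sym (fun x y => [exists e, joins G e x y]).
    by apply: sym_connect_sym => x y; apply: eq_existsb => e; rewrite joins_sym.
  have cv x : connect (fun x y => [exists e, joins G e x y]) v x.
    have := allV x; rewrite inE => /orP[/eqP->|]; first exact: connect0.
    exact: walk_connect wC _.
  by move=> x y; apply: connect_trans (cv y); rewrite cs.
- by move=> e c c' sc sc' ec ec'; apply: H1 ec ec'.
apply/andP; split; first exact: is_cycle_walk wC.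
apply/forallP => e; case: (H2 e (allE e)) => -[H ->].
  by have [c [sc _ ec]] := H; rewrite (_ : rigid G e) //; apply/asboolP; exists c.
case: ifP => // /asboolP [c sc ec].
by have := H c sc (fun g _ => allE g); rewrite ec.
Qed.

End CactusOfWalk.

(** * Plane trees describing oriented cacti *)

(* A bouquet (sort [true]) is the list of the primitives at a vertex: [Flex t1 t2]
   starts with a bridge to a new vertex carrying the bouquet [t1], and [Cyc c t]
   with a cycle whose other vertices carry the bouquets listed by the chain [c]
   (sort [false], made of [Link]s); [t2] and [t] are the remaining primitives. *)
Inductive tree := Leaf | Flex of tree & tree | Cyc of tree & tree | Link of tree & tree.

HB.instance Definition _ := gen_eqMixin tree.

Fixpoint shaped b t : bool :=
  match t with
  | Leaf => true
  | Flex t1 t2 => [&& b, shaped true t1 & shaped true t2]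
  | Cyc c t => [&& b, shaped false c & shaped true t]
  | Link t c => [&& ~~ b, shaped true t & shaped false c]
  end.

Fixpoint nb_edges t : nat :=
  match t with
  | Leaf => 0
  | Flex t1 t2 | Cyc t1 t2 | Link t1 t2 => (nb_edges t1 + nb_edges t2).+1
  end.

Fixpoint nb_vertices t : nat :=
  match t with
  | Leaf => 0
  | Cyc t1 t2 => nb_vertices t1 + nb_vertices t2
  | Flex t1 t2 | Link t1 t2 => (nb_vertices t1 + nb_vertices t2).+1
  end.

(* In [tour b t v vs es C], the walk [C] of shape [t] starts at [v] for a bouquet
   and ends there in both sorts; [vs] lists the vertices other than [v], and
   [es] the edges.  Distinctness is not built in: it is stated as [uniq (v :: vs)]
   and [uniq es]. *)
Inductive tour (V E : Type) :
  bool -> tree -> V -> seq V -> seq E -> seq (V * E) -> Prop :=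
| tour_leaf b v : tour b Leaf v [::] [::] [::]
| tour_flex t1 t2 v u e vs1 vs2 es1 es2 C1 C2 :
    tour true t1 u vs1 es1 C1 -> tour true t2 v vs2 es2 C2 ->
    tour true (Flex t1 t2) v (u :: vs1 ++ vs2) (e :: es1 ++ es2)
      ((v, e) :: C1 ++ (u, e) :: C2)
| tour_cyc c t v e vs1 vs2 es1 es2 C1 C2 :
    tour false c v vs1 es1 C1 -> tour true t v vs2 es2 C2 ->
    tour true (Cyc c t) v (vs1 ++ vs2) (e :: es1 ++ es2) ((v, e) :: C1 ++ C2)
| tour_link t c v u e vs1 vs2 es1 es2 C1 C2 :
    tour true t u vs1 es1 C1 -> tour false c v vs2 es2 C2 ->
    tour false (Link t c) v (u :: vs1 ++ vs2) (e :: es1 ++ es2)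
      (C1 ++ (u, e) :: C2).

Lemma cat_split (T : Type) (X Y A B : seq T) : X ++ Y = A ++ B ->
  (exists Z, A = X ++ Z /\ Y = Z ++ B) \/
  (exists z Z, X = A ++ z :: Z /\ B = z :: Z ++ Y).
Proof.
elim: X A => [|x X IH] [|a A] /=.
- by move=> ->; left; exists [::].
- by move=> ->; left; exists (a :: A).
- by move=> <-; right; exists x, X.
- case=> <- /IH [[Z [-> ->]]|[z [Z [-> ->]]]]; first by left; exists Z.
  by right; exists z, Z.
Qed.

Lemma perm_insert (T : eqType) (n a b p q : seq T) : perm_eq a (n ++ b) ->
  perm_eq (p ++ a ++ q) (n ++ p ++ b ++ q).
Proof.
move=> /permP H; apply/permP => z; rewrite !count_cat H count_cat; lia.
Qed.

Section Tours.
Variables V E : finType.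
Implicit Types (C D N X Y : seq (V * E)) (u v w x y : V) (e : E)
  (vs : seq V) (es : seq E).

Lemma tour_shaped b t v vs es C : tour b t v vs es C -> shaped b t.
Proof. by elim=> //= *; apply/andP. Qed.

Lemma tour_sizes b t v vs es C : tour b t v vs es C ->
  size vs = nb_vertices t /\ size es = nb_edges t.
Proof.
elim=> //= [? ? ? ? ? vs1 vs2 es1 es2 ? ?|? ? ? ? vs1 vs2 es1 es2 ? ?|? ? ? ? ? vs1 vs2 es1 es2 ? ?]
  _ [s1 s2] _ [s3 s4]; by rewrite !size_cat s1 s2 s3 s4.
Qed.

Lemma tour_exists b t v vs es : shaped b t -> size vs = nb_vertices t -> size es = nb_edges t ->
  exists C, tour b t v vs es C.
Proof.
elim: t b v vs es => [|t1 IH1 t2 IH2|t1 IH1 t2 IH2|t1 IH1 t2 IH2] b v vs es /=.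
- by move=> _ /size0nil-> /size0nil->; exists [::]; constructor.
- case/and3P=> -> s1 s2; case: vs => //= u vs [sv]; case: es => //= e es [se].
  have [||C1 H1] := IH1 true u (take (nb_vertices t1) vs) (take (nb_edges t1) es) s1.
  + by rewrite size_takel // sv leq_addr.
  + by rewrite size_takel // se leq_addr.
  have [||C2 H2] := IH2 true v (drop (nb_vertices t1) vs) (drop (nb_edges t1) es) s2.
  + by rewrite size_drop sv addKn.
  + by rewrite size_drop se addKn.
  exists ((v, e) :: C1 ++ (u, e) :: C2).
  by rewrite -[vs](cat_take_drop (nb_vertices t1)) -[es](cat_take_drop (nb_edges t1)); constructor.
- case/and3P=> -> s1 s2 sv; case: es => //= e es [se].
  have [||C1 H1] := IH1 false v (take (nb_vertices t1) vs) (take (nb_edges t1) es) s1.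
  + by rewrite size_takel // sv leq_addr.
  + by rewrite size_takel // se leq_addr.
  have [||C2 H2] := IH2 true v (drop (nb_vertices t1) vs) (drop (nb_edges t1) es) s2.
  + by rewrite size_drop sv addKn.
  + by rewrite size_drop se addKn.
  exists ((v, e) :: C1 ++ C2).
  by rewrite -[vs](cat_take_drop (nb_vertices t1)) -[es](cat_take_drop (nb_edges t1)); constructor.
- case/and3P=> /negbTE-> s1 s2; case: vs => //= u vs [sv]; case: es => //= e es [se].
  have [||C1 H1] := IH1 true u (take (nb_vertices t1) vs) (take (nb_edges t1) es) s1.
  + by rewrite size_takel // sv leq_addr.
  + by rewrite size_takel // se leq_addr.
  have [||C2 H2] := IH2 false v (drop (nb_vertices t1) vs) (drop (nb_edges t1) es) s2.
  + by rewrite size_drop sv addKn.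
  + by rewrite size_drop se addKn.
  exists (C1 ++ (u, e) :: C2).
  by rewrite -[vs](cat_take_drop (nb_vertices t1)) -[es](cat_take_drop (nb_edges t1)); constructor.
Qed.

Lemma cat_eq_size (T : Type) (a b c d : seq T) : size a = size c ->
  a ++ b = c ++ d -> a = c /\ b = d.
Proof.
by elim: a c => [|x a IH] [|y c] //= [] sz [] -> /(IH _ sz)[-> ->].
Qed.

(** The subtrees fix the sizes of their lists, so [vs] and [es] split in one way only: a tree with
    these two lists encodes a single walk. *)
Lemma tour_fun b t v vs es C C' :
  tour b t v vs es C -> tour b t v vs es C' -> C = C'.
Proof.
move=> H; elim: H C' => {b t v vs es C}.
- by move=> b v C' H; inversion H.
- move=> t1 t2 v u e vs1 vs2 es1 es2 C1 C2 T1 IH1 T2 IH2 C' H.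
  inversion H as [|? ? ? ? ? ? ? ? ? D1 D2 S1 S2| |]; subst.
  have [s1 s2] := tour_sizes T1; have [s1' s2'] := tour_sizes S1.
  do 2! match goal with HH : _ ++ _ = _ ++ _ |- _ =>
    case: (cat_eq_size _ HH); [congruence | move=> ? ? {HH}; subst] end.
  by rewrite (IH1 _ S1) (IH2 _ S2).
- move=> c t v e vs1 vs2 es1 es2 C1 C2 T1 IH1 T2 IH2 C' H.
  inversion H as [| |? ? ? ? ? ? ? ? D1 D2 S1 S2|]; subst.
  have [s1 s2] := tour_sizes T1; have [s1' s2'] := tour_sizes S1.
  do 2! match goal with HH : _ ++ _ = _ ++ _ |- _ =>
    case: (cat_eq_size _ HH); [congruence | move=> ? ? {HH}; subst] end.
  by rewrite (IH1 _ S1) (IH2 _ S2).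
- move=> t1 t2 v u e vs1 vs2 es1 es2 C1 C2 T1 IH1 T2 IH2 C' H.
  inversion H as [| | |? ? ? ? ? ? ? ? ? D1 D2 S1 S2]; subst.
  have [s1 s2] := tour_sizes T1; have [s1' s2'] := tour_sizes S1.
  do 2! match goal with HH : _ ++ _ = _ ++ _ |- _ =>
    case: (cat_eq_size _ HH); [congruence | move=> ? ? {HH}; subst] end.
  by rewrite (IH1 _ S1) (IH2 _ S2).
Qed.

Lemma tour_unzip1 b t v vs es C : tour b t v vs es C ->
  {subset unzip1 C <= if b then v :: vs else vs}.
Proof.
elim=> {b t v vs es C} //.
- move=> t1 t2 v u e vs1 vs2 es1 es2 C1 C2 _ IH1 _ IH2 x /=.
  rewrite /unzip1 map_cat !inE !mem_cat inE => /or4P[->//|/IH1|->|/IH2].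
  + by rewrite !inE => /orP[->|->]; rewrite ?orbT.
  + by rewrite orbT.
  + by rewrite !inE => /orP[->|->]; rewrite ?orbT.
- move=> c t v e vs1 vs2 es1 es2 C1 C2 _ IH1 _ IH2 x /=.
  rewrite /unzip1 map_cat !inE !mem_cat => /or3P[->//|/IH1->|/IH2].
  + by rewrite orbT.
  + by rewrite !inE => /orP[->|->]; rewrite ?orbT.
- move=> t1 t2 v u e vs1 vs2 es1 es2 C1 C2 _ IH1 _ IH2 x /=.
  rewrite /unzip1 map_cat !inE !mem_cat inE => /or3P[/IH1|->//|/IH2->].
  + by rewrite !inE => /orP[->|->]; rewrite ?orbT.
  + by rewrite !orbT.
Qed.

Lemma tour_names b t v vs es C : tour b t v vs es C -> {subset vs <= unzip1 C}.
Proof.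
elim=> {b t v vs es C} //.
- move=> t1 t2 v u e vs1 vs2 es1 es2 C1 C2 _ IH1 _ IH2 x /=.
  rewrite /unzip1 map_cat !inE !mem_cat inE => /or3P[->|/IH1->|/IH2->]; by rewrite ?orbT.
- move=> c t v e vs1 vs2 es1 es2 C1 C2 _ IH1 _ IH2 x /=.
  rewrite /unzip1 map_cat !inE !mem_cat => /orP[/IH1->|/IH2->]; by rewrite ?orbT.
- move=> t1 t2 v u e vs1 vs2 es1 es2 C1 C2 _ IH1 _ IH2 x /=.
  rewrite /unzip1 map_cat !inE !mem_cat inE => /or3P[->|/IH1->|/IH2->]; by rewrite ?orbT.
Qed.

Lemma tour_edges b t v vs es C : tour b t v vs es C -> unzip2 C =i es.
Proof.
elim=> {b t v vs es C} //.
- move=> t1 t2 v u e vs1 vs2 es1 es2 C1 C2 _ IH1 _ IH2 x.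
  by rewrite /unzip2 /= map_cat !inE !mem_cat inE IH1 IH2; case: eqP => //=; rewrite orbF.
- move=> c t v e vs1 vs2 es1 es2 C1 C2 _ IH1 _ IH2 x /=.
  by rewrite /unzip2 /= map_cat !inE !mem_cat IH1 IH2.
- move=> t1 t2 v u e vs1 vs2 es1 es2 C1 C2 _ IH1 _ IH2 x /=.
  by rewrite /unzip2 /= map_cat !inE !mem_cat inE IH1 IH2 orbCA.
Qed.

Lemma tour_target t v vs es C : tour true t v vs es C -> target C v = v.
Proof. by move=> H; inversion H. Qed.

Lemma chain_target c v vs es C w : tour false c v vs es C ->
  (C = [::] /\ c = Leaf) \/ exists u vs', vs = u :: vs' /\ target C w = u.
Proof.
move=> H; inversion H as [| | |t c' v' u e vs1 vs2 es1 es2 C1 C2 T1 T2]; [by left|right].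
exists u, (vs1 ++ vs2); split=> //; rewrite target_cat /=.
exact: tour_target T1.
Qed.

Section Insertion.
Variables (x : V) (N : seq (V * E)) (nvs : seq V) (nes : seq E).
Hypothesis insP : forall t vs es C, tour true t x vs es C ->
  exists t', tour true t' x (nvs ++ vs) (nes ++ es) (N ++ C).

Lemma tour_insert_root t v vs es C : tour true t v vs es C -> v = x ->
  exists t' vs' es', [/\ tour true t' v vs' es' (N ++ C),
    perm_eq vs' (nvs ++ vs) & perm_eq es' (nes ++ es)].
Proof.
move=> T E1; subst v; have [t' T'] := insP T.
by exists t', (nvs ++ vs), (nes ++ es).
Qed.

(** The cut between [X] and [Y] singles out the bouquet being toured at that moment, and the new
    primitive is put in front of what remains of it. For a chain the cut at its very end is
    excluded: the walk is then back at [v], in the bouquet that follows. The lists are known up to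
    order only, since the new names land in their middle. *)
Lemma tour_insert b t v vs es C : tour b t v vs es C ->
  forall X Y, C = X ++ Y -> b || (Y != [::]) -> target Y v = x ->
  exists t' vs' es', [/\ tour b t' v vs' es' (X ++ N ++ Y),
    perm_eq vs' (nvs ++ vs) & perm_eq es' (nes ++ es)].
Proof.
move=> H; elim: H => {b t v vs es C}.
- move=> b v X Y; case: X Y => [|? ?] [|? ?] // _; rewrite orbF => /= -> vx.
  exact: (tour_insert_root (tour_leaf _ true v) vx).
- move=> t1 t2 v u e vs1 vs2 es1 es2 C1 C2 T1 IH1 T2 IH2 X Y CE _ vx.
  case: X CE => [|p X] /= CE.
    subst Y; exact: (tour_insert_root (tour_flex e T1 T2) vx).
  case: CE => <- /esym/cat_split [[Z [C1E YE]]|[z [Z [XE YE]]]].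
    subst C1 Y; rewrite target_cat /= in vx.
    have [t' [vs' [es' [T' pv pe]]]] := IH1 X Z erefl isT vx.
    exists (Flex t' t2), (u :: vs' ++ vs2), (e :: es' ++ es2); split.
    + have -> : (v, e) :: X ++ N ++ Z ++ (u, e) :: C2 =
        (v, e) :: (X ++ N ++ Z) ++ (u, e) :: C2 by rewrite -!catA.
      exact: tour_flex.
    + exact: (perm_insert [:: u] vs2 pv).
    + exact: (perm_insert [:: e] es2 pe).
  case: YE => zE C2E; subst z X.
  have [t' [vs' [es' [T' pv pe]]]] := IH2 Z Y C2E isT vx.
  exists (Flex t1 t'), (u :: vs1 ++ vs'), (e :: es1 ++ es'); split.
  + have -> : (v, e) :: (C1 ++ (u, e) :: Z) ++ N ++ Y =
      (v, e) :: C1 ++ (u, e) :: (Z ++ N ++ Y) by rewrite -!catA.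
    exact: tour_flex.
  + by have := perm_insert (u :: vs1) [::] pv; rewrite !cats0.
  + by have := perm_insert (e :: es1) [::] pe; rewrite !cats0.
- move=> c t v e vs1 vs2 es1 es2 C1 C2 T1 IH1 T2 IH2 X Y CE _ vx.
  case: X CE => [|p X] /= CE.
    subst Y; exact: (tour_insert_root (tour_cyc e T1 T2) vx).
  have H2 Z : C2 = Z ++ Y -> p = (v, e) -> X = C1 ++ Z ->
    exists t' vs' es', [/\ tour true t' v vs' es' (p :: X ++ N ++ Y),
      perm_eq vs' (nvs ++ vs1 ++ vs2) & perm_eq es' (nes ++ e :: es1 ++ es2)].
    move=> C2E -> ->; have [t' [vs' [es' [T' pv pe]]]] := IH2 Z Y C2E isT vx.
    exists (Cyc c t'), (vs1 ++ vs'), (e :: es1 ++ es'); split.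
    + by rewrite -catA; apply: tour_cyc.
    + by have := perm_insert vs1 [::] pv; rewrite !cats0.
    + by have := perm_insert (e :: es1) [::] pe; rewrite !cats0.
  case: CE => /esym pE /esym/cat_split [[Z [C1E YE]]|[z [Z [XE YE]]]]; last first.
    by apply: (H2 (z :: Z)).
  (* A cut exactly at the end of the cycle belongs to the remaining bouquet [t]. *)
  have [Z0|Z0] := eqVneq Z [::].
    move: C1E YE; rewrite Z0 cats0 /= => C1E YE; by apply: (H2 [::]); rewrite ?cats0.
  subst C1 Y p.
  have vx' : target Z v = x by move: vx; case: (Z) Z0.
  have [t' [vs' [es' [T' pv pe]]]] := IH1 X Z erefl Z0 vx'.
  exists (Cyc t' t), (vs' ++ vs2), (e :: es' ++ es2); split.
  + by have := tour_cyc e T' T2; rewrite -!catA.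
  + exact: (perm_insert [::] vs2 pv).
  + exact: (perm_insert [:: e] es2 pe).
- move=> t c v u e vs1 vs2 es1 es2 C1 C2 T1 IH1 T2 IH2 X Y + /= Y0 vx.
  move=> /esym/cat_split [[Z [C1E YE]]|[z [Z [XE YE]]]].
    subst C1 Y; rewrite target_cat /= in vx.
    have [t' [vs' [es' [T' pv pe]]]] := IH1 X Z erefl isT vx.
    exists (Link t' c), (u :: vs' ++ vs2), (e :: es' ++ es2); split.
    + by have := tour_link e T' T2; rewrite -!catA.
    + exact: (perm_insert [:: u] vs2 pv).
    + exact: (perm_insert [:: e] es2 pe).
  case: YE => zE C2E; subst z X.
  have [t' [vs' [es' [T' pv pe]]]] := IH2 Z Y C2E Y0 vx.
  exists (Link t t'), (u :: vs1 ++ vs'), (e :: es1 ++ es'); split.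
  + by have := tour_link e T1 T'; rewrite -!catA.
  + by have := perm_insert (u :: vs1) [::] pv; rewrite !cats0.
  + by have := perm_insert (e :: es1) [::] pe; rewrite !cats0.
Qed.
End Insertion.

Lemma chain_tour v C : exists c, tour false c v (unzip1 C) (unzip2 C) C.
Proof.
elim: C => [|[u e] C [c T]]; first by exists Leaf; apply: tour_leaf.
by exists (Link Leaf c); apply: (tour_link e (tour_leaf _ true u) T).
Qed.

Lemma cac_tour (G : mgraph V E) v C : cac G v C ->
  exists t vs es, [/\ tour true t v vs es C, uniq (v :: vs) & uniq es].
Proof.
elim=> [|X N Y u _ [t [vs [es [T uv ue]]]] [wN N0 uN pN] wX wY fE fV].
  by exists Leaf, [::], [::]; split=> //; apply: tour_leaf.
have tY := walk_target wY.
have fin nvs nes : uniq nvs -> uniq nes -> {subset nvs <= unzip1 (behead N)} ->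
    {subset nes <= unzip2 N} ->
    (forall t vs es C, tour true t u vs es C ->
       exists t', tour true t' u (nvs ++ vs) (nes ++ es) (N ++ C)) ->
    exists t vs es, [/\ tour true t v vs es (X ++ N ++ Y), uniq (v :: vs) & uniq es].
  move=> un1 un2 sub1 sub2 insP.
  have [t' [vs' [es' [T' pv pe]]]] := tour_insert insP T erefl isT tY.
  exists t', vs', es'; split=> //.
    rewrite (perm_uniq (_ : perm_eq _ (nvs ++ v :: vs))); last first.
      by have := perm_insert [:: v] [::] pv; rewrite !cats0.
    rewrite cat_uniq un1 uv andbT andTb; apply/hasPn => x xvs; apply/negP => /sub1 /fV.
    apply/negP; rewrite negbK; move: xvs; rewrite !inE => /orP[->//|/(tour_names T) ->].
    by rewrite orbT.
  rewrite (perm_uniq pe) cat_uniq un2 ue andbT andTb; apply/hasPn => e ees.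
  by apply/negP => /sub2 /fE; rewrite (tour_edges T) ees.
case: pN => [u2|[w [e NE]]].
  case: N N0 => [//|[u' e] N'] _ in wN uN fE fV u2 fin *.
  have /and3P[/eqP E1 _ _] := wN; subst u'; apply: (fin (unzip1 N') (unzip2 ((u, e) :: N'))) => //.
    by case/andP: uN.
  move=> t1 vs1 es1 C1 T1; have [c Tc] := chain_tour u N'.
  by exists (Cyc c t1); apply: tour_cyc.
subst N; apply: (fin [:: w] [:: e]) => //.
  by move=> g; rewrite !inE => ->.
move=> t1 vs1 es1 C1 T1; exists (Flex Leaf t1).
exact: (tour_flex e (tour_leaf _ true w) T1).
Qed.

End Tours.

(** * From trees back to insertions, and unique parsing of walks *)

Section ToursOfCacti.
Variables (V E : finType).
Implicit Types (C D N X Y : seq (V * E)) (u v w x y : V) (e : E)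
  (vs : seq V) (es : seq E).

Section Build.
Variable G : mgraph V E.

Definition fresh_at v X Y vs es :=
  {in vs, forall x, x \notin v :: unzip1 (X ++ Y)} /\
  {in es, forall e, e \notin unzip2 (X ++ Y)}.

(** The vertices of a chain cannot be inserted one by one: the cycle has to come in one piece, and
    the bouquets on it afterwards. Hence the skeleton [sk], the chain stripped of its bouquets;
    wherever [sk] stands in an insertion walk, it may be replaced by the whole chain. *)
Lemma tour_cac b t u vs es N : tour b t u vs es N -> uniq (u :: vs) -> uniq es ->
  if b then walk G u N u -> forall v X Y, cac G v (X ++ Y) -> walk G v X u ->
    walk G u Y v -> fresh_at v X Y vs es -> cac G v (X ++ N ++ Y)
  else walk G (target N u) N u -> exists sk,
    [/\ walk G (target N u) sk u, {subset unzip1 sk <= vs} /\ uniq (unzip1 sk),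
        {subset unzip2 sk <= es} /\ uniq (unzip2 sk) &
        forall v X Y, cac G v (X ++ sk ++ Y) -> walk G v X (target N u) ->
          walk G u Y v -> fresh_at v X Y vs es -> cac G v (X ++ N ++ Y)].
Proof.
elim=> {b t u vs es N}.
- case=> u _ _ /=; first by move=> _ v X Y; rewrite ?cats0.
  move=> _; exists [::]; split=> //=.
- move=> t1 t2 u w e vs1 vs2 es1 es2 C1 C2 T1 IH1 T2 IH2.
  rewrite -cat_cons => uv; rewrite -cat_cons => ue.
  move: (uv); rewrite cons_uniq => /andP[uN]; rewrite cat_uniq => /and3P[u1 /hasPn h12 u2].
  move: (ue); rewrite cat_uniq => /and3P[ue1 /hasPn g12 ue2].
  move=> wN v X Y cXY wX wY [fV fE].
  move: wN; rewrite walk_cons target_cat [target (_ :: _) _]/= (tour_target T1).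
  case/and3P=> _ J1; case/walk_catP=> w' wC1 w2.
  have := walk_target w2; rewrite [target _ _]/= => E1; subst w'.
  move: w2; rewrite walk_cons (tour_target T2) => /and3P[_ J2 wC2].
  have uw : u != w by apply: contraNneq uN => ->; rewrite inE eqxx.
  (* The bare bridge is inserted, then [C1] between its two traversals, then [C2] after them. *)
  have c0 : cac G v (X ++ [:: (u, e); (w, e)] ++ Y).
    apply: (cac_ins cXY _ wX wY).
    + split=> //; last by right; exists w, e.
        by rewrite /= /target /= !eqxx J1 J2.
      by rewrite /= inE uw.
    + by move=> g; rewrite !inE orbb => /eqP->; apply: fE; rewrite inE eqxx.
    + by move=> x; rewrite inE => /eqP->; apply: fV; rewrite inE eqxx.
  have c1 : cac G v ((X ++ [:: (u, e)]) ++ C1 ++ (w, e) :: Y).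
    apply: IH1 => //.
    + by case/andP: ue1.
    + by rewrite -catA.
    + by apply/walk_catP; exists u => //=; rewrite /target /= !eqxx J1.
    + by rewrite walk_cons eqxx (walk_target wY) J2.
    + split=> [x xv|g gv].
        have := fV x; rewrite in_cons mem_cat xv orbT => /(_ isT).
        have xw : x != w by apply: contraTneq u1 => <-; rewrite /= xv.
        have xu : x != u by apply: contraNneq uN => <-; rewrite !inE mem_cat xv !orbT.
        rewrite /unzip1 !map_cat /= !inE !mem_cat !inE !negb_or xw xu.
        by move=> /and3P[-> -> ->].
      have := fE g; rewrite in_cons mem_cat gv orbT => /(_ isT).
      have ge : g != e by apply: contraTneq ue1 => <-; rewrite /= gv.
      rewrite /unzip2 !map_cat /= !mem_cat !inE !negb_or ge.
      by move=> /andP[-> ->].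
  have -> : X ++ ((u, e) :: C1 ++ (w, e) :: C2) ++ Y =
      (X ++ (u, e) :: C1 ++ [:: (w, e)]) ++ C2 ++ Y.
    by rewrite -!catA /= -!catA.
  apply: IH2 => //.
  + by rewrite cons_uniq u2 andbT; apply: contraNN uN; rewrite inE mem_cat => ->; rewrite !orbT.
  + by move: c1; rewrite -!catA /= -!catA.
  + apply/walk_catP; exists u => //; rewrite walk_cons target_cat [target (_ :: _) _]/=.
    rewrite (tour_target T1) eqxx J1 /=; apply/walk_catP; exists w => //=.
    by rewrite /target /= !eqxx J2.
  + split=> [x xv|g gv].
      have := fV x; rewrite in_cons mem_cat xv !orbT => /(_ isT).
      have xw : x \notin w :: vs1 by apply: h12.
      have xu : x != u by apply: contraNneq uN => <-; rewrite !inE mem_cat xv !orbT.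
      have xC1 : x \notin unzip1 C1 by apply: contraNN xw => /(tour_unzip1 T1).
      move: xw; rewrite inE negb_or => /andP[xw _].
      rewrite /unzip1 !map_cat /= !map_cat /= !inE !mem_cat !inE !mem_cat !inE.
      rewrite !negb_or xw xu xC1.
      by move=> /and3P[-> -> ->].
    have := fE g; rewrite in_cons mem_cat gv !orbT => /(_ isT).
    have ge := g12 g gv; move: ge; rewrite inE negb_or => /andP[ge g1].
    have gC1 : g \notin unzip2 C1 by rewrite (tour_edges T1).
    rewrite /unzip2 !map_cat /= !map_cat /= !mem_cat !inE !mem_cat !inE.
    by rewrite !negb_or ge gC1 => /andP[-> ->].
- move=> c t u e vs1 vs2 es1 es2 C1 C2 T1 IH1 T2 IH2.
  move=> uv; rewrite -cat_cons => ue.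
  move: (uv); rewrite cons_uniq => /andP[uN]; rewrite cat_uniq => /and3P[u1 /hasPn h12 u2].
  move: (ue); rewrite cat_uniq => /and3P[ue1 /hasPn g12 ue2].
  move=> wN v X Y cXY wX wY [fV fE].
  move: wN; rewrite walk_cons target_cat (tour_target T2).
  case/and3P=> _ J1; case/walk_catP=> u' wC1 wC2.
  have E1 := walk_target wC2; rewrite (tour_target T2) in E1; subst u'.
  have [||sk [wsk [skv usk] [ske usk2] ins]] := IH1 _ _ wC1.
  + by rewrite cons_uniq u1 andbT; apply: contraNN uN; rewrite mem_cat => ->.
  + by case/andP: ue1.
  have c0 : cac G v (X ++ ((u, e) :: sk) ++ Y).
    apply: (cac_ins cXY _ wX wY).
    + split=> //.
      * by rewrite walk_cons eqxx (walk_target wsk) J1.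
      * rewrite /= usk andbT; apply: contraNN uN => /skv; rewrite mem_cat => ->//.
      * by left; rewrite /= usk2 andbT; case/andP: ue1 => e1 _; apply: contraNN e1 => /ske.
    + move=> g; rewrite inE => /orP[/eqP->|/ske gs]; apply: fE; rewrite inE ?eqxx //.
      by rewrite mem_cat gs orbT.
    + by move=> x /= /skv xs; apply: fV; rewrite mem_cat xs.
  have c1 : cac G v ((X ++ [:: (u, e)]) ++ C1 ++ Y).
    apply: ins => //.
    + by move: c0; rewrite -!catA.
    + by apply/walk_catP; exists u => //=; rewrite /target /= !eqxx J1.
    + split=> [x xv|g gv].
        have := fV x; rewrite mem_cat xv => /(_ isT).
        have xu : x != u by apply: contraNneq uN => <-; rewrite !mem_cat xv.
        rewrite /unzip1 !map_cat /= !inE !mem_cat !inE !negb_or xu.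
        by move=> /and3P[-> -> ->].
      have := fE g; rewrite in_cons mem_cat gv orbT => /(_ isT).
      have ge : g != e by apply: contraTneq ue1 => <-; rewrite /= gv.
      rewrite /unzip2 !map_cat /= !mem_cat !inE !negb_or ge.
      by move=> /andP[-> ->].
  have -> : X ++ ((u, e) :: C1 ++ C2) ++ Y = (X ++ (u, e) :: C1) ++ C2 ++ Y.
    by rewrite -!catA /= -!catA.
  apply: IH2 => //.
  + by rewrite cons_uniq u2 andbT; apply: contraNN uN; rewrite mem_cat => ->; rewrite !orbT.
  + by move: c1; rewrite -!catA.
  + by apply/walk_catP; exists u => //; rewrite walk_cons eqxx J1.
  + split=> [x xv|g gv].
      have := fV x; rewrite mem_cat xv !orbT => /(_ isT).
      have xu : x != u by apply: contraNneq uN => <-; rewrite !mem_cat xv !orbT.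
      have xC1 : x \notin unzip1 C1 by apply: contraNN (h12 x xv) => /(tour_unzip1 T1).
      rewrite /unzip1 !map_cat /= !inE !mem_cat !inE.
      rewrite !negb_or xu xC1.
      by move=> /and3P[-> -> ->].
    have := fE g; rewrite in_cons mem_cat gv !orbT => /(_ isT).
    have ge := g12 g gv; move: ge; rewrite inE negb_or => /andP[ge g1].
    have gC1 : g \notin unzip2 C1 by rewrite (tour_edges T1).
    rewrite /unzip2 !map_cat /= !mem_cat !inE.
    by rewrite !negb_or ge gC1 => /andP[-> ->].
- move=> t c u w e vs1 vs2 es1 es2 C1 C2 T1 IH1 T2 IH2.
  rewrite -cat_cons => uv; rewrite -cat_cons => ue.
  move: (uv); rewrite cons_uniq => /andP[uN]; rewrite cat_uniq => /and3P[u1 /hasPn h12 u2].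
  move: (ue); rewrite cat_uniq => /and3P[ue1 /hasPn g12 ue2].
  rewrite target_cat [target (_ :: _) _]/= (tour_target T1).
  case/walk_catP=> w' wC1 w2.
  have := walk_target w2; rewrite [target _ _]/= => E1; subst w'.
  move: w2; rewrite walk_cons => /and3P[_ J2 wC2].
  have [||sk [wsk [skv usk] [ske usk2] ins]] := IH2 _ _ wC2.
  + by rewrite cons_uniq u2 andbT; apply: contraNN uN; rewrite inE mem_cat => ->; rewrite !orbT.
  + by [].
  exists ((w, e) :: sk); split.
  + by rewrite walk_cons eqxx (walk_target wsk) J2.
  + split=> [x|].
      by rewrite !inE mem_cat => /orP[->//|/skv->]; rewrite !orbT.
    rewrite /= usk andbT; apply/negP => /skv /h12; by rewrite inE eqxx.
  + split=> [x|].
      by rewrite !inE mem_cat => /orP[->//|/ske->]; rewrite !orbT.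
    rewrite /= usk2 andbT; apply/negP => /ske /g12; by rewrite inE eqxx.
  move=> v X Y cXY wX wY [fV fE].
  have c1 : cac G v ((X ++ [:: (w, e)]) ++ C2 ++ Y).
    apply: ins => //.
    + by move: cXY; rewrite -!catA.
    + by apply/walk_catP; exists w => //=; rewrite /target /= !eqxx J2.
    + split=> [x xv|g gv].
        have := fV x; rewrite mem_cat xv orbT => /(_ isT).
        have xw : x \notin w :: vs1 by apply: h12.
        move: xw; rewrite inE negb_or => /andP[xw _].
        rewrite /unzip1 !map_cat /= !inE !mem_cat !inE !negb_or xw.
        by move=> /and3P[-> -> ->].
      have := fE g; rewrite mem_cat gv !orbT => /(_ isT).
      have ge := g12 g gv; move: ge; rewrite inE negb_or => /andP[ge _].
      rewrite /unzip2 !map_cat /= !mem_cat !inE !negb_or ge.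
      by move=> /andP[-> ->].
  have -> : X ++ (C1 ++ (w, e) :: C2) ++ Y = X ++ C1 ++ ((w, e) :: C2 ++ Y).
    by rewrite -!catA.
  apply: IH1 => //.
  + by case/andP: ue1.
  + by move: c1; rewrite -!catA.
  + rewrite -cat_cons; apply/walk_catP; exists u => //.
    by rewrite walk_cons eqxx J2.
  + split=> [x xv|g gv].
      have := fV x; rewrite in_cons mem_cat xv orbT => /(_ isT).
      have xw : x != w by apply: contraTneq u1 => <-; rewrite /= xv.
      have xC2 : x \notin unzip1 C2.
        by apply/negP => /(tour_unzip1 T2) /h12; rewrite inE xv orbT.
      rewrite /unzip1 !map_cat /= !inE !mem_cat !inE !map_cat !mem_cat !negb_or xw xC2.
      by move=> /and3P[-> -> ->].
    have := fE g; rewrite in_cons mem_cat gv orbT => /(_ isT).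
    have ge : g != e by apply: contraTneq ue1 => <-; rewrite /= gv.
    have gC2 : g \notin unzip2 C2.
      by rewrite (tour_edges T2); apply/negP => /g12; rewrite inE gv orbT.
    rewrite /unzip2 !map_cat /= !mem_cat !inE !map_cat !mem_cat !negb_or ge gC2.
    by move=> /andP[-> ->].
Qed.

End Build.

Lemma cat_first (S : eqType) (T : eqType) (f : T -> S) (p q : T) (A B A' B' : seq T) :
  A ++ p :: B = A' ++ q :: B' -> f p = f q ->
  f p \notin map f A -> f p \notin map f A' -> [/\ A = A', p = q & B = B'].
Proof.
elim: A A' => [|a A IH] [|a' A'] /=.
- by case.
- by case=> -> _ _ _; rewrite inE eqxx.
- by case=> -> _ ->; rewrite inE eqxx.
case=> -> H fpq; rewrite !inE !negb_or => /andP[_ n1] /andP[_ n2].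
by have [-> -> ->] := IH _ H fpq n1 n2.
Qed.

Lemma cat_last (S : eqType) (T : eqType) (f : T -> S) (p q : T) (A B A' B' : seq T) :
  A ++ p :: B = A' ++ q :: B' -> f p = f q ->
  f p \notin map f B -> f p \notin map f B' -> [/\ A = A', p = q & B = B'].
Proof.
move=> /(congr1 rev); rewrite !rev_cat !rev_cons !cat_rcons => H fpq n1 n2.
have [||/(congr1 rev) + -> /(congr1 rev)] := cat_first H fpq.
- by rewrite map_rev mem_rev.
- by rewrite map_rev mem_rev.
by rewrite !revK => -> ->.
Qed.

Lemma uniq_flex (T : eqType) (v w : T) a b :
  uniq [:: v, w & a ++ b] -> uniq (w :: a) /\ uniq (v :: b).
Proof.
rewrite /= inE !mem_cat !negb_or cat_uniq.
by move=> /and3P[/and3P[_ _ ->] /andP[-> _] /and3P[-> _ ->]].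
Qed.

Lemma uniq_cyc (T : eqType) (v : T) a b :
  uniq (v :: a ++ b) -> uniq (v :: a) /\ uniq (v :: b).
Proof.
by rewrite /= mem_cat negb_or cat_uniq => /andP[/andP[-> ->] /and3P[-> _ ->]].
Qed.

Lemma uniq_edge (T : eqType) (e : T) a b : uniq (e :: a ++ b) -> uniq a /\ uniq b.
Proof. by rewrite /= cat_uniq => /and4P[_ -> _ ->]. Qed.

(** The walk can be parsed. In a bouquet the first edge recurs exactly when it is a bridge, and its
    second occurrence ends the subtree. In a chain the bouquet at [w] ends with the last departure
    from [w]. Nothing in a chain marks its own end, so the remainders [R] and [R'] are kept: they
    begin at [v] and avoid the vertices of the chain. *)
Lemma tour_inj b t v vs es C : tour b t v vs es C ->
  forall t' vs' es' C' R R', tour b t' v vs' es' C' ->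
  uniq (v :: vs) -> uniq (v :: vs') -> uniq es -> uniq es' ->
  (if b then R = [::] /\ R' = [::] else
   [/\ target R v = v, target R' v = v, {in vs, forall x, x \notin unzip1 R} &
       {in vs', forall x, x \notin unzip1 R'}]) ->
  C ++ R = C' ++ R' -> [/\ t = t', C = C' & R = R'].
Proof.
elim=> {b t v vs es C}.
- case=> v t' vs' es' C' R R' T' _ u' _ _.
    case=> -> ->; inversion T'; subst => //.
  case=> tR tR' _ nR' CE; have [[C0 c0]|[u [ws [E1 E2]]]] := chain_target v T'.
    by subst; split.
  move: u'; rewrite E1 /= inE negb_or => /andP[/andP[vu _] _].
  by case/eqP: vu; rewrite -E2 -tR' -target_cat -CE /= tR.
- move=> t1 t2 v w e vs1 vs2 es1 es2 C1 C2 T1 IH1 T2 IH2 t' vs' es' C' R R' T'.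
  move=> uv uv' ue ue' [-> ->]; rewrite !cats0.
  have e1 : e \notin unzip2 C1.
    by rewrite (tour_edges T1); move: ue => /= /andP[+ _]; rewrite mem_cat negb_or => /andP[].
  inversion T' as [|t1' t2' ? w' e' vs1' vs2' es1' es2' C1' C2' T1' T2'
                   |c t3 ? e' vs1' vs2' es1' es2' C1' C2' T1' T2'|]; subst => //.
    case=> Ee; subst e' => CE.
    have e1' : e \notin unzip2 C1'.
      by rewrite (tour_edges T1'); move: ue' => /= /andP[+ _]; rewrite mem_cat negb_or => /andP[].
    have [E1 [Ew] E2] := cat_first (f := snd) CE erefl e1 e1'.
    subst w' C1' C2'.
    have [u1 u2] := uniq_flex uv; have [u1' u2'] := uniq_flex uv'.
    have [ue1 ue2] := uniq_edge ue; have [ue1' ue2'] := uniq_edge ue'.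
    have [|| -> _ _] := IH1 _ _ _ _ [::] [::] T1' u1 u1' ue1 ue1' => //.
    by have [|| -> _ _] := IH2 _ _ _ _ [::] [::] T2' u2 u2' ue2 ue2'.
  case=> Ee; subst e' => CE.
  suff : e \notin unzip2 (C1' ++ C2').
    by rewrite -CE /unzip2 map_cat mem_cat inE eqxx !orbT.
  rewrite /unzip2 map_cat mem_cat -!/(unzip2 _) (tour_edges T1') (tour_edges T2').
  by move: ue' => /= /andP[+ _]; rewrite mem_cat.
- move=> c t v e vs1 vs2 es1 es2 C1 C2 T1 IH1 T2 IH2 t' vs' es' C' R R' T'.
  move=> uv uv' ue ue' [-> ->]; rewrite !cats0.
  have e1 : e \notin unzip2 (C1 ++ C2).
    rewrite /unzip2 map_cat mem_cat -!/(unzip2 _) (tour_edges T1) (tour_edges T2).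
    by move: ue => /= /andP[+ _]; rewrite mem_cat.
  have [u1 u2] := uniq_cyc uv; have [ue1 ue2] := uniq_edge ue.
  inversion T' as [|t1' t2' ? w' e' vs1' vs2' es1' es2' C1' C2' T1' T2'
                   |c' t3 ? e' vs1' vs2' es1' es2' C1' C2' T1' T2'|]; subst => //.
    case=> Ee; subst e' => CE.
    by move: e1; rewrite CE /unzip2 map_cat mem_cat inE eqxx !orbT.
  case=> Ee; subst e' => CE.
  have [u1' u2'] := uniq_cyc uv'; have [ue1' ue2'] := uniq_edge ue'.
  have cl (t0 : tree) ws vs0 es0 C0 : tour true t0 v vs0 es0 C0 -> uniq (v :: ws ++ vs0) ->
      {in ws, forall x, x \notin unzip1 C0}.
    move=> T0 /= /andP[]; rewrite mem_cat negb_or => /andP[vws _] u0 x xws.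
    apply/negP => /(tour_unzip1 T0); rewrite inE => /orP[/eqP xv|x0].
      by move: vws; rewrite -xv xws.
    by move: u0; rewrite cat_uniq => /and3P[_ /hasPn /(_ x x0)]; rewrite /= xws.
  have [| -> -> E2] := IH1 _ _ _ _ C2 C2' T1' u1 u1' ue1 ue1' _ CE.
    split; rewrite ?(tour_target T2) ?(tour_target T2') //.
      exact: cl T2 uv.
    exact: cl T2' uv'.
  subst C2'.
  by have [|| -> _ _] := IH2 _ _ _ _ [::] [::] T2' u2 u2' ue2 ue2'.
- move=> t c v w e vs1 vs2 es1 es2 C1 C2 T1 IH1 T2 IH2 t' vs' es' C' R R' T'.
  move=> uv uv' ue ue' [tR tR' nR nR'] CE.
  have [C0|[w0 [ws [Ew tC']]]] := chain_target v T'.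
    case: C0 => C0 _; subst C'; move: uv; rewrite /= inE negb_or => /andP[/andP[/eqP[]]].
    rewrite -tR' -[target R' v]/(target ([::] ++ R') v) -CE -catA target_cat.
    by rewrite target_cat (tour_target T1).
  move: Ew tC'; inversion T' as [| | |t0 c' ? w' e' vs1' vs2' es1' es2' C1' C2' T1' T2']; subst => //.
  case=> ? _ tC'; subst w0.
  have Ew : w' = w.
    have : target ((C1 ++ (w, e) :: C2) ++ R) v = w.
      by rewrite -catA target_cat [target (_ :: _) _]/= (tour_target T1).
    by rewrite CE target_cat tR' tC'.
  subst w'.
  have [u1 u2] := uniq_flex uv; have [ue1 ue2] := uniq_edge ue.
  have [u1' u2'] := uniq_flex uv'; have [ue1' ue2'] := uniq_edge ue'.
  have cl (c0 : tree) ws0 es0 C0 R0 : tour false c0 v ws0 es0 C0 ->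
      w \notin ws0 -> w \notin unzip1 R0 -> w \notin unzip1 (C0 ++ R0).
    move=> T0 w0 wR; rewrite /unzip1 map_cat mem_cat negb_or wR andbT.
    by apply: contraNN w0 => /(tour_unzip1 T0).
  have wn vs0 vs3 : uniq [:: v, w & vs0 ++ vs3] -> w \notin vs3.
    by rewrite /= mem_cat negb_or => /and3P[_ /andP[]].
  rewrite -!catA !cat_cons in CE.
  have [||E1 [Ee] E2] := cat_last (f := fst) CE erefl.
  - apply: cl T2 (wn _ _ uv) _; apply: nR; exact: mem_head.
  - apply: cl T2' (wn _ _ uv') _; apply: nR'; exact: mem_head.
  subst e' C1'.
  have [|| -> _ _] := IH1 _ _ _ _ [::] [::] T1' u1 u1' ue1 ue1' => //.
  have [| -> -> ->] := IH2 _ _ _ _ R R' T2' u2 u2' ue2 ue2' _ E2; last by [].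
  by split=> // x xv; [apply: nR | apply: nR']; rewrite inE mem_cat xv !orbT.
Qed.

End ToursOfCacti.

Local Open Scope ring_scope.

(** * Degrees, flexible edges and bipartiteness *)

Fixpoint deg t : nat :=
  match t with Flex _ t => (deg t).+1 | Cyc _ t => (deg t).+2 | _ => 0 end.

Fixpoint nb_flex t : nat :=
  match t with
  | Leaf => 0
  | Flex t1 t2 => (nb_flex t1 + nb_flex t2).+1
  | Cyc t1 t2 | Link t1 t2 => nb_flex t1 + nb_flex t2
  end.

Definition nb_flex_but_first t : nat := if t is Flex t1 t2 then (nb_flex t1 + nb_flex t2)%N else nb_flex t.

Fixpoint links t : nat := if t is Link _ c then (links c).+1 else 0.

(** The cycle of a [Cyc] node has one edge more than its chain has links, so an odd number of links
    means an even cycle. *)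
Fixpoint even_cycles t : bool :=
  match t with
  | Leaf => true
  | Cyc c t => [&& odd (links c), even_cycles c & even_cycles t]
  | Flex t1 t2 | Link t1 t2 => even_cycles t1 && even_cycles t2
  end.

(** The root vertex is left out, as its degree depends on where the bouquet is attached: a bridge
    adds 1 to it, a cycle passing through adds 2. *)
Fixpoint weight (K : comNzRingType) (lam : nat -> K) t : K :=
  match t with
  | Leaf => 1
  | Flex t1 t2 => lam (deg t1).+1 * weight lam t1 * weight lam t2
  | Cyc c t => weight lam c * weight lam t
  | Link t c => lam (deg t).+2 * weight lam t * weight lam c
  end.

Lemma uniq_cat_notin (T : eqType) (v w : T) a b :
  uniq (v :: a) -> uniq (w :: b) -> w \notin v :: a -> v \notin w :: b ->
  uniq (a ++ b) -> 
  (forall x, x \in a -> x \notin w :: b) /\ (forall x, x \in b -> x \notin v :: a).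
Proof.
move=> /andP[va _] /andP[wb _]; rewrite !inE !negb_or => /andP[_ wa] /andP[_ vb].
rewrite cat_uniq => /and3P[_ /hasPn h _]; split=> x xs; rewrite inE negb_or.
  rewrite (_ : x != w) /=; last by apply: contraNneq wa => <-.
  by apply: contraTN xs => /h.
by rewrite h // andbT; apply: contraNneq vb => <-.
Qed.

Lemma uniq_flex_notin (T : eqType) (v w : T) a b : uniq [:: v, w & a ++ b] ->
  [/\ v != w, v \notin w :: a, w \notin v :: b &
   (forall x, x \in a -> x \notin v :: b) /\ (forall x, x \in b -> x \notin w :: a)].
Proof.
move=> U; have : [&& [&& v != w, v \notin a & v \notin b],
    (w \notin a) && (w \notin b) & uniq (a ++ b)].
  by move: U; rewrite /= inE !mem_cat !negb_or.
case/and3P=> [/and3P[vw v1 v2] /andP[w1 w2] u12].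
have vwa : v \notin w :: a by rewrite inE negb_or vw v1.
have wvb : w \notin v :: b by rewrite inE negb_or eq_sym vw w2.
have := u12; rewrite cat_uniq => /and3P[u1 _ u2].
have uwa : uniq (w :: a) by rewrite /= w1.
have uvb : uniq (v :: b) by rewrite /= v2.
by split; [exact: vw | exact: vwa | exact: wvb | exact: (uniq_cat_notin uwa uvb vwa wvb u12)].
Qed.

Lemma uniq_cyc_notin (T : eqType) (v : T) a b : uniq (v :: a ++ b) ->
  (forall x, x \in a -> x \notin v :: b) /\ (forall x, x \in b -> x \notin v :: a).
Proof.
move=> U; have : [&& v \notin a, v \notin b & uniq (a ++ b)].
  by move: U; rewrite /= mem_cat negb_or -andbA.
case/and3P=> va vb; rewrite cat_uniq => /and3P[_ /hasPn h _].
split=> x xs; rewrite inE negb_or.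
  rewrite (_ : x != v) /=; last by apply: contraNneq va => <-.
  by apply: contraTN xs => /h.
by rewrite h // andbT; apply: contraNneq vb => <-.
Qed.

Section TourData.
Variables (V E : finType).
Implicit Types (C D N X Y : seq (V * E)) (u v w x y : V) (e : E)
  (vs : seq V) (es : seq E).

Section Degree.
Variable G : mgraph V E.

Definition edge_degree e x := ((x \in G e) + (G e == [set x]))%N.

Lemma edge_degreeE e x a b : joins G e a b -> edge_degree e x = ((x == a) + (x == b))%N.
Proof.
move=> J; rewrite /edge_degree (joins_mem _ J); move: J; rewrite /joins => /eqP->.
have [->|xa] := eqVneq x a.
  have [<-|ab] /= := eqVneq a b; first by rewrite setUid eqxx.
  case: eqP => // /setP /(_ b); rewrite !inE eqxx orbT /= => /esym.
  by rewrite eq_sym (negbTE ab).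
have [xeq|xb] /= := eqVneq x b.
  rewrite xeq; case: eqP => // /setP /(_ a); rewrite !inE eqxx /= => /esym /eqP ab.
  by rewrite xeq ab eqxx in xa.
case: eqP => // /setP /(_ x); rewrite !inE eqxx.
by rewrite (negbTE xa) (negbTE xb).
Qed.

Definition degree_in es x := (\sum_(e <- es) edge_degree e x)%N.

Lemma degree_in_cons e es x : degree_in (e :: es) x = (edge_degree e x + degree_in es x)%N.
Proof. by rewrite /degree_in big_cons. Qed.

Lemma degree_in_cat es1 es2 x :
  degree_in (es1 ++ es2) x = (degree_in es1 x + degree_in es2 x)%N.
Proof. by rewrite /degree_in big_cat. Qed.

Variables (K : comNzRingType) (lam : nat -> K).

(** The edge leading from [v] into a chain belongs to the enclosing [Cyc] node and is not in [es];
    [d] adds its end at [target C v]. With this convention a chain contributes 1 at [v], the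
    returning end of the cycle, and for a loop that end is the added term itself. *)
Lemma tour_degree b t v vs es C : tour b t v vs es C -> uniq (v :: vs) ->
  walk G (target C v) C v ->
  let d x := ((if b then 0 else (x == target C v) : nat) + degree_in es x)%N in
  [/\ forall x, x \notin v :: vs -> d x = 0%N, d v = if b then deg t else 1%N &
      \prod_(x <- vs) lam (d x) = weight lam t].
Proof.
elim=> {b t v vs es C}.
- move=> b v _ _ /=; rewrite big_nil; split=> //.
    by move=> x; rewrite inE /degree_in big_nil => /negbTE->; case: b.
  by rewrite /degree_in big_nil eqxx; case: b.
- move=> t1 t2 v w e vs1 vs2 es1 es2 C1 C2 T1 IH1 T2 IH2 uv /= W.
  have [u1 u2] := uniq_flex uv.
  move: W; rewrite eqxx target_cat [target (_ :: _) _]/= (tour_target T1) => /and3P[_ J].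
  case/walk_catP=> w' wC1 w2.
  have := walk_target w2; rewrite [target _ _]/= => E1; subst w'.
  move: w2; rewrite walk_cons (tour_target T2) => /and3P[_ _ wC2].
  rewrite (tour_target T1) in IH1; rewrite (tour_target T2) in IH2.
  have [d1 r1 p1] : [/\ forall x, x \notin w :: vs1 -> degree_in es1 x = 0%N,
      degree_in es1 w = deg t1 &
      \prod_(x <- vs1) lam (degree_in es1 x) = weight lam t1] := IH1 u1 wC1.
  have [d2 r2 p2] : [/\ forall x, x \notin v :: vs2 -> degree_in es2 x = 0%N,
      degree_in es2 v = deg t2 &
      \prod_(x <- vs2) lam (degree_in es2 x) = weight lam t2] := IH2 u2 wC2.
  have dE x : degree_in (e :: es1 ++ es2) x =
      ((x == v) + (x == w) + (degree_in es1 x + degree_in es2 x))%N.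
    by rewrite degree_in_cons degree_in_cat (edge_degreeE _ J).
  have [vw v1 w2' [n12 n21]] := uniq_flex_notin uv.
  split.
  + move=> x; rewrite inE inE mem_cat !negb_or => /and4P[xv xw x1 x2].
    by rewrite dE (negbTE xv) (negbTE xw) d1 ?d2 // inE negb_or ?xv ?xw ?x1 ?x2.
  + by rewrite dE eqxx (negbTE vw) d1 // r2.
  + rewrite big_cons big_cat /= dE eqxx eq_sym (negbTE vw) (d2 _ w2') r1 addn0 add0n.
    rewrite -p1 -p2 mulrA; congr (_ * _ * _); apply: eq_big_seq => x xs; rewrite dE.
      have := n12 x xs; rewrite inE negb_or => /andP[xv x2].
      have -> : (x == w) = false by apply: contraTF xs => /eqP->; case/andP: u1.
      by rewrite (negbTE xv) d2 ?addn0 // inE negb_or xv.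
    have := n21 x xs; rewrite inE negb_or => /andP[xw x1].
    have -> : (x == v) = false by apply: contraTF xs => /eqP->; case/andP: u2.
    by rewrite (negbTE xw) d1 // inE negb_or xw.
- move=> c t v e vs1 vs2 es1 es2 C1 C2 T1 IH1 T2 IH2 uv /= W.
  have [u1 u2] := uniq_cyc uv; have [n12 n21] := uniq_cyc_notin uv.
  move: W; rewrite eqxx target_cat (tour_target T2) => /and3P[_ J].
  case/walk_catP=> w' wC1 w2.
  have := walk_target w2; rewrite (tour_target T2) => E1; subst w'.
  rewrite (tour_target T2) in IH2.
  have [d1 r1 p1] := IH1 u1 wC1.
  have [d2 r2 p2] : [/\ forall x, x \notin v :: vs2 -> degree_in es2 x = 0%N,
      degree_in es2 v = deg t &
      \prod_(x <- vs2) lam (degree_in es2 x) = weight lam t] := IH2 u2 w2.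
  have dE x : degree_in (e :: es1 ++ es2) x =
      ((x == v) + ((x == target C1 v) + degree_in es1 x) + degree_in es2 x)%N.
    by rewrite degree_in_cons degree_in_cat (edge_degreeE _ J) !addnA.
  split.
  + move=> x; rewrite inE mem_cat !negb_or => /and3P[xv x1 x2].
    by rewrite dE (negbTE xv) d1 ?d2 // inE negb_or ?xv ?x1 ?x2.
  + by rewrite dE eqxx r1 r2.
  + rewrite big_cat /= -p1 -p2; congr (_ * _); apply: eq_big_seq => x xs; rewrite dE.
      have := n12 x xs; rewrite inE negb_or => /andP[xv x2].
      by rewrite (negbTE xv) d2 ?addn0 // inE negb_or xv.
    have := n21 x xs; rewrite inE negb_or => /andP[xv x1].
    by rewrite (negbTE xv) d1 // inE negb_or xv.
- move=> t c v w e vs1 vs2 es1 es2 C1 C2 T1 IH1 T2 IH2 uv.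
  have [u1 u2] := uniq_flex uv; have [vw v1 w2' [n12 n21]] := uniq_flex_notin uv.
  rewrite target_cat [target (_ :: _) _]/= (tour_target T1).
  case/walk_catP=> w' wC1 w2.
  have := walk_target w2; rewrite [target _ _]/= => E1; subst w'.
  move: w2; rewrite walk_cons => /and3P[_ J wC2].
  rewrite (tour_target T1) in IH1.
  have [d1 r1 p1] : [/\ forall x, x \notin w :: vs1 -> degree_in es1 x = 0%N,
      degree_in es1 w = deg t &
      \prod_(x <- vs1) lam (degree_in es1 x) = weight lam t] := IH1 u1 wC1.
  have [d2 r2 p2] := IH2 u2 wC2.
  have dE x : ((x == w) + degree_in (e :: es1 ++ es2) x =
      ((x == w) + (x == w) + degree_in es1 x) +
      ((x == target C2 v) + degree_in es2 x))%N.
    by rewrite degree_in_cons degree_in_cat (edge_degreeE _ J); ring.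
  split.
  + move=> x; rewrite inE inE mem_cat !negb_or => /and4P[xv xw x1 x2].
    by rewrite dE (negbTE xw) d1 ?d2 // inE negb_or ?xv ?xw ?x1 ?x2.
  + by rewrite dE (negbTE vw) d1 // r2.
  + rewrite big_cons big_cat /= dE eqxx (d2 _ w2') r1 addn0.
    rewrite -p1 -p2 mulrA; congr (_ * _ * _); apply: eq_big_seq => x xs; rewrite dE.
      have := n12 x xs; rewrite inE negb_or => /andP[xv x2].
      have -> : (x == w) = false by apply: contraTF xs => /eqP->; case/andP: u1.
      by rewrite d2 ?addn0 // inE negb_or xv.
    have := n21 x xs; rewrite inE negb_or => /andP[xw x1].
    by rewrite (negbTE xw) d1 // inE negb_or xw.
Qed.

End Degree.

Fixpoint alternates (f : V -> bool) C w : bool :=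
  if C is (x, e) :: C' then (f x != f (target C' w)) && alternates f C' w else true.

Lemma alternates_cat f X Y w :
  alternates f (X ++ Y) w = alternates f X (target Y w) && alternates f Y w.
Proof. by elim: X => //= -[x e] X IH; rewrite IH target_cat andbA. Qed.

Lemma alternates_ext f g C w : {in w :: unzip1 C, f =1 g} ->
  alternates f C w = alternates g C w.
Proof.
elim: C => //= -[x e] C IH fg; rewrite IH; last first.
  by move=> y yC; apply: fg; move: yC; rewrite !inE => /orP[->|->]; rewrite ?orbT.
rewrite (fg x) ?(fg (target C w)) //; last by rewrite !inE eqxx orbT.
by rewrite /target; case: (C) => [|p D]; rewrite /= !inE eqxx ?orbT.
Qed.

Lemma tour_alternates f b t v vs es C : tour b t v vs es C -> alternates f C v ->
  even_cycles t /\ (b \/ (f (target C v) != f v) = odd (links t)).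
Proof.
elim=> {b t v vs es C}.
- by move=> b v _; split=> //; right; rewrite eqxx.
- move=> t1 t2 v w e vs1 vs2 es1 es2 C1 C2 T1 IH1 T2 IH2 /=.
  rewrite alternates_cat /= => /and4P[_ a1 _ a2].
  by have [-> _] := IH1 a1; have [-> _] := IH2 a2; split=> //; left.
- move=> c t v e vs1 vs2 es1 es2 C1 C2 T1 IH1 T2 IH2 /=.
  rewrite alternates_cat target_cat (tour_target T2) => /and3P[a0 a1 a2].
  have [-> [//|<-]] := IH1 a1; have [-> _] := IH2 a2.
  by rewrite eq_sym a0; split=> //; left.
- move=> t c v w e vs1 vs2 es1 es2 C1 C2 T1 IH1 T2 IH2 /=.
  rewrite alternates_cat target_cat /= (tour_target T1) => /and3P[a1 a0 a2].
  have [-> [//|<-]] := IH2 a2; have [-> _] := IH1 a1; split=> //; right.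
  by move: a0; case: (f w); case: (f v); case: (f _).
Qed.

(** The colour at [v] is prescribed so that colourings of subtrees can be glued there. For a cycle,
    [tour_alternates] compares the colour at the start of the chain with that at [v], and the odd
    number of links makes the edge between them alternate. *)
Lemma even_alternates b t v vs es C : tour b t v vs es C -> uniq (v :: vs) ->
  even_cycles t -> forall c0, exists2 f, f v = c0 & alternates f C v.
Proof.
elim=> {b t v vs es C}.
- by move=> b v _ _ c0; exists (fun=> c0).
- move=> t1 t2 v w e vs1 vs2 es1 es2 C1 C2 T1 IH1 T2 IH2 uv /= /andP[o1 o2] c0.
  have [u1 u2] := uniq_flex uv; have [vw v1 w2' [n12 n21]] := uniq_flex_notin uv.
  have [f1 f1w a1] := IH1 u1 o1 (~~ c0); have [f2 f2v a2] := IH2 u2 o2 c0.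
  pose f x := if x \in w :: vs1 then f1 x else f2 x.
  have fv : f v = c0 by rewrite /f (negbTE v1).
  have fw : f w = ~~ c0 by rewrite /f inE eqxx.
  exists f => //; rewrite alternates_cat /= target_cat /= (tour_target T1) (tour_target T2).
  rewrite fv fw (@alternates_ext f f1) ?(@alternates_ext f f2) ?a1 ?a2.
  + by case: (c0).
  + move=> x; rewrite inE => xC; rewrite /f ifN //.
    have : x \in v :: vs2 by case/orP: xC => [/eqP->|/(tour_unzip1 T2)]; rewrite ?inE ?eqxx.
    by rewrite inE => /orP[/eqP->//|/n21].
  + move=> x; rewrite inE => xC; rewrite /f ifT //.
    by case/orP: xC => [/eqP->|/(tour_unzip1 T1)]; rewrite ?inE ?eqxx.
- move=> c t v e vs1 vs2 es1 es2 C1 C2 T1 IH1 T2 IH2 uv /= /and3P[ol o1 o2] c0.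
  have [u1 u2] := uniq_cyc uv; have [n12 n21] := uniq_cyc_notin uv.
  have [f1 f1v a1] := IH1 u1 o1 c0; have [f2 f2v a2] := IH2 u2 o2 c0.
  pose f x := if x \in v :: vs1 then f1 x else f2 x.
  have E1 : {in v :: unzip1 C1, f =1 f1}.
    move=> x; rewrite inE => xC; rewrite /f ifT //.
    by case/orP: xC => [/eqP->|/(tour_unzip1 T1)]; rewrite ?inE ?eqxx // => ->; rewrite orbT.
  have E2 : {in v :: unzip1 C2, f =1 f2}.
    move=> x; rewrite inE => xC; rewrite /f.
    have : x \in v :: vs2 by case/orP: xC => [/eqP->|/(tour_unzip1 T2)]; rewrite ?inE ?eqxx.
    rewrite inE => /orP[/eqP->|/n21/negbTE->//].
    by rewrite inE eqxx f1v f2v.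
  have fv : f v = c0 by rewrite /f inE eqxx.
  exists f => //; rewrite alternates_cat target_cat (tour_target T2).
  have af : alternates f C1 v by rewrite (alternates_ext E1).
  have [_ [//|]] := tour_alternates T1 af; rewrite ol eq_sym => ->.
  by rewrite af (alternates_ext E2).
- move=> t c v w e vs1 vs2 es1 es2 C1 C2 T1 IH1 T2 IH2 uv /= /andP[o1 o2] c0.
  have [u1 u2] := uniq_flex uv; have [vw v1 w2' [n12 n21]] := uniq_flex_notin uv.
  have [f2 f2v a2] := IH2 u2 o2 c0.
  have [f1 f1w a1] := IH1 u1 o1 (~~ f2 (target C2 v)).
  pose f x := if x \in w :: vs1 then f1 x else f2 x.
  have E1 : {in w :: unzip1 C1, f =1 f1}.
    move=> x; rewrite inE => xC; rewrite /f ifT //.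
    by case/orP: xC => [/eqP->|/(tour_unzip1 T1)]; rewrite ?inE ?eqxx.
  have E2 : {in v :: unzip1 C2, f =1 f2}.
    move=> x; rewrite inE => xC; rewrite /f ifN //.
    by case/orP: xC => [/eqP->//|/(tour_unzip1 T2) /n21].
  have fv : f v = c0 by rewrite /f (negbTE v1).
  have fw : f w = f1 w by rewrite /f inE eqxx.
  exists f => //; rewrite alternates_cat /= (alternates_ext E1) (alternates_ext E2) a1 a2.
  rewrite fw f1w E2; first by case: (f2 _).
  by rewrite /target; case: (C2) => [|p D]; rewrite /= !inE eqxx ?orbT.
Qed.

Lemma walk_alternates (G : mgraph V E) v C : walk G v C v ->
  (forall e, e \in unzip2 C) ->
  bipartite G = `[< exists f, alternates f C v >].
Proof.
move=> wC allE; apply/existsP/asboolP => -[f].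
  move=> /forallP H; exists f.
  have {H}H e x y : joins G e x y -> f x != f y.
    by move: (H e) => /forallP/(_ x)/forallP/(_ y)/implyP.
  move: wC {allE}; generalize v at 2 3 => w.
  by elim: C v => //= -[x e] C IH v /and3P[_ J W]; rewrite (H _ _ _ J) (IH _ W).
move=> aC; exists [ffun x => f x]; apply/forallP => e.
apply/forallP => x; apply/forallP => y; apply/implyP; rewrite !ffunE.
have := allE e => {allE}; move: wC aC; generalize v at 2 3 => w.
elim: C v => //= -[z g] C IH v /and3P[_ J W] /andP[fz aC].
rewrite inE => /orP[/eqP->|eC]; last exact: IH W aC eC.
by move=> /(joins_eq J) [[-> ->]|[-> ->]] //; rewrite eq_sym.
Qed.

Lemma tour_bipartite (G : mgraph V E) t v vs es C : tour true t v vs es C ->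
  uniq (v :: vs) -> walk G v C v -> (forall e, e \in unzip2 C) ->
  bipartite G = even_cycles t.
Proof.
move=> T uv wC allE; rewrite (walk_alternates wC allE).
apply/asboolP/idP => [[f /(tour_alternates T) []//]|et].
by have [f _ af] := even_alternates T uv et true; exists f.
Qed.

Lemma tour_size b t v vs es C : tour b t v vs es C -> size C = (nb_edges t + nb_flex t)%N.
Proof.
elim=> //= [? ? ? ? ? ? ? ? ? C1 C2|? ? ? ? ? ? ? ? C1 C2|? ? ? ? ? ? ? ? ? C1 C2];
  move=> _ IH1 _ IH2; rewrite !size_cat /= IH1 IH2; lia.
Qed.

Lemma size_count (T : finType) (s : seq T) : size s = (\sum_x count_mem x s)%N.
Proof.
elim: s => [|a s IH] /=; first by rewrite big1.
rewrite big_split /= -IH (bigD1 a) //= eqxx big1 ?addn0 ?add1n // => x xa.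
by rewrite eq_sym (negbTE xa).
Qed.

(** A double count avoids identifying the flexible edges one by one: an outercycle has one step per
    edge and one more per flexible edge, while the tour has [nb_edges t + nb_flex t] steps. Only the
    first edge has to be examined, and it is flexible exactly for [Flex]. *)
Lemma tour_nflex (G : mgraph V E) t v vs es C : tour true t v vs es C ->
  uniq es -> outercycle G C -> (forall e, e \in es) -> C != [::] ->
  nflex G C = nb_flex_but_first t.
Proof.
move=> T ue /andP[_ /forallP cnt] allE C0.
have nfl : #|[set e | flexible G e]| = nb_flex t.
  have /eqP : size C = (nb_edges t + #|[set e | flexible G e]|)%N.
    rewrite -(size_map snd) -/(unzip2 C) size_count.
    have [_ <-] := tour_sizes T.
    have -> : size es = (\sum_(e : E) 1)%N.
      rewrite sum1_card -(card_uniqP ue); apply: eq_card => e; by rewrite allE.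
    rewrite -sum1_card [X in _ = (_ + X)%N]big_mkcond -big_split /=.
    apply: eq_bigr => e _; rewrite (eqP (cnt e)) inE /flexible.
    by case: (rigid G e).
  by rewrite (tour_size T) eqn_add2l => /eqP.
rewrite /nflex; inversion T as [|t1 t2 ? u e vs1 vs2 es1 es2 C1 C2 T1 T2
  |c t3 ? e vs1 vs2 es1 es2 C1 C2 T1 T2|]; subst => //.
  have fe : flexible G e.
    have := cnt e; rewrite /flexible; case: (rigid G e) => //=.
    by rewrite eqxx /unzip2 map_cat count_cat /= eqxx; lia.
  move: nfl; rewrite (cardsD1 e) inE fe add1n /= => -[<-]; apply: eq_card => g.
  by rewrite !inE andbC; congr (_ && _); apply/idP/idP; apply: contraNN => /eqP => [->//|[->]].
rewrite -[RHS]/(nb_flex (Cyc c t3)) -nfl; apply: eq_card => g; rewrite !inE /=.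
case fg: (flexible G g) => //=; apply/eqP => -[ge]; subst g.
have := cnt e; move: fg; rewrite /flexible; case: (rigid G e) => //= _.
rewrite eqxx (count_memPn _) // /unzip2 map_cat mem_cat.
rewrite -!/(unzip2 _) (tour_edges T1) (tour_edges T2) -mem_cat.
by case/andP: ue.
Qed.

End TourData.

(** * Oriented cacti and trees *)

Lemma tour_map (V E V' E' : Type) (f : V -> V') (g : E -> E') b t v vs es C :
  tour b t v vs es C ->
  tour b t (f v) (map f vs) (map g es) [seq (f p.1, g p.2) | p <- C].
Proof.
elim=> {b t v vs es C} *; rewrite /= ?map_cat /= ?map_cat; by constructor.
Qed.

Lemma walk_map (V E V' E' : finType) (G : mgraph V E) (G' : mgraph V' E')
    (f : V -> V') (g : E -> E') v C w :
  (forall e, G' (g e) = f @: G e) -> walk G v C w ->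
  walk G' (f v) [seq (f p.1, g p.2) | p <- C] (f w).
Proof.
move=> GG; elim: C v => [|[x e] C IH] v /=; first by move/eqP->; rewrite eqxx.
case/and3P=> /eqP-> J W; have := IH _ W.
have -> : target [seq (f p.1, g p.2) | p <- C] (f w) = f (target C w) by case: (C).
move=> ->; rewrite eqxx /= andbT; move: J.
by rewrite /joins GG => /eqP->; rewrite imsetU1 imset_set1.
Qed.

Lemma walk_map_graph (V E V' E' : finType) (G : mgraph V E) (G' : mgraph V' E')
    (f : V -> V') (g : E -> E') v C w e :
  walk G v C w -> walk G' (f v) [seq (f p.1, g p.2) | p <- C] (f w) ->
  e \in unzip2 C -> G' (g e) = f @: G e.
Proof.
elim: C v => [|[x h] C IH] v //= /and3P[_ J W].
have -> : target [seq (f p.1, g p.2) | p <- C] (f w) = f (target C w) by case: (C).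
case/and3P=> _ J' W'; rewrite inE => /orP[/eqP->|]; last exact: IH W W'.
by move: J J'; rewrite /joins => /eqP-> /eqP->; rewrite imsetU1 imset_set1.
Qed.

Section Renaming.
Variables (S S' : eqType) (d : S') (s : seq S) (s' : seq S').
Definition rename x := nth d s' (index x s).
Hypotheses (us : uniq s) (us' : uniq s') (ss' : size s = size s').

Lemma map_rename : map rename s = s'.
Proof.
apply: (@eq_from_nth _ d); rewrite ?size_map // => i i_s.
have [x0] : exists x0 : S, true by case: s i_s => // x0; exists x0.
by move=> _; rewrite (nth_map x0) // /rename index_uniq.
Qed.

End Renaming.

Lemma renameK (S S' : eqType) (d : S) (d' : S') (s : seq S) (s' : seq S') :
  uniq s' -> size s = size s' -> (forall x, x \in s) ->
  cancel (rename d' s s') (rename d s' s).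
Proof.
move=> us' ss' alls x; rewrite /rename index_uniq ?nth_index // -ss'.
by rewrite index_mem.
Qed.

Definition full_tour (V E : finType) (t : tree) v (vs : seq V) (es : seq E) C :=
  [/\ tour true t v vs es C, uniq (v :: vs), uniq es,
      forall x, x \in v :: vs & forall e, e \in es].

Lemma tour_walk (V E : finType) (G : mgraph V E) t v vs es C :
  tour true t v vs es C -> is_cycle G C -> walk G v C v.
Proof.
by move=> T; inversion T; subst; rewrite ?is_cycleE //= eqxx.
Qed.

(** Matching the lists of the two tours by position carries one walk to the other by [tour_fun]; it
    is a graph isomorphism because every edge occurs on the walk, where its ends can be read. *)
Lemma full_tour_iso (V E V' E' : finType) (G : mgraph V E) (G' : mgraph V' E')
    t v vs es C v' vs' es' C' :
  full_tour t v vs es C -> full_tour t v' vs' es' C' ->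
  is_cycle G C -> is_cycle G' C' -> C != [::] -> oriented_iso G C G' C'.
Proof.
move=> [T uv ue av ae] [T' uv' ue' av' ae'] cC cC' C0.
have [s1 s2] := tour_sizes T; have [s1' s2'] := tour_sizes T'.
have sv : size (v :: vs) = size (v' :: vs') by rewrite /= s1 s1'.
have se : size es = size es' by rewrite s2 s2'.
have [e0 _] : exists e0, e0 \in es.
  by case: C C0 {cC T} => // -[x e] C _; exists e.
have [e0' _] : exists e0', e0' \in es'.
  have : size es != 0 by apply/eqP => /size0nil E1; have := ae e0; rewrite E1.
  by rewrite se; case: (es') => // e0' ?; exists e0'; rewrite inE eqxx.
pose f := rename v' (v :: vs) (v' :: vs').
pose g := rename e0' es es'.
have fE : f v :: map f vs = v' :: vs' := map_rename v' uv sv.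
have [fv fvs] : f v = v' /\ map f vs = vs' by case: fE.
have gE : map g es = es' := map_rename e0' ue se.
have C'E : C' = [seq (f p.1, g p.2) | p <- C].
  apply: (tour_fun T'); have := tour_map f g T.
  by rewrite fv fvs gE.
exists f, g; split=> //.
- by exists (rename v (v' :: vs') (v :: vs)); apply: renameK.
- by exists (rename e0 es' es); apply: renameK.
move=> e; apply: (walk_map_graph (tour_walk T cC)); last by rewrite (tour_edges T).
by rewrite -C'E fv; apply: tour_walk T' cC'.
Qed.

(** * Realising a tree as a graph with an outercycle *)

Section GraphOfEnds.
Variables (V E : finType).
Implicit Types (h : E -> V * V) (C : seq (V * E)) (v w x y : V).

Lemma ends_subproof h :
  [forall e, (0 < #|[ffun e => [set (h e).1; (h e).2]] e| <= 2)%N].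
Proof. by apply/forallP => e; rewrite ffunE cards2; case: eqP. Qed.

Definition graph_of h : mgraph V E := MGraph (ends_subproof h).

Lemma joins_graph_of h e x y : h e = (x, y) -> joins (graph_of h) e x y.
Proof. by move=> hE; rewrite /joins /= ffunE hE. Qed.

Lemma walk_ext (G G' : mgraph V E) v C w :
  (forall e, e \in unzip2 C -> G e = G' e) -> walk G v C w = walk G' v C w.
Proof.
elim: C v => //= -[x e] C IH v GG; rewrite IH /joins.
  by rewrite GG // inE eqxx.
by move=> g gC; apply: GG; rewrite inE gC orbT.
Qed.

Lemma graph_of_ext h h' e : h e = h' e -> graph_of h e = graph_of h' e.
Proof. by move=> hh; rewrite /= !ffunE hh. Qed.

(** The ends of an edge are prescribed at the node that introduces it; distinctness of [es] keeps
    the prescriptions compatible. A chain is toured from [target C v], since the edge entering it is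
    introduced by the enclosing [Cyc]. *)
Lemma tour_graph b t v vs es C : tour b t v vs es C -> uniq es ->
  exists h, walk (graph_of h) (target C v) C v.
Proof.
elim=> {b t v vs es C}.
- by move=> b v _; exists (fun=> (v, v)); rewrite /= eqxx.
- move=> t1 t2 v w e vs1 vs2 es1 es2 C1 C2 T1 IH1 T2 IH2 ue.
  have [u1 u2] := uniq_edge ue; have [n12 n21] := uniq_cyc_notin ue.
  have [h1 W1] := IH1 u1; have [h2 W2] := IH2 u2.
  rewrite (tour_target T1) in W1; rewrite (tour_target T2) in W2.
  pose h g := if g == e then (v, w) else if g \in es1 then h1 g else h2 g.
  have he : h e = (v, w) by rewrite /h eqxx.
  have {}W1 : walk (graph_of h) w C1 w.
    rewrite (@walk_ext _ (graph_of h1)) // => g; rewrite (tour_edges T1) => g1.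
    apply: graph_of_ext; rewrite /h g1 ifN //.
    by apply: contraTneq g1 => ->; case/andP: ue; rewrite mem_cat negb_or => /andP[].
  have {}W2 : walk (graph_of h) v C2 v.
    rewrite (@walk_ext _ (graph_of h2)) // => g; rewrite (tour_edges T2) => g2.
    apply: graph_of_ext; have := n21 g g2; rewrite inE negb_or /h => /andP[/negbTE-> /negbTE->] //.
  exists h; rewrite [target _ _]/= walk_cons eqxx target_cat [target (_ :: _) _]/=.
  rewrite (tour_target T1) (joins_graph_of he) /=; apply/walk_catP; exists w => //.
  by rewrite walk_cons eqxx (tour_target T2) joins_sym (joins_graph_of he).
- move=> c t v e vs1 vs2 es1 es2 C1 C2 T1 IH1 T2 IH2 ue.
  have [u1 u2] := uniq_edge ue; have [n12 n21] := uniq_cyc_notin ue.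
  have [h1 W1] := IH1 u1; have [h2 W2] := IH2 u2.
  rewrite (tour_target T2) in W2.
  pose h g := if g == e then (v, target C1 v) else if g \in es1 then h1 g else h2 g.
  have he : h e = (v, target C1 v) by rewrite /h eqxx.
  have {}W1 : walk (graph_of h) (target C1 v) C1 v.
    rewrite (@walk_ext _ (graph_of h1)) // => g; rewrite (tour_edges T1) => g1.
    apply: graph_of_ext; rewrite /h g1 ifN //.
    by apply: contraTneq g1 => ->; case/andP: ue; rewrite mem_cat negb_or => /andP[].
  have {}W2 : walk (graph_of h) v C2 v.
    rewrite (@walk_ext _ (graph_of h2)) // => g; rewrite (tour_edges T2) => g2.
    apply: graph_of_ext; have := n21 g g2; rewrite inE negb_or /h => /andP[/negbTE-> /negbTE->] //.
  exists h; rewrite [target _ _]/= walk_cons eqxx target_cat (tour_target T2).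
  by rewrite (joins_graph_of he) /=; apply/walk_catP; exists v.
- move=> t c v w e vs1 vs2 es1 es2 C1 C2 T1 IH1 T2 IH2 ue.
  have [u1 u2] := uniq_edge ue; have [n12 n21] := uniq_cyc_notin ue.
  have [h1 W1] := IH1 u1; have [h2 W2] := IH2 u2.
  rewrite (tour_target T1) in W1.
  pose h g := if g == e then (w, target C2 v) else if g \in es1 then h1 g else h2 g.
  have he : h e = (w, target C2 v) by rewrite /h eqxx.
  have {}W1 : walk (graph_of h) w C1 w.
    rewrite (@walk_ext _ (graph_of h1)) // => g; rewrite (tour_edges T1) => g1.
    apply: graph_of_ext; rewrite /h g1 ifN //.
    by apply: contraTneq g1 => ->; case/andP: ue; rewrite mem_cat negb_or => /andP[].
  have {}W2 : walk (graph_of h) (target C2 v) C2 v.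
    rewrite (@walk_ext _ (graph_of h2)) // => g; rewrite (tour_edges T2) => g2.
    apply: graph_of_ext; have := n21 g g2; rewrite inE negb_or /h => /andP[/negbTE-> /negbTE->] //.
  exists h; rewrite target_cat [target (_ :: _) _]/= (tour_target T1).
  by apply/walk_catP; exists w => //; rewrite walk_cons eqxx (joins_graph_of he).
Qed.

End GraphOfEnds.

Lemma full_tour_cactus (V E : finType) (G : mgraph V E) t v vs es C :
  full_tour t v vs es C -> walk G v C v -> cactus G /\ outercycle G C.
Proof.
move=> [T uv ue av ae] W.
have cC : cac G v C.
  have ins := tour_cac G T uv ue; rewrite /= in ins.
  have := ins W v [::] [::]; rewrite /= cats0 eqxx; apply=> //; first exact: cac0.
  split=> [x xv|e] //=; rewrite inE; apply: contraTneq xv => ->.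
  by case/andP: uv.
apply: (cac_cactus cC).
  by move=> x; have := av x; rewrite !inE => /orP[->//|/(tour_names T)->]; rewrite orbT.
by move=> e; rewrite (tour_edges T).
Qed.

Lemma cactus_full_tour (V E : finType) (G : mgraph V E) C :
  cactus G -> outercycle G C -> (0 < #|E|)%N ->
  exists t v vs es, full_tour t v vs es C /\ walk G v C v.
Proof.
move=> cG oC /card_gt0P [e0 _].
have [cycC /forallP cnt] := andP oC.
have aC e : e \in unzip2 C.
  by rewrite -has_pred1 has_count (eqP (cnt e)); case: ifP.
have [v W] : exists v, walk G v C v.
  case: (C) cycC (aC e0) => // -[x e] D; rewrite is_cycleE => W _; by exists x.
have gC : good G v C by split=> // e _; apply/eqP/cnt.
have cC := good_cac cG gC.
have [t [vs [es [T uv ue]]]] := cac_tour cC.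
exists t, v, vs, es; split=> //; split=> //; last by move=> e; rewrite -(tour_edges T).
(* A path from [v] in the connected graph stays on the walk, because all its edges occur in [C]. *)
have aV x : x \in v :: unzip1 C.
  have [[_ con] _] := cG; have /connectP [p] := con v x.
  have : v \in v :: unzip1 C by rewrite inE eqxx.
  elim: p {1 3 4}v => [|z p IH] y yC /=; first by move=> _ ->.
  case/andP=> /existsP [e J] pp lx; apply: IH pp lx.
  by apply: walk_ends W (aC e) _; rewrite (joins_mem _ J) eqxx orbT.
by move=> x; have := aV x; rewrite !inE => /orP[->//|/(tour_unzip1 T)]; rewrite inE.
Qed.

Lemma nV_nE t : (nb_vertices t <= nb_edges t)%N.
Proof. by elim: t => //= *; lia. Qed.

Lemma nF_nE t : (nb_flex t <= nb_edges t)%N.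
Proof. by elim: t => //= *; lia. Qed.

(** * The bijection between classes of oriented cacti and trees *)

Section OrientedCactiOfTrees.
Variable n : nat.
Hypothesis n_gt0 : (0 < n)%N.

Definition has_tree (x : ocactus n) t :=
  exists v vs es, full_tour t v vs es (oc_cycle x) /\ walk (oc_graph x) v (oc_cycle x) v.

Lemma ocactus_cactus (x : ocactus n) :
  cactus (oc_graph x) /\ outercycle (oc_graph x) (oc_cycle x).
Proof. by case: x => x xP; apply/asboolP. Qed.

Lemma has_tree_exists (x : ocactus n) : exists t, has_tree x t.
Proof.
have [cG oC] := ocactus_cactus x.
have [|t [v [vs [es [F W]]]]] := cactus_full_tour cG oC; first by rewrite card_ord.
by exists t, v, vs, es.
Qed.

Lemma tree_exists t : shaped true t -> nb_edges t = n -> exists x, has_tree x t.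
Proof.
move=> st nt; have mn : ((nb_vertices t).+1 < n.+2)%N by rewrite !ltnS -nt nV_nE.
pose m := Ordinal mn; pose V := 'I_m; pose v : V := @ord0 (nb_vertices t).
pose vs : seq V := [seq lift ord0 i | i <- enum 'I_(nb_vertices t)].
have [||C T] := @tour_exists V 'I_n true t v vs (enum 'I_n) st.
- by rewrite size_map size_enum_ord.
- by rewrite size_enum_ord nt.
have [h W] := tour_graph T (enum_uniq _).
rewrite (tour_target T) in W.
have F : full_tour t v vs (enum 'I_n) C.
  split=> //.
  - rewrite cons_uniq map_inj_uniq ?enum_uniq; last exact: lift_inj.
    by rewrite andbT; apply/mapP => -[i _ /(congr1 val)].
  - exact: enum_uniq.
  - move=> x; rewrite inE; case: (unliftP ord0 x) => [j ->|->]; last by rewrite eqxx.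
    by rewrite map_f ?orbT // mem_enum.
  - by move=> e; rewrite mem_enum.
have szC : (size C <= n.*2)%N.
  by rewrite (tour_size T) -nt -addnn leq_add2l nF_nE.
pose x0 : pre_ocactus n := @Tagged _ m (fun m : 'I_n.+2 => mgraph 'I_m 'I_n * (n.*2).-bseq ('I_m * 'I_n))%type
   (graph_of h, Bseq szC).
have x0P : is_ocactus x0 by apply/asboolP; apply: full_tour_cactus F W.
by exists (exist _ x0 x0P), v, vs, (enum 'I_n).
Qed.

Lemma has_tree_neq0 (x : ocactus n) : oc_cycle x != [::].
Proof.
have [_ /andP[_ /forallP cnt]] := ocactus_cactus x.
apply/eqP => x0; have := cnt (Ordinal n_gt0); rewrite x0 /=.
by case: ifP.
Qed.

Lemma has_tree_iso x y t : has_tree x t -> has_tree y t -> oc_iso x y.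
Proof.
move=> [v [vs [es [F W]]]] [v' [vs' [es' [F' W']]]]; apply/asboolP.
apply: full_tour_iso F F' _ _ (has_tree_neq0 x); [exact: is_cycle_walk W | exact: is_cycle_walk W'].
Qed.

Lemma oc_iso_has_tree x y t : oc_iso x y -> has_tree x t -> has_tree y t.
Proof.
move=> /asboolP [f [g [bf bg GG CC]]] [v [vs [es [[T uv ue av ae] W]]]].
exists (f v), (map f vs), (map g es); rewrite CC; split; last exact: walk_map W.
split.
- exact: tour_map.
- by rewrite -map_cons map_inj_uniq //; apply: bij_inj.
- by rewrite map_inj_uniq //; apply: bij_inj.
- by case: bf => f' fK f'K z; rewrite -map_cons -[z]f'K map_f.
- by case: bg => g' gK g'K z; rewrite -[z]g'K map_f.
Qed.

Lemma has_tree_uniq x t t' : has_tree x t -> has_tree x t' -> t = t'.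
Proof.
move=> [v [vs [es [[T uv ue _ _] W]]]] [v' [vs' [es' [[T' uv' ue' _ _] W']]]].
have vv : v = v'.
  by rewrite -(walk_target W) -(walk_target W'); case: (oc_cycle x) (has_tree_neq0 x).
subst v'; by have [] := tour_inj T (R := [::]) (R' := [::]) T' uv uv' ue ue' (conj erefl erefl) erefl.
Qed.

Lemma has_tree_shape x t : has_tree x t -> shaped true t && (nb_edges t == n).
Proof.
move=> [v [vs [es [[T uv ue _ ae] W]]]]; rewrite (tour_shaped T) /=.
have [_ <-] := tour_sizes T; rewrite -(card_uniqP ue) -[X in _ == X]card_ord.
by apply/eqP; apply: eq_card => e; rewrite ae.
Qed.

Definition tree_of (q : OCG n) : tree := projT1 (cid (has_tree_exists (repr q))).

Lemma tree_ofP q : has_tree (repr q) (tree_of q).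
Proof. by rewrite /tree_of; case: cid. Qed.

Lemma tree_of_inj : injective tree_of.
Proof.
move=> q q' E1; rewrite -[q]reprK -[q']reprK; apply/eqmodP.
by apply: has_tree_iso (tree_ofP q) _; rewrite E1; apply: tree_ofP.
Qed.

Lemma tree_of_surj t : shaped true t -> nb_edges t = n -> exists q, tree_of q = t.
Proof.
move=> st nt; have [x xt] := tree_exists st nt; exists (\pi_(OCG n) x)%qT.
apply: has_tree_uniq (tree_ofP _) _; apply: oc_iso_has_tree xt.
by rewrite oc_iso_sym; apply/eqmodP; rewrite reprK.
Qed.

Variables (K : comNzRingType) (lam : nat -> K).

Lemma ocactus_term x t : has_tree x t ->
  [/\ bipartite (oc_graph x) = even_cycles t,
      nflex (oc_graph x) (oc_cycle x) = nb_flex_but_first t &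
      \prod_v lam (mdegree (oc_graph x) v) = lam (deg t) * weight lam t].
Proof.
move=> [v [vs [es [[T uv ue av ae] W]]]]; have [cG oC] := ocactus_cactus x.
have aC e : e \in unzip2 (oc_cycle x) by rewrite (tour_edges T).
split; first exact: tour_bipartite T uv W aC.
  exact: tour_nflex T ue oC ae (has_tree_neq0 x).
have W' : walk (oc_graph x) (target (oc_cycle x) v) (oc_cycle x) v by rewrite (tour_target T).
have [_ dv pv] : [/\ forall z, z \notin v :: vs -> degree_in (oc_graph x) es z = 0%N,
    degree_in (oc_graph x) es v = deg t &
    \prod_(z <- vs) lam (degree_in (oc_graph x) es z) = weight lam t] :=
  tour_degree lam T uv W'.
have pe : perm_eq (index_enum 'I_n) es.
  apply: uniq_perm => // [|e]; first exact: index_enum_uniq.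
  by rewrite ae mem_index_enum.
have mE z : mdegree (oc_graph x) z = degree_in (oc_graph x) es z.
  rewrite /degree_in -(perm_big _ pe) /= big_split /=; congr (_ + _)%N.
    by rewrite -sum1_card big_mkcond; apply: eq_bigr => e _; rewrite inE; case: ifP.
  by rewrite -sum1_card big_mkcond; apply: eq_bigr => e _; rewrite inE; case: ifP.
have pV : perm_eq (index_enum 'I_(oc_order x)) (v :: vs).
  apply: uniq_perm => // [|z]; first exact: index_enum_uniq.
  by rewrite av mem_index_enum.
rewrite (perm_big _ pV) /= big_cons mE dv -pv.
by congr (_ * _); apply: eq_bigr => z _; rewrite mE.
Qed.

Lemma OCG_sum (TL : seq tree) : uniq TL ->
  (forall t, (t \in TL) = shaped true t && (nb_edges t == n)) ->
  \sum_(q : OCG n | bipartite (OCG_graph q))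
     2 ^+ (nflex (OCG_graph q) (OCG_cycle q)).+1 *
     \prod_v lam (mdegree (OCG_graph q) v) =
  \sum_(t <- TL | even_cycles t) 2 ^+ (nb_flex_but_first t).+1 * (lam (deg t) * weight lam t).
Proof.
move=> uTL memTL.
have pT : perm_eq TL (map tree_of (index_enum (OCG n))).
  apply: uniq_perm => // [|t].
    by rewrite map_inj_uniq ?index_enum_uniq //; apply: tree_of_inj.
  rewrite memTL; apply/andP/mapP => [[st /eqP nt]|[q _ ->]].
    by have [q <-] := tree_of_surj st nt; exists q; rewrite ?mem_index_enum.
  exact/andP/(has_tree_shape (tree_ofP q)).
rewrite (perm_big _ pT) /= big_map; apply: eq_big => q.
  by have [-> _ _] := ocactus_term (tree_ofP q).
by move=> _; have [_ <- <-] := ocactus_term (tree_ofP q).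
Qed.

End OrientedCactiOfTrees.

(** * Sums over non-crossing partitions *)

(** Weighted Lukasiewicz paths of [n] steps from height [h] down to 0: a step up by k has weight
    lambda_(k+1) and opens a block of size k + 1 (level steps are singletons), a step down has
    weight 1. [D] bounds the size of blocks. *)
Fixpoint path_sum (K : comNzRingType) (lam : nat -> K) (D n h : nat) : K :=
  if n is n'.+1 then
    \sum_(k < D) lam k.+1 * path_sum lam D n' (k + h) +
    (if h is h'.+1 then path_sum lam D n' h' else 0)
  else (h == 0%N)%:R.

Section NoncrossingSum.
Variable n : nat.
Implicit Types (P : {set {set 'I_n}}) (S H U V W : {set 'I_n}) (x y z : 'I_n).

Lemma noncrossingP P :
  reflect (forall V W i j k l, V \in P -> W \in P -> i \in V -> j \in W ->
             k \in V -> l \in W -> (i < j)%N -> (j < k)%N -> (k < l)%N -> V = W)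
    (noncrossing P).
Proof.
apply: (iffP forall_inP) => [H V W i j k l VP WP iV jW kV lW ij jk kl|H V VP].
  have /forall_inP/(_ W WP)/implyP := H V VP.
  case: eqVneq => // _ /(_ isT)/negP[].
  by apply/exists_inP; exists i => //; apply/exists_inP; exists j => //;
    apply/exists_inP; exists k => //; apply/exists_inP; exists l; rewrite ?ij ?jk.
apply/forall_inP => W WP; apply/implyP => VW; apply/negP.
case/exists_inP => i iV /exists_inP[j jW /exists_inP[k kV /exists_inP[l lW /and3P[ij jk kl]]]].
by move: VW; rewrite (H V W i j k l) ?eqxx.
Qed.

Definition straddles V H :=
  [exists y in V, exists x in H, exists z in V, (y < x < z)%N].

Lemma straddlesP V H : reflect (exists y x z,
  [/\ y \in V, x \in H, z \in V & (y < x < z)%N]) (straddles V H).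
Proof.
apply: (iffP exists_inP) => [[y yV /exists_inP[x xH /exists_inP[z zV yxz]]]|].
  by exists y, x, z.
move=> [y [x [z [yV xH zV yxz]]]]; exists y => //; apply/exists_inP; exists x => //.
by apply/exists_inP; exists z.
Qed.

(* [H] stands for the remaining elements of the blocks opened before [S]: no
   block of [P] may contain elements on both sides of one of them. *)
Definition nc_over S H P :=
  [&& partition P S, noncrossing P & [forall V in P, ~~ straddles V H]].

Definition before V H := [forall x in V, forall y in H, (x < y)%N].

Lemma beforeP V H :
  reflect {in V & H, forall x y, (x < y)%N} (before V H).
Proof.
apply: (iffP forall_inP) => [h x y xV yH|h x xV]; first by have /forall_inP := h x xV; apply.
by apply/forall_inP => y yH; apply: h.
Qed.

Variables (K : comNzRingType) (lam : nat -> K).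

Definition nc_sum S H := \sum_(P | nc_over S H P) \prod_(V in P) lam #|V|.

Lemma nc_over_block S H V P x : x \in S -> {in S, forall y, (x <= y)%N} ->
  {in H, forall y, (x < y)%N} -> [disjoint S & H] ->
  nc_over S H (V |: P) -> V \notin P -> x \in V ->
  [/\ V :\ x \subset S :\ x, before (V :\ x) H & nc_over (S :\: V) (V :\ x :|: H) P].
Proof.
move=> xS xmin xH dSH /and3P[pP /noncrossingP nP /forall_inP sP] VP xV.
have VE : V \in V |: P by rewrite !inE eqxx.
have VS := partitionS pP VE.
split; first exact: setSD.
  apply/beforeP => v h; rewrite !inE => /andP[vx vV] hH.
  have vS := subsetP VS v vV.
  have hv : h != v by apply: contraTneq hH => ->; rewrite (disjointFr dSH).
  have := sP V VE; rewrite ltnNge leq_eqVlt val_eqE (negbTE hv) /=.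
  apply: contraNN => hv'; apply/straddlesP; exists x, h, v; split=> //.
  by rewrite xH.
have PE : P = (V |: P) :\ V.
  by rewrite setU1K.
apply/and3P; split.
- by rewrite {1}PE; apply: partitionD1.
- apply/noncrossingP => A B i j k l AP BP; apply: nP; rewrite !inE ?AP ?BP orbT //.
apply/forall_inP => W WP; have WE : W \in V |: P by rewrite !inE WP orbT.
apply/negP => /straddlesP [y [h [z [yW + zW /andP[yh hz]]]]].
rewrite !inE => /orP[/andP[hx hV]|hH]; last first.
  by case/negP: (sP W WE); apply/straddlesP; exists y, h, z; split; rewrite ?yh.
have VW : V <> W by move=> VW; rewrite -VW (negbTE VP) in WP.
have yS := subsetP (partitionS pP WE) y yW.
have yx : (x < y)%N.
  rewrite ltn_neqAle xmin // andbT; apply/eqP => /val_inj xy; subst y.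
  have /trivIsetP/(_ V W VE WE) := partition_trivIset pP.
  by move/(_ (introN eqP VW)) => /disjoint_setI0/setP/(_ x); rewrite !inE xV yW.
by apply: VW; apply: (nP V W x y h z).
Qed.

Lemma nc_over_add S H V P x : x \in S -> {in S, forall y, (x <= y)%N} ->
  {in H, forall y, (x < y)%N} -> [disjoint S & H] ->
  V \subset S :\ x -> before V H ->
  nc_over (S :\ x :\: V) (V :|: H) P -> 
  nc_over S H ((x |: V) |: P) /\ (x |: V) \notin P.
Proof.
move=> xS xmin xH dSH VS /beforeP bV /and3P[pP /noncrossingP nP /forall_inP sP].
have VS' v : v \in V -> v != x /\ v \in S.
  by move/(subsetP VS); rewrite !inE => /andP[].
have PS W y : W \in P -> y \in W -> [/\ y != x, y \in S, y \notin V & (x < y)%N].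
  move=> WP yW; have := subsetP (partitionS pP WP) y yW.
  rewrite !inE => /and3P[yV yx yS]; split=> //.
  by rewrite ltn_neqAle xmin // andbT eq_sym.
have dP : [disjoint x |: V & S :\ x :\: V].
  rewrite -setI_eq0; apply/eqP/setP => y; rewrite !inE.
  by case: (y =P x); case: (y \in V); rewrite ?andbF.
have V0 : x |: V != set0 by apply/set0Pn; exists x; rewrite !inE eqxx.
have SE : S = (x |: V) :|: (S :\ x :\: V).
  apply/setP => y; rewrite !inE; case: (y =P x) => [->//|_] /=.
  by case yV: (y \in V) => //=; have [_ ->] := VS' y yV.
have nb_vertices : x |: V \notin P.
  by apply/negP => VP; have [/eqP] := PS _ x VP (setU11 x V).
have stV W y k z : W \in P -> y \in W -> k \in x |: V -> z \in W ->
    (y < k)%N -> (k < z)%N -> False.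
  move=> WP yW; rewrite !inE => /orP[/eqP->|kV] zW yk kz.
    by have [_ _ _] := PS W y WP yW; rewrite ltnNge (ltnW yk).
  case/negP: (sP W WP); apply/straddlesP; exists y, k, z; split; rewrite ?yk //.
  by rewrite inE kV.
split=> //; apply/and3P; split.
- by rewrite [X in partition _ X]SE; apply: partitionU1.
- apply/noncrossingP => A B i j k l; rewrite !in_setU1.
  move=> /predU1P[->|AP] /predU1P[->|BP] // iA jB kA lB ij jk kl; last exact: (nP A B i j k l).
    by case: (stV B j k l).
  by case: (stV A i j k).
apply/forall_inP => W; rewrite in_setU1 => /predU1P[->|WP]; last first.
  apply: contraNN (sP W WP) => /straddlesP [y [h [z [yW hH zW yhz]]]].
  by apply/straddlesP; exists y, h, z; split; rewrite // inE hH orbT.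
apply/negP => /straddlesP [y [h [z [yW hH zW /andP[yh hz]]]]].
move: zW; rewrite !inE => /orP[/eqP zx|zV].
  by move: hz; rewrite zx ltnNge (ltnW (xH h hH)).
by have := bV z h zV hH; rewrite ltnNge (ltnW hz).
Qed.

(** Removing the block of the least element [x] leaves a partition over the remaining [V] of that
    block together with [H]. That [V] must lie before [H] is the stack discipline: the block opened
    last is exhausted first. *)
Lemma nc_sum_block S H x : x \in S -> {in S, forall y, (x <= y)%N} ->
  {in H, forall y, (x < y)%N} -> [disjoint S & H] ->
  nc_sum S H = \sum_(V : {set 'I_n} | (V \subset S :\ x) && before V H)
    lam #|V|.+1 * nc_sum (S :\ x :\: V) (V :|: H).
Proof.
move=> xS xmin xH dSH; rewrite /nc_sum.
rewrite (partition_big (fun P => pblock P x :\ x)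
  (fun V => (V \subset S :\ x) && before V H)) /=; last first.
  move=> P PP; have pP : partition P S by case/and3P: PP.
  have xP : x \in cover P by rewrite (cover_partition pP).
  have BP := pblock_mem xP; have xB : x \in pblock P x by rewrite mem_pblock.
  have PP' : nc_over S H (pblock P x |: (P :\ pblock P x)) by rewrite setD1K.
  have nB : pblock P x \notin P :\ pblock P x by rewrite !inE eqxx.
  by have [-> ->] := nc_over_block xS xmin xH dSH PP' nB xB.
apply: eq_bigr => V /andP[VS bV]; have xV : x \notin V.
  by apply/negP => /(subsetP VS); rewrite !inE eqxx.
rewrite big_distrr /= (reindex_onto (fun P => (x |: V) |: P) (fun P => P :\ (x |: V))) /=.
  apply: eq_big => [P|P].
    apply/idP/idP.
      case/andP=> /andP[PP /eqP pV] /eqP PE.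
      have nb_vertices : x |: V \notin P by rewrite -PE !inE eqxx.
      have [_ _] := nc_over_block xS xmin xH dSH PP nb_vertices (setU11 x V).
      by rewrite setU1K // setDDl.
    move=> PP; have [PP' nb_vertices] := nc_over_add xS xmin xH dSH VS bV PP.
    rewrite PP' setU1K // eqxx andbT /=.
    have pP : partition ((x |: V) |: P) S by case/and3P: PP'.
    rewrite (def_pblock (partition_trivIset pP) (setU11 _ _) (setU11 x V)).
    by rewrite setU1K.
  case/andP=> _ /eqP PE; have nb_vertices : x |: V \notin P by rewrite -PE !inE eqxx.
  by rewrite big_setU1 //= cardsU1 xV.
move=> P /andP[PP /eqP PE]; rewrite setD1K //.
have pP : partition P S by case/and3P: PP.
have xP : x \in cover P by rewrite (cover_partition pP).
by rewrite -PE setD1K ?mem_pblock // pblock_mem.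
Qed.

Definition initial k H : {set 'I_n} := [set y in take k (enum H)].
Definition final k H : {set 'I_n} := [set y in drop k (enum H)].

Lemma sorted_enum H : sorted (fun x y : 'I_n => (x < y)%N) (enum H).
Proof.
rewrite -[enum H]/(filter (mem H) (Finite.enum 'I_n)) -enumT.
apply: sorted_filter => [y x z|]; first exact: ltn_trans.
by have := iota_ltn_sorted 0 n; rewrite -val_enum_ord sorted_map.
Qed.

Lemma initialU k H : initial k H :|: final k H = H.
Proof. by apply/setP => y; rewrite !inE -mem_cat cat_take_drop mem_enum. Qed.

Lemma enum_before V H : before V H -> enum (V :|: H) = enum V ++ enum H.
Proof.
move=> /beforeP bV; apply: (irr_sorted_eq (leT := fun x y : 'I_n => (x < y)%N)).
- by move=> y x z; apply: ltn_trans.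
- by move=> x; rewrite ltnn.
- exact: sorted_enum.
- rewrite sorted_pairwise; last by move=> y x z; apply: ltn_trans.
  rewrite pairwise_cat -!sorted_pairwise ?sorted_enum ?andbT; try by move=> y x z; apply: ltn_trans.
  by apply/allrelP => x y; rewrite !mem_enum; apply: bV.
- by move=> x; rewrite mem_cat !mem_enum inE.
Qed.

Lemma initial_before k H : before (initial k H) (final k H).
Proof.
apply/beforeP => x y; rewrite !inE => xi yf.
have := sorted_enum H; rewrite sorted_pairwise; last by move=> b a c; apply: ltn_trans.
by rewrite -{1}(cat_take_drop k (enum H)) pairwise_cat => /and3P[/allrelP/(_ _ _ xi yf)].
Qed.

Lemma card_initial k H : (k <= #|H|)%N -> #|initial k H| = k.
Proof.
move=> kH; rewrite cardsE (card_uniqP _) ?take_uniq ?enum_uniq //.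
by rewrite size_takel // -cardE.
Qed.

Lemma card_final k H : #|final k H| = (#|H| - k)%N.
Proof.
by rewrite cardsE (card_uniqP _) ?drop_uniq ?enum_uniq // size_drop -cardE.
Qed.

Lemma initial_union V H : before V H -> initial #|V| (V :|: H) = V.
Proof.
move=> bV; apply/setP => y; rewrite inE enum_before // take_size_cat ?mem_enum //.
by rewrite cardE.
Qed.

Lemma final_union V H : before V H -> final #|V| (V :|: H) = H.
Proof.
move=> bV; apply/setP => y; rewrite inE enum_before // drop_size_cat ?mem_enum //.
by rewrite cardE.
Qed.

Definition tail (i : nat) : {set 'I_n} := [set x : 'I_n | (i <= x)%N].

Lemma before_disjoint V H : before V H -> [disjoint V & H].
Proof.
move=> /beforeP bV; rewrite -setI_eq0; apply/eqP/setP => y; rewrite !inE.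
by apply/negP => /andP[yV yH]; have := bV y y yV yH; rewrite ltnn.
Qed.

(** A set [V] before [H] consists of the [#|V|] least elements of [V :|: H], so the pair is
    recovered from the union and one number. *)
Lemma sum_before (T : {set 'I_n}) h D (F : {set 'I_n} -> K) : (#|T| < D)%N ->
  \sum_(H : {set 'I_n} | (H \subset T) && (#|H| == h))
    \sum_(V : {set 'I_n} | (V \subset T :\: H) && before V H)
      lam #|V|.+1 * F (V :|: H) =
  \sum_(k < D) lam k.+1 *
    \sum_(H : {set 'I_n} | (H \subset T) && (#|H| == k + h)%N) F H.
Proof.
move=> TD; case: D TD => // D; rewrite ltnS => TD; rewrite pair_big_dep /=.
rewrite (partition_big (fun p : {set 'I_n} * {set 'I_n} => inord #|p.2| : 'I_D.+1) xpredT) //=.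
apply: eq_bigr => k _; rewrite big_distrr /=.
rewrite (reindex_onto (fun H => (final k H, initial k H)) (fun p => p.2 :|: p.1)) /=.
  apply: eq_big => [H|H].
    rewrite initialU eqxx andbT initial_before andbT card_final.
    apply/idP/idP.
      case/andP=> /andP[/andP[fT fh] iT] /eqP ik.
      have iT' : initial k H \subset T by apply: subset_trans iT (subsetDl _ _).
      have ik' : #|initial k H| = k.
        by have := congr1 val ik; rewrite /= inordK // ltnS (leq_trans (subset_leq_card iT')).
      have HT : H \subset T by rewrite -(initialU k H) subUset iT'.
      rewrite HT /=; move: (fh) => /eqP <-.
      rewrite subnKC // -{1}ik'; apply: subset_leq_card.
      by rewrite -{2}(initialU k H) subsetUl.
    case/andP=> HT /eqP Hk; have kH : (k <= #|H|)%N by rewrite Hk leq_addr.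
    have iT : initial k H \subset T by rewrite (subset_trans _ HT) // -{2}(initialU k H) subsetUl.
    have fT : final k H \subset T by rewrite (subset_trans _ HT) // -{2}(initialU k H) subsetUr.
    rewrite fT Hk addKn eqxx card_initial // subsetD iT before_disjoint ?initial_before //=.
    by apply/eqP/val_inj; rewrite /= inordK.
  case/andP=> /andP[/andP[_ /andP[iT _]] /eqP ik] _.
  rewrite initialU; congr (lam _.+1 * _).
  have := congr1 val ik; rewrite /= inordK // ltnS.
  apply: leq_trans TD; apply: subset_leq_card.
  by apply: subset_trans iT (subsetDl _ _).
case=> H V /= /andP[/andP[_ /andP[VT bV]] /eqP ik].
have Vk : #|V| = k.
  have := congr1 val ik; rewrite /= inordK // ltnS (leq_trans _ TD) //.
  by apply: subset_leq_card; apply: subset_trans VT (subsetDl _ _).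
by rewrite -Vk initial_union ?final_union.
Qed.

Lemma nc_sum_setU1 S H x : {in S, forall y, (x <= y)%N} ->
  nc_sum S (x |: H) = nc_sum S H.
Proof.
move=> xmin; apply: eq_bigl => P; rewrite /nc_over.
case pP : (partition P S) => //=; congr (_ && _).
apply: eq_forallb_in => W WP; congr (~~ _).
apply/straddlesP/straddlesP => -[y [h [z [yW hH zW yhz]]]]; exists y, h, z; split=> //.
  move: hH; rewrite in_setU1 => /predU1P[hx|//]; subst h.
  have := xmin y (subsetP (partitionS pP WP) y yW).
  by case/andP: yhz => yx _; rewrite leqNgt yx.
by rewrite in_setU1 hH orbT.
Qed.

Lemma tailS i (i_n : (i < n)%N) : tail i = Ordinal i_n |: tail i.+1.
Proof. by apply/setP => y; rewrite !inE leq_eqVlt -val_eqE /= eq_sym. Qed.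

Lemma tail_end i : i = n -> tail i = set0.
Proof. by move=> ->; apply/setP => x; rewrite !inE leqNgt ltn_ord. Qed.

Lemma card_tail m i : (i + m = n)%N -> #|tail i| = m.
Proof.
elim: m i => [|m IH] i im; first by rewrite tail_end ?cards0 // -im addn0.
have i_n : (i < n)%N by lia.
by rewrite (tailS i_n) cardsU1 inE /= ltnn IH ?addSnnS.
Qed.

(** [H] is the set of positions at which the [h] tokens now on the stack will be popped. If the
    position [i] lies in [H], it pops a token; otherwise it opens a block, and [nc_sum_block]
    applies. *)
Lemma nc_sum_tail D m i h : (i + m = n)%N -> (m <= D)%N ->
  \sum_(H : {set 'I_n} | (H \subset tail i) && (#|H| == h))
    nc_sum (tail i :\: H) H = path_sum lam D m h.
Proof.
elim: m i h => [|m IH] i h im mD.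
  have t0 : tail i = set0 by rewrite tail_end // -im addn0.
  rewrite t0 /= (eq_bigl (fun H => (H == set0) && (h == 0%N))); last first.
    by move=> H; rewrite subset0; case: eqP => //= ->; rewrite cards0 eq_sym.
  case: (h == 0%N); last by rewrite big_pred0 // => H; rewrite andbF.
  rewrite (eq_bigl (fun H => H == set0)) => [|H]; last by rewrite andbT.
  rewrite big_pred1_eq setD0 /nc_sum (eq_bigl (fun P => P == set0)) => [|P].
    by rewrite big_pred1_eq big_set0.
  rewrite /nc_over partition_set0; case: eqP => //= ->; apply/andP; split.
    by apply/noncrossingP => V W y z x t; rewrite inE.
  by apply/forall_inP => V; rewrite inE.
have i_n : (i < n)%N by lia.
pose x := Ordinal i_n.
have tE : tail i = x |: tail i.+1 by apply: tailS.
have xt : x \notin tail i.+1 by rewrite inE /= ltnn.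
have tT : tail i :\ x = tail i.+1 by rewrite tE setU1K.
have tD : (#|tail i.+1| < D)%N.
  by rewrite (card_tail (m := m)) // addSnnS.
rewrite (bigID (fun H : {set 'I_n} => x \in H)) /= addrC; congr (_ + _).
  transitivity (\sum_(k < D) lam k.+1 *
      \sum_(H : {set 'I_n} | (H \subset tail i.+1) && (#|H| == k + h)%N)
        nc_sum (tail i.+1 :\: H) H); last first.
    by apply: eq_bigr => k _; rewrite IH ?addSnnS // ltnW.
  rewrite -(sum_before _ (fun H => nc_sum (tail i.+1 :\: H) H)) //.
  rewrite (eq_bigl (fun H : {set 'I_n} => (H \subset tail i.+1) && (#|H| == h))).
    apply: eq_bigr => H /andP[HT _].
    have xH : x \notin H by apply: contraNN xt => /(subsetP HT).
    have SE : (tail i :\: H) :\ x = tail i.+1 :\: H.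
      by rewrite setDDl setUC -setDDl tE setU1K.
    rewrite (@nc_sum_block _ _ x).
    - by rewrite SE; apply: eq_bigr => V _; rewrite !setDDl (setUC H).
    - by rewrite !inE xH /= leqnn.
    - by move=> y; rewrite !inE => /andP[].
    - by move=> y /(subsetP HT); rewrite !inE.
    - by rewrite disjoint_sym disjoints_subset setCD subsetUr.
  by move=> H; rewrite andbAC -subsetD1 tT.
case: h => [|h].
  rewrite big1 // => H /andP[/andP[_ /eqP/cards0_eq->]]; by rewrite inE.
rewrite -(IH i.+1 h) ?addSnnS //; last exact: ltnW.
rewrite (reindex_onto (fun H => x |: H) (fun H => H :\ x)) /=.
  apply: eq_big => [H|H].
    rewrite setU11 andbT; apply/idP/idP.
      case/andP=> /andP[xHT xHh] /eqP HE; have xH : x \notin H by rewrite -HE !inE eqxx.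
      move: xHh; rewrite cardsU1 xH add1n eqSS => ->; rewrite andbT.
      by rewrite -tT subsetD1 xH andbT; apply: subset_trans xHT; apply: subsetUr.
    case/andP=> HT /eqP Hh; have xH : x \notin H by apply: contraNN xt => /(subsetP HT).
    by rewrite setU1K // eqxx cardsU1 xH Hh eqxx tE setUS.
  case/andP=> /andP[/andP[xHT xHh] _] /eqP HE; have xH : x \notin H by rewrite -HE !inE eqxx.
  have -> : tail i :\: (x |: H) = tail i.+1 :\: H.
    by rewrite -setDDl tE setU1K.
  by apply: nc_sum_setU1 => y; rewrite !inE => /andP[_ /ltnW].
by move=> H /andP[_ xH]; rewrite setD1K.
Qed.

Lemma sum_NC D : (n <= D)%N ->
  \sum_(P in NC n) \prod_(V in P) lam #|V| = path_sum lam D n 0.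
Proof.
move=> nD; rewrite -(nc_sum_tail 0 (add0n n) nD).
rewrite (eq_bigl (fun H => H == set0)) => [|H]; last first.
  by rewrite cards_eq0; case: eqP => [->|]; rewrite ?sub0set ?andbF.
rewrite big_pred1_eq setD0; apply: eq_bigl => P; rewrite /nc_over inE.
have -> : tail 0 = [set: 'I_n] by apply/setP => x; rewrite !inE.
case: (partition _ _) => //=; rewrite (_ : [forall V in P, _]) ?andbT //.
by apply/forall_inP => V _; apply/straddlesP => -[y [x [z []]]]; rewrite inE.
Qed.

End NoncrossingSum.

(** * Moments of words in free variables *)

Lemma NC_block_proper n P (V : {set 'I_n}) : P \in NC n -> P != [set [set: 'I_n]] ->
  V \in P -> (0 < #|V| < n)%N.
Proof.
rewrite inE => /andP[/and3P[_ tP nP] _] PT VP; rewrite card_gt0; apply/andP; split.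
  by apply: contraNneq nP => <-.
rewrite -[X in (_ < X)%N]card_ord -cardsT proper_card // properT.
apply: contraNneq PT => VT; rewrite eqEsubset sub1set -VT VP andbT.
apply/subsetP => W WP; rewrite inE; apply/negPn/negP => WV.
move/trivIsetP: tP => tP; move: (tP _ _ WP VP WV).
rewrite VT -setI_eq0 setIT => /eqP W0; by move: nP; rewrite -W0 WP.
Qed.

(** Among the non-crossing partitions of n points the one-block partition contributes exactly
    [lam n], and all others involve smaller indices only. *)
Lemma path_sum_inj (K : comNzRingType) (lam mu : nat -> K) D :
  (forall n, (0 < n <= D)%N -> path_sum lam D n 0 = path_sum mu D n 0) ->
  forall n, (0 < n <= D)%N -> lam n = mu n.
Proof.
move=> H; apply: ltn_ind => n IH /andP[n0 nD]; have := H n.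
rewrite n0 nD -!sum_NC // => /(_ isT).
rewrite !(bigD1 _ (NC1 n0)) /= !big_set1 cardsT card_ord => E1.
apply: (addIr _ (etrans E1 _)); congr (_ + _).
apply: eq_bigr => P /andP[PN PT]; apply: eq_bigr => V VP.
have /andP[V0 Vn] := NC_block_proper PN PT VP.
by rewrite IH // V0 (leq_trans (ltnW Vn)).
Qed.

Section CumulantPaths.
Variables (K : comNzRingType) (A : algType K) (phi : {scalar A}).

Lemma subword_nseq n (x : A) (V : {set 'I_(size (nseq n x))}) :
  subword V = nseq #|V| x.
Proof.
rewrite -size_subword; apply/all_pred1P; rewrite /subword all_map.
apply/allP => i _ /=; by rewrite (tnth_nth x) nth_nseq if_same.
Qed.

Lemma moment_path_sum D n (x : A) : phi 1 = 1 -> (n <= D)%N ->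
  phi (x ^+ n) = path_sum (fun k => cumulant phi k x) D n 0.
Proof.
move=> phi1 nD; have [->|n0] := posnP n; first by rewrite expr0 phi1.
have := moment_cumulant phi (s := nseq n x); rewrite {1}size_nseq => /(_ n0).
rewrite big_nseq iter_mulr_1 => ->.
have := @sum_NC (size (nseq n x)) K (fun k => cumulant phi k x) D.
move=> SN; rewrite -[n in RHS](size_nseq n x) -SN ?size_nseq //; apply: eq_bigr => P _; apply: eq_bigr => V _.
by rewrite subword_nseq.
Qed.
End CumulantPaths.

Section Words.
Variables (K : comNzRingType) (m : nat -> K).

(* The value of [Phi] on the word [pre] times the product over [l] of the
   centred powers [c ^ n - m n] times the word [r]. *)
Fixpoint centred (Phi : seq bool -> K) pre (l : seq (bool * nat)) r : K :=
  if l is (c, n) :: l' then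
    centred Phi (pre ++ nseq n c) l' r - m n * centred Phi pre l' r
  else Phi (pre ++ r).

Lemma centred_rcons Phi pre l c n r :
  centred Phi pre (rcons l (c, n)) r =
  centred Phi pre l (nseq n c ++ r) - m n * centred Phi pre l r.
Proof.
elim: l pre => [|[c' n'] l IH] pre /=; first by rewrite catA.
rewrite !IH; ring.
Qed.

Definition alternating (l : seq (bool * nat)) := sorted (fun x y => x.1 != y.1) l.
Definition total (l : seq (bool * nat)) := sumn (map snd l).

Lemma total_rcons l c n : total (rcons l (c, n)) = (total l + n)%N.
Proof. by rewrite /total map_rcons sumn_rcons. Qed.

Lemma alternating_rcons l x : alternating (rcons l x) =
  alternating l && ((l == [::]) || ((last x l).1 != x.1)).
Proof.
case: l => [|y l] //=; by rewrite /alternating /= rcons_path.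
Qed.

Lemma centred_unique Phi Psi N : Phi [::] = Psi [::] ->
  (forall l, l != [::] -> alternating l -> all (fun x => 0 < x.2)%N l ->
     (total l <= N)%N -> centred Phi [::] l [::] = centred Psi [::] l [::]) ->
  forall w, (size w <= N)%N -> Phi w = Psi w.
Proof.
move=> Phi0 cPhi.
suff: forall d l r, alternating l -> all (fun x => 0 < x.2)%N l ->
    (total l + size r < d)%N -> (d <= N.+1)%N ->
    centred Phi [::] l r = centred Psi [::] l r.
  by move=> H w wN; apply: (H N.+1 [::] w).
elim=> // d IHd l r; elim: r l => [|c r IHr] l al pl lr dN.
  have [->|l0] := eqVneq l [::]; first exact: Phi0.
  apply: cPhi => //; rewrite addn0 in lr; exact: leq_trans lr dN.
have IHd' l' r' : alternating l' -> all (fun x => 0 < x.2)%N l' ->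
    (total l' + size r' < d)%N -> centred Phi [::] l' r' = centred Psi [::] l' r'.
  by move=> al' pl' lr'; apply: IHd => //; apply: ltnW.
have step Chi l' n : centred Chi [::] l' (nseq n.+1 c ++ r) =
    centred Chi [::] (rcons l' (c, n.+1)) r + m n.+1 * centred Chi [::] l' r.
  by rewrite centred_rcons subrK.
rewrite /= in lr.
case: (lastP l) al pl lr => [|l' [c' n]] al pl lr.
  rewrite -[c :: r]/(nseq 1 c ++ r) !step.
  by congr (_ + _ * _); [apply: IHr | apply: IHd'].
move: (al) (pl); rewrite alternating_rcons all_rcons total_rcons /= in lr *.
case/andP=> al' cl' /andP[n0 pl'].
have [Ec|cc'] := eqVneq c' c.
  (* The next letter extends the last power: with c_n = c^n - m n, one has c_n c = c_(n+1) + m (n+1)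
     - m n c, and the last two terms fall under the outer induction. *)
  subst c'; rewrite !centred_rcons.
  have -> : nseq n c ++ c :: r = nseq n.+1 c ++ r by elim: (n) => //= k ->.
  rewrite !step; congr (_ + _ - _).
  - apply: IHr => //; first by rewrite alternating_rcons al'; case: (l') cl'.
    + by rewrite all_rcons.
    + by rewrite total_rcons; lia.
  - by congr (_ * _); apply: IHd' => //; lia.
  - by congr (_ * _); apply: IHd' => //=; lia.
rewrite -[c :: r]/(nseq 1 c ++ r) !step; congr (_ + _ * _).
  apply: IHr => //.
  - by rewrite alternating_rcons al last_rcons cc' orbT.
  - by rewrite all_rcons.
  - by rewrite !total_rcons; lia.
apply: IHd' => //; rewrite total_rcons; lia.
Qed.

End Words.

Section Freeness.
Variables (K : comNzRingType) (A : algType K) (phi : {scalar A}) (a b : A).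
Hypotheses (phi1 : phi 1 = 1) (free_ab : free_indep phi a b).
Variables (D : nat) (m : nat -> K).
Hypothesis ma : forall n, (n <= D)%N -> phi (a ^+ n) = m n.
Hypothesis mb : forall n, (n <= D)%N -> phi (b ^+ n) = m n.

Definition letter_value (c : bool) := if c then a else b.
Definition word_value (w : seq bool) := \prod_(c <- w) letter_value c.
Definition centred_power (x : bool * nat) := letter_value x.1 ^+ x.2 - (m x.2)%:A.

Lemma word_value_nseq n c : word_value (nseq n c) = letter_value c ^+ n.
Proof. by rewrite /word_value big_nseq iter_mulr_1. Qed.

Lemma centred_moment pre l r :
  centred m (phi \o word_value) pre l r =
  phi (word_value pre * \prod_(x <- l) centred_power x * word_value r).
Proof.
elim: l pre => [|[c n] l IH] pre /=.
  by rewrite big_nil mulr1 /word_value big_cat.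
rewrite !IH big_cons /centred_power /= -word_value_nseq.
rewrite {1}/word_value big_cat /= -/(word_value _) -/(word_value _).
rewrite mulrBl mulrBr mulrBl linearB /= !mulrA; congr (_ - _).
by rewrite -scalerAr mulr1 -!scalerAl linearZ.
Qed.

Lemma centred_moment0 l : l != [::] -> alternating l -> (total l <= D)%N ->
  centred m (phi \o word_value) [::] l [::] = 0.
Proof.
move=> l0 al lD; rewrite centred_moment /word_value big_nil mul1r mulr1.
have := free_ab (s := [seq (x.1, centred_power x) | x <- l]); rewrite big_map; apply.
- by case: l l0 {al lD}.
- by rewrite sorted_map.
move=> _ /mapP [[c n] xl ->] /=.
have nD : (n <= D)%N.
  apply: leq_trans lD; rewrite /total; elim: l xl {l0 al} => //= y l IH.
  by rewrite inE => /predU1P[<-|/IH H]; [apply: leq_addr | rewrite (leq_trans H) ?leq_addl].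
split.
  exists ('X^n - (m n)%:P); rewrite rmorphB rmorphXn /= horner_algX horner_algC.
  by rewrite /centred_power /letter_value; case: c {xl}.
rewrite /centred_power linearB linearZ /= phi1 /letter_value.
by case: c {xl} => /=; rewrite ?ma ?mb // mulr1 subrr.
Qed.

End Freeness.

(** * The two-colour stack automaton *)

Section Automaton.
Variables (K : comNzRingType) (lam : nat -> K) (D : nat).

(* Reading the letter [c] either closes the top of the stack or opens a block
   of size k + 1, whose k remaining letters are put on the stack. *)
Definition letter c (h : seq bool -> K) (s : seq bool) : K :=
  \sum_(k < D) lam k.+1 * h (nseq k c ++ s) +
  (if s is c' :: s' then if c' == c then h s' else 0 else 0).

Definition empty_stack (s : seq bool) : K := (s == [::])%:R.

Definition read (w : seq bool) (h : seq bool -> K) := foldr letter h w.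

Lemma letter_sub c h h' x : 
  letter c (fun s => h s - x * h' s) = (fun s => letter c h s - x * letter c h' s).
Proof.
apply: funext => s; rewrite /letter.
under eq_bigr => k _ do rewrite mulrBr mulrCA.
rewrite sumrB -big_distrr /=.
by case: s => [|c' s]; [ring | case: ifP => _; ring].
Qed.

Lemma read_sub w h h' x :
  read w (fun s => h s - x * h' s) = (fun s => read w h s - x * read w h' s).
Proof. by elim: w => //= c w ->; rewrite letter_sub. Qed.

Lemma read_nseq n c h : read (nseq n c) h = iter n (letter c) h.
Proof. by elim: n => //= n <-. Qed.

Lemma letter_iter n c h i s :
  (forall j, (0 < j)%N -> h (nseq j c ++ s) = 0) -> ohead s != Some c ->
  iter n (letter c) h (nseq i c ++ s) = path_sum lam D n i * h s.
Proof.
move=> h0 sc; elim: n i => [|n IH] i /=.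
  by case: i => [|i]; rewrite ?mul1r // mul0r h0.
rewrite [letter _ _ _]/letter.
rewrite mulrDl big_distrl /=; congr (_ + _).
  by apply: eq_bigr => k _; rewrite catA -nseqD IH mulrA.
case: i => [|i] /=; last by rewrite eqxx IH.
by rewrite mul0r; case: s sc {h0 IH} => //= c' s sc; rewrite ifN //; apply: contraNN sc => /eqP->.
Qed.

Definition centred_read := foldr (fun x h s =>
  read (nseq x.2 x.1) h s - path_sum lam D x.2 0 * h s).

Lemma centred_readE l pre r s :
  centred (fun n => path_sum lam D n 0) (fun w => read w empty_stack s) pre l r =
  read pre (centred_read (read r empty_stack) l) s.
Proof.
elim: l pre => [|[c n] l IH] pre /=; first by rewrite /read foldr_cat.
by rewrite !IH read_sub /read foldr_cat.
Qed.

(** By [letter_iter] a power read on a stack whose top has another colour multiplies by exactly the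
    moment that centring subtracts. The vanishing on unpopped tokens that [letter_iter] asks for is
    the induction hypothesis, the next power being of the other colour. *)
Lemma centred_read0 l s : l != [::] -> alternating l ->
  ohead s != omap fst (ohead l) -> centred_read empty_stack l s = 0.
Proof.
elim: l s => //= -[c n] l IH s _ al sc; rewrite read_nseq /=.
rewrite -[in iter _ _ _ s](cat0s s) -[[::]]/(nseq 0 c) letter_iter ?subrr //.
case=> // j _; case: l IH al => [|[c' n'] l] IH al; first by [].
by apply: IH => //=; move: al => /= /andP[+ ?] //.
Qed.

End Automaton.

(** Both sides agree on the empty word and vanish on alternating centred products, the left one by
    freeness and the right one by [centred_read0]; [centred_unique] concludes. *)
Lemma moment_read (K : comNzRingType) (A : algType K) (phi : {scalar A}) (a b : A) D w :
  phi 1 = 1 -> free_indep phi a b -> same_distribution phi a b -> (size w <= D)%N ->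
  phi (word_value a b w) =
  read (fun k => cumulant phi k a) D w (empty_stack K) [::].
Proof.
move=> phi1 fab dab wD; pose lam := fun k => cumulant phi k a.
pose m n := path_sum lam D n 0.
have ma n : (n <= D)%N -> phi (a ^+ n) = m n by apply: moment_path_sum.
have mb n : (n <= D)%N -> phi (b ^+ n) = m n.
  by case: n => [|n] nD; rewrite -ma // -dab.
apply: (centred_unique (m := m) (N := D) (Phi := phi \o word_value a b)
  (Psi := fun w => read lam D w (empty_stack K) [::])) => //=.
  by rewrite /word_value big_nil phi1.
move=> l l0 al _ lD; rewrite (centred_moment0 phi1 fab ma mb) //.
by rewrite centred_readE [read _ _ _ _]/= centred_read0 //; case: l l0 {al lD}.
Qed.

(** * Generating functions of trees *)

(** All trees with fewer than [h] edges occur, and larger ones of small height as well. Bounding the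
    height lets the list split by constructors; the surplus trees have weights divisible by y^(N+1)
    = 0. *)
Fixpoint trees h : seq tree :=
  if h is h'.+1 then
    Leaf :: [seq Flex t1 t2 | t1 <- trees h', t2 <- trees h'] ++
            [seq Cyc t1 t2 | t1 <- trees h', t2 <- trees h'] ++
            [seq Link t1 t2 | t1 <- trees h', t2 <- trees h']
  else [::].

Lemma mem_trees h t : (nb_edges t < h)%N -> t \in trees h.
Proof.
elim: h t => // h IH [|t1 t2|t1 t2|t1 t2] /=; rewrite ?inE ?eqxx // !mem_cat ltnS => th;
  have t1h : t1 \in trees h by [apply: IH; lia]; have t2h : t2 \in trees h by [apply: IH; lia];
  by rewrite (allpairs_f _ t1h t2h) ?orbT.
Qed.

Lemma trees_uniq h : uniq (trees h).
Proof.
elim: h => //= h IH; rewrite !mem_cat !negb_or !cat_uniq.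
have inj2 (f : tree -> tree -> tree) : (forall a b c d, f a b = f c d -> a = c /\ b = d) ->
    uniq [seq f t1 t2 | t1 <- trees h, t2 <- trees h].
  move=> finj; apply: allpairs_uniq => // -[a b] [c d] _ _ /= /finj [-> ->] //.
rewrite !inj2; try by move=> ? ? ? ? [].
rewrite !andbT /=.
have nmem (f : tree -> tree -> tree) x : (forall a b, f a b <> x) ->
    x \notin [seq f t1 t2 | t1 <- trees h, t2 <- trees h].
  by move=> H; apply/allpairsP => -[[a b] /= [_ _ /esym/H]].
rewrite !nmem //=; apply/andP; split.
  rewrite has_cat negb_or; apply/andP; split; apply/hasPn => x /allpairsP [[a b] /= [_ _ ->]];
  by rewrite nmem.
by apply/hasPn => x /allpairsP [[a b] /= [_ _ ->]]; rewrite nmem.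
Qed.

(** * Algebraic equations for sums over trees *)

Section TreeSums.
Variables (S : comNzRingType) (lam : nat -> S) (y : S) (N : nat).
Hypothesis yN : y ^+ N.+1 = 0.

(* [Some par] is the sort of chains whose number of links has parity [par]. *)
Fixpoint gen_weight (b : option bool) t : S :=
  match t, b with
  | Leaf, None => 1
  | Leaf, Some par => (~~ par)%:R
  | Flex t1 t2, None => 2 * y * lam (deg t1).+1 * gen_weight None t1 * gen_weight None t2
  | Cyc c t, None => y * gen_weight (Some true) c * gen_weight None t
  | Link t c, Some par =>
      y * lam (deg t).+2 * gen_weight None t * gen_weight (Some (~~ par)) c
  | _, _ => 0
  end.

Definition negligible (F : tree -> S) := forall t, (N < nb_edges t)%N -> F t = 0.

Definition tree_sum (F : tree -> S) := \sum_(t <- trees N.+1) F t.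

Lemma big_trees h (F : tree -> S) : \sum_(t <- trees h.+1) F t = F Leaf +
  \sum_(t1 <- trees h) \sum_(t2 <- trees h) F (Flex t1 t2) +
  \sum_(t1 <- trees h) \sum_(t2 <- trees h) F (Cyc t1 t2) +
  \sum_(t1 <- trees h) \sum_(t2 <- trees h) F (Link t1 t2).
Proof. by rewrite [trees _]/= big_cons !big_cat !big_allpairs_dep !addrA. Qed.

(** Splitting by constructors leads from the list at N + 2 to that at N + 1. Passing from N + 1 to N
    + 2 on the left adds negligible trees only, so the equations are exact with one and the same
    truncation throughout. *)
Lemma tree_sumE F : negligible F -> tree_sum F =
  F Leaf + tree_sum (fun t1 => tree_sum (fun t2 => F (Flex t1 t2)))
         + tree_sum (fun t1 => tree_sum (fun t2 => F (Cyc t1 t2)))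
         + tree_sum (fun t1 => tree_sum (fun t2 => F (Link t1 t2))).
Proof.
move=> nb_flex.
have -> : tree_sum F = \sum_(t <- trees N.+2) F t.
  have trunc h : \sum_(t <- trees h) F t = \sum_(t <- trees h | (nb_edges t <= N)%N) F t.
    rewrite (bigID (fun t => nb_edges t <= N)%N) /= [X in _ + X]big1 ?addr0 // => t tN.
    by apply: nb_flex; rewrite ltnNge.
  rewrite /tree_sum !trunc.
  rewrite -!(big_filter (trees _)); apply: perm_big; apply: uniq_perm;
    rewrite ?filter_uniq ?trees_uniq // => t; rewrite !mem_filter.
  by case tN : (nb_edges t <= N)%N => //; rewrite !andTb !mem_trees // ltnS (leq_trans tN).
exact: big_trees.
Qed.

Lemma gen_weight_div b t : exists r, gen_weight b t = y ^+ nb_edges t * r.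
Proof.
elim: t b => [|t1 IH1 t2 IH2|t1 IH1 t2 IH2|t1 IH1 t2 IH2] b /=.
- by case: b => [par|]; eexists; rewrite mul1r.
- case: b => [par|]; first by exists 0; rewrite mulr0.
  have [r1 ->] := IH1 None; have [r2 ->] := IH2 None.
  by exists (2 * lam (deg t1).+1 * r1 * r2); rewrite exprS exprD; ring.
- case: b => [par|]; first by exists 0; rewrite mulr0.
  have [r1 ->] := IH1 (Some true); have [r2 ->] := IH2 None.
  by exists (r1 * r2); rewrite exprS exprD; ring.
- case: b => [par|]; last by exists 0; rewrite mulr0.
  have [r1 ->] := IH1 None; have [r2 ->] := IH2 (Some (~~ par)).
  by exists (lam (deg t1).+2 * r1 * r2); rewrite exprS exprD; ring.
Qed.

Lemma y_large k : (N < k)%N -> y ^+ k = 0.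
Proof. by move=> /subnK <-; rewrite exprD yN mulr0. Qed.

Lemma gen_weight0 b t : (N < nb_edges t)%N -> gen_weight b t = 0.
Proof. by move=> tN; have [r ->] := gen_weight_div b t; rewrite y_large // mul0r. Qed.

Lemma deg_nE t : (deg t <= (nb_edges t).*2)%N.
Proof. by elim: t => //= *; lia. Qed.

(** These are L1 and L2: a bouquet counted with the vertex by which it hangs, from a bridge or from
    a cycle. [degree_part d] is A_d. *)
Definition hanging1 := tree_sum (fun t => lam (deg t).+1 * gen_weight None t).
Definition hanging2 := tree_sum (fun t => lam (deg t).+2 * gen_weight None t).
Definition chains par := tree_sum (gen_weight (Some par)).
Definition degree_part d := tree_sum (fun t => (deg t == d)%:R * gen_weight None t).

Lemma tree_sum0 : tree_sum (fun=> 0) = 0.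
Proof. by rewrite /tree_sum big1. Qed.

Lemma tree_sum_eq F G : F =1 G -> tree_sum F = tree_sum G.
Proof. by move=> FG; apply: eq_bigr => t _. Qed.

Lemma tree_sum_mul F G x :
  tree_sum (fun t1 => tree_sum (fun t2 => x * (F t1 * G t2))) = x * (tree_sum F * tree_sum G).
Proof.
rewrite /tree_sum big_distrlr /= mulr_sumr; apply: eq_bigr => t1 _.
by rewrite mulr_sumr.
Qed.

Lemma chains_even : chains false = 1 + y * hanging2 * chains true.
Proof.
rewrite {1}/chains tree_sumE => [|t]; last exact: gen_weight0.
rewrite /= !tree_sum0 !addr0; congr (_ + _).
rewrite -mulrA -tree_sum_mul; do 2! apply: tree_sum_eq => ?; ring.
Qed.

Lemma chains_odd : chains true = y * hanging2 * chains false.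
Proof.
rewrite {1}/chains tree_sumE => [|t]; last exact: gen_weight0.
rewrite /= !tree_sum0 !addr0 add0r.
rewrite -mulrA -tree_sum_mul; do 2! apply: tree_sum_eq => ?; ring.
Qed.

Lemma degree_part_negligible d : negligible (fun t => (deg t == d)%:R * gen_weight None t).
Proof. by move=> t tN; rewrite gen_weight0 ?mulr0. Qed.

Lemma degree_partE d : degree_part d = (d == 0%N)%:R
  + 2 * (y * hanging1) * (if d is d'.+1 then degree_part d' else 0)
  + y * chains true * (if d is d'.+2 then degree_part d' else 0).
Proof.
rewrite {1}/degree_part tree_sumE; last exact: degree_part_negligible.
have -> : tree_sum (fun t1 => tree_sum (fun t2 =>
    (deg (Flex t1 t2) == d)%:R * gen_weight None (Flex t1 t2))) =
    2 * (y * hanging1) * (if d is d'.+1 then degree_part d' else 0).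
  case: d => [|d].
    by rewrite mulr0 -[RHS]tree_sum0 -[in RHS]tree_sum0; do 2! apply: tree_sum_eq => ?; rewrite mul0r.
  rewrite [2 * _]mulrA -[RHS]mulrA -tree_sum_mul; do 2! apply: tree_sum_eq => ?.
  by rewrite /= eqSS; ring.
have -> : tree_sum (fun t1 => tree_sum (fun t2 =>
    (deg (Cyc t1 t2) == d)%:R * gen_weight None (Cyc t1 t2))) =
    y * chains true * (if d is d'.+2 then degree_part d' else 0).
  case: d => [|[|d]].
  - by rewrite mulr0 -[RHS]tree_sum0 -[in RHS]tree_sum0; do 2! apply: tree_sum_eq => ?; rewrite mul0r.
  - by rewrite mulr0 -[RHS]tree_sum0 -[in RHS]tree_sum0; do 2! apply: tree_sum_eq => ?; rewrite mul0r.
  rewrite -[RHS]mulrA -tree_sum_mul; do 2! apply: tree_sum_eq => ?.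
  by rewrite /= !eqSS; ring.
have -> : tree_sum (fun t1 => tree_sum (fun t2 =>
    (deg (Link t1 t2) == d)%:R * gen_weight None (Link t1 t2))) = 0.
  by rewrite -[RHS]tree_sum0 -[in RHS]tree_sum0; do 2! apply: tree_sum_eq => ?; rewrite mulr0.
by rewrite /= [0%N == d]eq_sym mulr1 addr0.
Qed.

Lemma degree_part_large d : (N.*2 < d)%N -> degree_part d = 0.
Proof.
move=> dN; rewrite -[RHS]tree_sum0; apply: tree_sum_eq => t.
have [tN|tN] := ltnP N (nb_edges t); first by rewrite gen_weight0 ?mulr0.
case: eqP => [td|_]; last by rewrite mul0r.
by have := deg_nE t; rewrite td leqNgt (leq_ltn_trans _ dN) // leq_double.
Qed.

Lemma sum_degree_part (F : nat -> S) D : (N.*2 < D)%N ->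
  tree_sum (fun t => F (deg t) * gen_weight None t) = \sum_(d < D) F d * degree_part d.
Proof.
move=> ND; rewrite /degree_part /tree_sum; under [RHS]eq_bigr do rewrite mulr_sumr.
rewrite exchange_big /=; apply: eq_bigr => t _.
have [tN|tN] := ltnP N (nb_edges t).
  rewrite gen_weight0 // mulr0 big1 // => d _; by rewrite !mulr0.
have tD : (deg t < D)%N.
  by rewrite (leq_ltn_trans _ ND) // (leq_trans (deg_nE t)) // leq_double.
rewrite (bigD1 (Ordinal tD)) //= eqxx mul1r big1 ?addr0 // => d dt.
rewrite (_ : (deg t == d) = false) ?mul0r ?mulr0 //; apply/negP => /eqP td.
by case/eqP: dt; apply: val_inj.
Qed.

(** The weight of a whole cactus, its root vertex included. The factor 2 is the [+ 1] in the
    exponent of 2: an initial bridge is not counted there and has no factor 2 of its own, while an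
    initial cycle receives the 2 on top of those of all bridges. *)
Definition root_weight t : S :=
  match t with
  | Flex t1 t2 => 2 * y * (lam (deg t1).+1 * gen_weight None t1 *
                           (lam (deg t2).+1 * gen_weight None t2))
  | Cyc c t => 2 * y * (gen_weight (Some true) c * (lam (deg t).+2 * gen_weight None t))
  | _ => 0
  end.

Lemma root_weight_sum : tree_sum root_weight = 2 * (y * hanging1 ^+ 2) + 2 * (y * chains true * hanging2).
Proof.
rewrite tree_sumE => [|t tN].
  rewrite /= !tree_sum0 !addr0 add0r !tree_sum_mul -/hanging1 -/hanging2 -/(chains _).
  by congr (_ + _); ring.
case: t tN => //= t1 t2 tN.
  have [r1 ->] := gen_weight_div None t1; have [r2 ->] := gen_weight_div None t2.
  transitivity (y ^+ (nb_edges t1 + nb_edges t2).+1 * (2 * lam (deg t1).+1 * lam (deg t2).+1 * r1 * r2)).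
    by rewrite exprS exprD; ring.
  by rewrite y_large ?mul0r.
have [r1 ->] := gen_weight_div (Some true) t1; have [r2 ->] := gen_weight_div None t2.
transitivity (y ^+ (nb_edges t1 + nb_edges t2).+1 * (2 * lam (deg t2).+2 * r1 * r2)).
  by rewrite exprS exprD; ring.
by rewrite y_large ?mul0r.
Qed.

End TreeSums.

Section TreeWeights.
Variables (K S : comNzRingType) (iota : {rmorphism K -> S}) (lam : nat -> K) (y : S).

Lemma gen_weightE b t : gen_weight (iota \o lam) y b t =
  let ok := if b is Some par then shaped false t && (odd (links t) == par)
            else shaped true t in
  if ok && even_cycles t then y ^+ nb_edges t * iota (2 ^+ nb_flex t * weight lam t) else 0.
Proof.
elim: t b => [|t1 IH1 t2 IH2|t1 IH1 t2 IH2|t1 IH1 t2 IH2] [par|] //=.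
- by case: par => //=; rewrite !mul1r rmorph1.
- by rewrite !mul1r rmorph1.
- rewrite IH1 IH2 /=; case: (shaped true t1) => /=; last by rewrite ?andbF ?(mulr0, mul0r).
  case: (shaped true t2) => /=; last by rewrite ?andbF ?(mulr0, mul0r).
  case: (even_cycles t1) => /=; last by rewrite ?andbF ?(mulr0, mul0r).
  case: (even_cycles t2) => /=; last by rewrite ?andbF ?(mulr0, mul0r).
  by rewrite !rmorphM !rmorphXn !rmorphMn !rmorph1 exprS exprD exprS exprD; ring.
- rewrite IH1 IH2 /= eqb_id; case: (shaped false t1) => /=; last by rewrite ?andbF ?(mulr0, mul0r).
  case: (shaped true t2) => /=; last by rewrite ?andbF ?(mulr0, mul0r).
  case: (odd (links t1)) => /=; last by rewrite ?andbF ?(mulr0, mul0r).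
  case: (even_cycles t1) => /=; last by rewrite ?andbF ?(mulr0, mul0r).
  case: (even_cycles t2) => /=; last by rewrite ?andbF ?(mulr0, mul0r).
  by rewrite !rmorphM !rmorphXn !rmorphMn !rmorph1 exprS !exprD; ring.
- rewrite IH1 IH2 /=; case: (shaped true t1) => /=; last by rewrite ?andbF ?(mulr0, mul0r).
  case: (shaped false t2) => /=; last by rewrite ?andbF ?(mulr0, mul0r).
  rewrite eqb_negLR.
  case: (odd (links t2) == ~~ par) => /=; last by rewrite ?andbF ?(mulr0, mul0r).
  case: (even_cycles t1) => /=; last by rewrite ?andbF ?(mulr0, mul0r).
  case: (even_cycles t2) => /=; last by rewrite ?andbF ?(mulr0, mul0r).
  by rewrite !rmorphM !rmorphXn !rmorphMn !rmorph1 exprS !exprD; ring.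
Qed.

Lemma root_weightE t : t != Leaf -> root_weight (iota \o lam) y t =
  if shaped true t && even_cycles t then
    y ^+ nb_edges t * iota (2 ^+ (nb_flex_but_first t).+1 * (lam (deg t) * weight lam t)) else 0.
Proof.
case: t => [/eqP//|t1 t2 _|t1 t2 _|t1 t2 _ //]; rewrite [LHS]/=.
- rewrite !gen_weightE /=; case: (shaped true t1) => /=; last by rewrite ?andbF ?(mulr0, mul0r).
  case: (shaped true t2) => /=; last by rewrite ?andbF ?(mulr0, mul0r).
  case: (even_cycles t1) => /=; last by rewrite ?andbF ?(mulr0, mul0r).
  case: (even_cycles t2) => /=; last by rewrite ?andbF ?(mulr0, mul0r).
  by rewrite !rmorphM !rmorphXn !rmorphMn !rmorph1 !exprS !exprD; ring.
- rewrite !gen_weightE /= eqb_id; case: (shaped false t1) => /=; last by rewrite ?andbF ?(mulr0, mul0r).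
  case: (shaped true t2) => /=; last by rewrite ?andbF ?(mulr0, mul0r).
  case: (odd (links t1)) => /=; last by rewrite ?andbF ?(mulr0, mul0r).
  case: (even_cycles t1) => /=; last by rewrite ?andbF ?(mulr0, mul0r).
  case: (even_cycles t2) => /=; last by rewrite ?andbF ?(mulr0, mul0r).
  by rewrite !rmorphM !rmorphXn !rmorphMn !rmorph1 !exprS !exprD; ring.
Qed.

End TreeWeights.

(** * The functional equation *)

Section FixedPoint.
Variables (S : comNzRingType) (X : Type) (T : (X -> S) -> (X -> S)) (z : S) (N : nat).
Hypothesis Tlin : forall u v x, T (fun s => u s + x * v s) = (fun s => T u s + x * T v s).
Hypothesis zN : z ^+ N.+1 = 0.

(** Substituting the equation into itself N + 1 times leaves a remainder with the factor z^(N+1) =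
    0. Solutions are thus unique, so it is enough to exhibit one. *)
Lemma fixed_point_sum (e g : X -> S) : (forall s, g s = e s + z * T g s) ->
  forall s, g s = \sum_(n < N.+1) z ^+ n * iter n T e s.
Proof.
move=> gE; have gE' : g = (fun s => e s + z * T g s) by apply: funext.
have Tn n u v x : iter n T (fun s => u s + x * v s) =
    (fun s => iter n T u s + x * iter n T v s).
  by elim: n => //= n ->; rewrite Tlin.
suff H k s : g s = \sum_(0 <= n < k) z ^+ n * iter n T e s + z ^+ k * iter k T g s.
  by move=> s; rewrite (H N.+1) zN mul0r addr0 big_mkord.
elim: k => [|k IH]; first by rewrite big_nil add0r mul1r.
have E1 : iter k T g s = iter k T e s + z * iter k.+1 T g s.
  by rewrite {1}gE' Tn -iterSr.
by rewrite big_nat_recr //= IH E1 exprSr /=; ring.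
Qed.

End FixedPoint.

Section PairReading.
Variables (K : comNzRingType) (lam : nat -> K) (D : nat).

Definition read_pair (h : seq bool -> K) s : K :=
  letter lam D true (letter lam D false h) s + letter lam D false (letter lam D true h) s.

Lemma letter_linear c u v x : letter lam D c (fun s => u s + x * v s) =
  (fun s => letter lam D c u s + x * letter lam D c v s).
Proof.
have -> : (fun s => u s + x * v s) = (fun s => u s - (- x) * v s).
  by apply: funext => s; rewrite mulNr opprK.
by rewrite letter_sub; apply: funext => s; rewrite mulNr opprK.
Qed.

Lemma read_pair_linear u v x : read_pair (fun s => u s + x * v s) =
  (fun s => read_pair u s + x * read_pair v s).
Proof. by apply: funext => s; rewrite /read_pair !letter_linear; ring. Qed.

End PairReading.

(** * Verification of the excursion matrix *)

Section FunctionalEquation.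
Variables (S : comNzRingType) (lam : nat -> S) (D : nat) (z M L1 L2 q : S) (A : nat -> S).
Let y := z * M.
Let t := y * L2.
Hypothesis qE : q = 1 + t ^+ 2 * q.
Hypothesis ME : M = 1 + 2 * (y * L1 ^+ 2) + 2 * (t ^+ 2 * q).
Hypothesis A0 : A 0 = 1.
Hypothesis A1 : A 1 = 2 * (y * L1).
Hypothesis AS : forall k, A k.+2 = 2 * (y * L1) * A k.+1 + y * t * q * A k.
Hypothesis L1E : L1 = \sum_(k < D.+1) lam k.+1 * A k.
Hypothesis L2E : L2 = \sum_(k < D.+1) lam k.+2 * A k.
Hypothesis AD : A D = 0.

(* The state [None] is the beginning of a pair of letters; in the state
   [Some c] the letter [c] has to complete the current pair. [excursion p r]
   enumerates the words leading from [p] to [r] and leaving the stack as it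
   was. *)
Definition excursion (p r : option bool) : S :=
  match p, r with
  | None, None => M
  | None, Some _ => M * L1
  | Some _, None => y * L1
  | Some c, Some d => (if c == d then q else t * q) + y * L1 ^+ 2
  end.

(** Enumerates the words that start in state [p], pop all of [s] and end between pairs. The top
    token [c] is popped either by the first letter of a pair, after which [~~ c] must follow, or by
    the second, which completes the pair and earns the factor [z]. *)
Fixpoint emptying (s : seq bool) (p : option bool) : S :=
  if s is c :: s' then
    excursion p None * emptying s' (Some (~~ c)) +
    excursion p (Some c) * (z * emptying s' None)
  else excursion p None.

Let A' k := if k is k'.+1 then A k' else 0.

(** Popping [c] acts on the values at [None] and [Some (~~ c)] by the matrix P with rows (y L1, M)
    and (z (t q + y L1^2), y L1). By Cayley-Hamilton, P^k = A_k + A_(k-1) (P - 2 y L1). *)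
Lemma emptying_nseq c k s :
  emptying (nseq k c ++ s) None = A k * emptying s None +
    A' k * (M * emptying s (Some (~~ c)) - y * L1 * emptying s None) /\
  emptying (nseq k c ++ s) (Some (~~ c)) = A k * emptying s (Some (~~ c)) +
    A' k * (z * (t * q + y * L1 ^+ 2) * emptying s None
            - y * L1 * emptying s (Some (~~ c))).
Proof.
have AS' j : A j.+1 = 2 * (y * L1) * A j + y * t * q * A' j.
  by case: j => [|j]; rewrite ?AS //= A1 A0 mulr1 mulr0 addr0.
elim: k => [|k [IH1 IH2]]; first by rewrite A0 !mul1r !mul0r !addr0.
have cc : (~~ c == c) = false by case: (c).
rewrite [nseq _ _ ++ _]/= [emptying (_ :: _) None]/= [emptying (_ :: _) (Some _)]/=.
rewrite cc IH1 IH2 AS' /= /y; split; ring.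
Qed.

(** The index shift in Cayley-Hamilton turns lambda_(k+1) into lambda_(k+2), the weight of vertices
    on cycles; the term lost at the upper end is covered by [A D = 0]. *)
Lemma sum_A' : \sum_(k < D.+1) lam k.+1 * A' k = L2.
Proof.
rewrite big_ord_recl /= mulr0 add0r L2E big_ord_recr /= AD mulr0 addr0.
by apply: eq_bigr => k _.
Qed.

Lemma letter_emptying c s : letter lam D.+1 c (fun s => emptying s (Some (~~ c))) s =
  L1 * (1 - t) * emptying s (Some (~~ c)) +
  L2 * (z * (t * q + y * L1 ^+ 2)) * emptying s None +
  (if s is c' :: s' then if c' == c then emptying s' (Some (~~ c)) else 0 else 0).
Proof.
rewrite /letter; congr (_ + _).
under eq_bigr => k _ do rewrite (emptying_nseq c k s).2 mulrDr !mulrA.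
rewrite big_split /= -!big_distrl /= -L1E sum_A' /t; ring.
Qed.

Lemma letter_emptying_None c s : letter lam D.+1 c (fun s => emptying s None) s =
  L1 * emptying s None + L2 * (M * emptying s (Some (~~ c)) - y * L1 * emptying s None) +
  (if s is c' :: s' then if c' == c then emptying s' None else 0 else 0).
Proof.
rewrite /letter; congr (_ + _).
under eq_bigr => k _ do rewrite (emptying_nseq c k s).1 mulrDr !mulrA.
rewrite big_split /= -!big_distrl /= -L1E sum_A'; ring.
Qed.

(** The first-step equation in state [Some c]: the letter [c] is forced and completes a pair. Once
    the sums over block sizes are evaluated, only the top token matters and the identity reduces to
    [qE]. *)
Lemma emptying_Some c s :
  emptying s (Some c) = z * letter lam D.+1 c (fun s => emptying s None) s.
Proof.
rewrite letter_emptying_None.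
have E1 : emptying s (Some c) = z * L1 * (1 - t) * emptying s None +
    t * emptying s (Some (~~ c)) +
    (if s is c' :: s' then if c' == c then z * emptying s' None else 0 else 0).
  case: s => [|c' s] /=; first by rewrite /y; ring.
  have Q : q - t ^+ 2 * q - 1 = 0 by rewrite {1}qE; ring.
  have eqQ (u v w : S) : u - v = (q - t ^+ 2 * q - 1) * w -> u = v.
    by rewrite Q mul0r => /eqP; rewrite subr_eq0 => /eqP.
  case: c' c => [] [] /=; try (by rewrite /y; ring);
    by apply: (eqQ _ _ (z * emptying s None)); rewrite /y; ring.
rewrite E1; case: s {E1} => [|c' s]; rewrite /t /y; first by ring.
by case: ifP => _; ring.
Qed.

Lemma emptying_None s : emptying s None = empty_stack S s +
  \sum_c letter lam D.+1 c (fun s => emptying s (Some (~~ c))) s.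
Proof.
rewrite big_bool /= !letter_emptying /empty_stack.
have tE : L2 * (z * M) = t by rewrite /t /y mulrC.
have Q : q - t ^+ 2 * q - 1 = 0 by rewrite {1}qE; ring.
have PM : M - 1 - 2 * (y * L1 ^+ 2) - 2 * (t ^+ 2 * q) = 0 by rewrite {1}ME; ring.
(* The two sides will differ by a combination of the relations [qE] and [ME]; [w] and [w'] are its
   cofactors. *)
have eqPM (u v w w' : S) : u - v = (q - t ^+ 2 * q - 1) * w +
    (M - 1 - 2 * (y * L1 ^+ 2) - 2 * (t ^+ 2 * q)) * w' -> u = v.
  by rewrite Q PM !mul0r addr0 => /eqP; rewrite subr_eq0 => /eqP.
have E1 (u v : S) : L2 * (z * u) * (M * v) = t * u * v by rewrite -tE; ring.
case: s => [|c s].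
  rewrite /= -[M in RHS]mulr1 !E1; apply: (eqPM _ _ 0 1); rewrite /y; ring.
rewrite [_ == _]/=.
have -> : emptying (c :: s) None = M * (emptying s (Some (~~ c)) + L1 * (z * emptying s None)).
  by rewrite /=; ring.
rewrite !E1; set u := emptying s (Some _); set v := z * emptying s None.
case: c @u => u /=; rewrite -/v -/u.
  apply: (eqPM _ _ (- L1 * v) (u + L1 * v)); rewrite /y; ring.
apply: (eqPM _ _ (- L1 * v) (u + L1 * v)); rewrite /y; ring.
Qed.

Lemma emptying_read_pair s : emptying s None =
  empty_stack S s + z * read_pair lam D.+1 (fun s => emptying s None) s.
Proof.
have H c : (fun s => emptying s (Some (~~ c))) =
    (fun s => 0 + z * letter lam D.+1 (~~ c) (fun s => emptying s None) s).
  by apply: funext => r; rewrite add0r emptying_Some.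
have L0 c r : letter lam D.+1 c (fun=> 0) r = 0.
  rewrite /letter big1 => [|k _]; last by rewrite mulr0.
  by case: r => [|c' r]; rewrite ?if_same addr0.
rewrite emptying_None big_bool /= (H true) (H false) !letter_linear !L0 /= /read_pair; ring.
Qed.

End FunctionalEquation.

(** * The one-colour automaton *)

Section HeightEquation.
Variables (S : comNzRingType) (mu : nat -> S) (N : nat) (z M : S).
Hypothesis zN : z ^+ N.+1 = 0.
Hypothesis ME : M = 1 + \sum_(k < N) mu k.+1 * (z * M) ^+ k.+1.

Definition height_step (h : nat -> S) i : S :=
  \sum_(k < N) mu k.+1 * h (k + i)%N + (if i is i'.+1 then h i' else 0).

Lemma iter_height_step n i :
  iter n height_step (fun i => (i == 0%N)%:R) i = path_sum mu N n i.
Proof.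
elim: n i => //= n IH i; rewrite [LHS]/height_step; congr (_ + _).
  by apply: eq_bigr => k _; rewrite IH.
by case: i.
Qed.

(** A path from height i to 0 consists of i + 1 excursions separated by i descents, whence the
    series M (z M)^i. It solves the recursion of [height_step], and [fixed_point_sum] identifies it
    with the sum over paths. *)
Lemma height_sum : M = \sum_(n < N.+1) z ^+ n * path_sum mu N n 0.
Proof.
rewrite -[LHS]mulr1 -[X in M * X](expr0 (z * M)).
rewrite (@fixed_point_sum S nat height_step z N _ zN (fun i => (i == 0%N)%:R)
  (fun i => M * (z * M) ^+ i)) //.
- by apply: eq_bigr => n _; rewrite iter_height_step.
- move=> u v x; apply: funext => i; rewrite /height_step.
  under eq_bigr => k _ do rewrite mulrDr mulrCA.
  by rewrite big_split /= -big_distrr /=; case: i => [|i]; ring.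
have E1 i : z * (\sum_(k < N) mu k.+1 * (M * (z * M) ^+ (k + i))) = (M - 1) * (z * M) ^+ i.
  have -> : M - 1 = \sum_(k < N) mu k.+1 * (z * M) ^+ k.+1.
    by rewrite [in LHS]ME addrAC subrr add0r.
  rewrite mulr_sumr mulr_suml.
  by apply: eq_bigr => k _; rewrite exprD exprSr; ring.
move=> i; rewrite /height_step mulrDr E1; case: i => [|i] /=; first by ring.
by rewrite exprSr; ring.
Qed.

End HeightEquation.

(* Each iteration gains a factor [z]. *)
Lemma height_equation_solution (S : comNzRingType) (mu : nat -> S) N (z : S) :
  z ^+ N.+1 = 0 -> exists M, M = 1 + \sum_(k < N) mu k.+1 * (z * M) ^+ k.+1.
Proof.
move=> zN; pose T M := 1 + \sum_(k < N) mu k.+1 * (z * M) ^+ k.+1.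
have TT x x' : exists r, T x - T x' = z * ((x - x') * r).
  exists (\sum_(k < N) mu k.+1 * \sum_(i < k.+1) (z * x) ^+ (k - i) * (z * x') ^+ i).
  rewrite /T opprD addrACA subrr add0r -sumrB !mulr_sumr; apply: eq_bigr => k _.
  by rewrite -mulrBr subrXX /=; ring.
have H i : exists r, iter i.+1 T 0 - iter i T 0 = z ^+ i * r.
  elim: i => [|i [r IH]]; first by exists (T 0 - 0); rewrite mul1r.
  have [r' E1] := TT (iter i.+1 T 0) (iter i T 0).
  by exists (r * r'); rewrite [iter i.+2 _ _]iterS [X in _ - X]iterS E1 IH exprS; ring.
have [r] := H N.+1; rewrite zN mul0r => /eqP; rewrite subr_eq0 => /eqP E1.
by exists (iter N.+1 T 0); rewrite -{1}E1.
Qed.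

(** * The cumulants of ab + ba *)

Section CactusCumulants.
Variables (K : comNzRingType) (lam : nat -> K) (N : nat).

Definition bouquets k : seq tree := [seq t <- trees N.+1 | shaped true t & nb_edges t == k].

Definition cactus_cumulant k : K :=
  \sum_(t <- bouquets k | even_cycles t) 2 ^+ (nb_flex_but_first t).+1 * (lam (deg t) * weight lam t).

Lemma mem_bouquets k t : (k <= N)%N -> (t \in bouquets k) = shaped true t && (nb_edges t == k).
Proof.
move=> kN; rewrite mem_filter; apply: andb_idr => /andP[_ /eqP nt].
by rewrite mem_trees // nt ltnS.
Qed.

Lemma path_sum_map (S : comNzRingType) (iota : {rmorphism K -> S}) (mu : nat -> K) D n h :
  path_sum (iota \o mu) D n h = iota (path_sum mu D n h).
Proof.
elim: n h => [|n IH] h /=; first by rewrite rmorph_nat.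
rewrite rmorphD rmorph_sum; congr (_ + _).
  by apply: eq_bigr => k _; rewrite rmorphM IH.
by case: h => [|h]; rewrite ?rmorph0.
Qed.

Lemma read_pair_map (S : comNzRingType) (iota : {rmorphism K -> S}) D h :
  read_pair (iota \o lam) D (iota \o h) = iota \o read_pair lam D h.
Proof.
have L c g : letter (iota \o lam) D c (iota \o g) = iota \o letter lam D c g.
  apply: funext => s; rewrite /letter /= rmorphD rmorph_sum; congr (_ + _).
    by apply: eq_bigr => k _; rewrite rmorphM.
  by case: s => [|c' s]; [rewrite rmorph0 | case: ifP; rewrite ?rmorph0].
by apply: funext => s; rewrite /read_pair /= !L rmorphD.
Qed.

Lemma read_pair_path_sum_map (S : comNzRingType) (iota : {rmorphism K -> S}) (z : S) :
  z ^+ N.+1 = 0 ->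
  \sum_(n < N.+1) z ^+ n * iota (iter n (read_pair lam N.*2.+2) (empty_stack K) [::]) =
  \sum_(n < N.+1) z ^+ n * iota (path_sum cactus_cumulant N n 0).
Proof.
move=> zN; pose lamS := iota \o lam; pose mu := iota \o cactus_cumulant.
have [M ME] := height_equation_solution mu zN.
pose y := z * M.
have yN : y ^+ N.+1 = 0 by rewrite exprMn zN mul0r.
pose l1 := hanging1 lamS y N; pose l2 := hanging2 lamS y N; pose q := chains lamS y N false.
have oddE : chains lamS y N true = y * l2 * q by apply: chains_odd.
have qE : q = 1 + (y * l2) ^+ 2 * q by rewrite {1}/q chains_even // oddE -/l2; ring.
(* The sum over sizes becomes a sum over trees, which [root_weight_sum] evaluates in terms of L1, L2
   and q; this turns the height equation into the one required of [M]. *)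
have muE : \sum_(k < N) mu k.+1 * y ^+ k.+1 = tree_sum N (root_weight lamS y).
  rewrite /tree_sum /mu /cactus_cumulant.
  transitivity (\sum_(k < N) \sum_(t <- trees N.+1)
    if [&& shaped true t, nb_edges t == k.+1 & even_cycles t] then root_weight lamS y t else 0).
    apply: eq_bigr => k _ /=; rewrite rmorph_sum mulr_suml big_filter_cond -big_mkcond.
    apply: eq_big => [t|t /andP[/andP[st /eqP nt] et]]; first by rewrite andbA.
    have t0 : t != Leaf by apply/eqP => t0; rewrite t0 in nt.
    by rewrite root_weightE // st et nt mulrC.
  rewrite exchange_big /=; apply: eq_bigr => t _.
  have [->|t0] := eqVneq t Leaf.
    by rewrite big1 // => k _; rewrite if_same.
  have tE := root_weightE iota lam y t0.
  have [tN|tN] := ltnP N (nb_edges t).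
    have -> : root_weight lamS y t = 0 by rewrite tE (y_large yN tN) mul0r if_same.
    by rewrite big1 // => k _; rewrite if_same.
  have [st|st] := boolP (shaped true t && even_cycles t); last first.
    rewrite tE (negbTE st) big1 // => k _; rewrite ifF //.
    by apply/negbTE; apply: contraNN st => /and3P[-> _ ->].
  have nt0 : (nb_edges t).-1.+1 = nb_edges t by case: t t0 {tE tN st} => // /eqP.
  have tN' : ((nb_edges t).-1 < N)%N by rewrite nt0.
  rewrite (bigD1 (Ordinal tN')) //= nt0 eqxx; have /andP[-> ->] := st.
  rewrite big1 ?addr0 // => k kt; rewrite ifF //; apply/negP => /and3P[_ /eqP nk _].
  by case/eqP: kt; apply: val_inj; rewrite /= nk.
have ME' : M = 1 + 2 * (y * l1 ^+ 2) + 2 * ((y * l2) ^+ 2 * q).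
  by rewrite {1}ME muE root_weight_sum // oddE -/l1 -/l2; ring.
have A0 : degree_part lamS y N 0 = 1 by rewrite degree_partE //= !mulr0 !addr0.
have A1 : degree_part lamS y N 1 = 2 * (y * l1) by rewrite degree_partE //= A0 mulr0 addr0 add0r mulr1.
have AS k : degree_part lamS y N k.+2 = 2 * (y * l1) * degree_part lamS y N k.+1 + y * (y * l2) * q * degree_part lamS y N k.
  by rewrite degree_partE //= add0r oddE -/l1; ring.
(* A bouquet with at most N edges has root degree at most 2N, since an edge adds at most 2. Hence
   A_(2N+1) = 0, and the automaton is run with block sizes up to 2N + 2. *)
have big_D : (N.*2 < N.*2.+2)%N by lia.
have L1E : l1 = \sum_(k < N.*2.+2) lamS k.+1 * degree_part lamS y N k.
  exact: (sum_degree_part lamS yN (fun d => lamS d.+1) big_D).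
have L2E : l2 = \sum_(k < N.*2.+2) lamS k.+2 * degree_part lamS y N k.
  exact: (sum_degree_part lamS yN (fun d => lamS d.+2) big_D).
have AD : degree_part lamS y N N.*2.+1 = 0 by apply: degree_part_large.
transitivity M.
  have fix_ := emptying_read_pair qE ME' A0 A1 AS L1E L2E AD.
  have := fixed_point_sum (@read_pair_linear _ _ _) zN fix_ [::] => /= ->.
  apply: eq_bigr => n _; congr (_ * _).
  rewrite (_ : iter n _ _ = iota \o iter n (read_pair lam N.*2.+2) (empty_stack K)) //.
  elim: (nat_of_ord n) => [|k IH] /=; last by rewrite IH read_pair_map.
  by apply: funext => s; rewrite /= /empty_stack rmorph_nat.
rewrite {1}(height_sum zN ME); apply: eq_bigr => n _; by rewrite path_sum_map.
Qed.

(** The identity is instantiated in K[X]/(X^(N+1)) with z the class of X. Both sides are represented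
    by polynomials of size at most N + 1, so that their coefficients can be compared. *)
Lemma read_pair_path_sum n : (n <= N)%N ->
  iter n (read_pair lam N.*2.+2) (empty_stack K) [::] = path_sum cactus_cumulant N n 0.
Proof.
move=> nN; pose h : {poly K} := 'X^(N.+1); pose z : {poly %/ h} := in_qpoly h 'X.
pose iota : {rmorphism K -> {poly %/ h}} := in_qpoly h \o polyC.
(* The quotient is taken by [mk_monic h], which has to be identified with [h]. *)
have hE : mk_monic h = h by rewrite mk_monic_Xn.
have zN : z ^+ N.+1 = 0.
  by rewrite -rmorphXn; apply: val_inj; rewrite /= hE Pdiv.RingMonic.rmodpp ?monicXn.
have E1 (c : nat -> K) : \sum_(k < N.+1) z ^+ k * iota (c k) = in_qpoly h (\poly_(k < N.+1) c k).
  rewrite poly_def rmorph_sum; apply: eq_bigr => k _.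
  by rewrite -rmorphXn -rmorphM -mul_polyC mulrC.
have := read_pair_path_sum_map iota zN.
rewrite (E1 (fun k => iter k _ _ _)) (E1 (fun k => path_sum _ _ k _)).
move=> /(congr1 val) /=; rewrite !Pdiv.CommonRing.rmodp_small ?hE ?size_polyXn ?ltnS ?size_poly //.
by move=> /(congr1 (fun p : {poly K} => p`_n)); rewrite !coef_poly ltnS nN.
Qed.

End CactusCumulants.

(** The factors of the power are expanded one at a time into the prefix [pre], which always remains
    a sum of words; [D] has to bound the final length of these words for [moment_read] to apply. *)
Lemma moment_read_pair (K : comNzRingType) (A : algType K) (phi : {scalar A}) (a b : A) D n pre :
  phi 1 = 1 -> free_indep phi a b -> same_distribution phi a b ->
  (size pre + n.*2 <= D)%N ->
  phi (word_value a b pre * (a * b + b * a) ^+ n) =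
  read (fun k => cumulant phi k a) D pre
    (iter n (read_pair (fun k => cumulant phi k a) D) (empty_stack K)) [::].
Proof.
move=> phi1 fab dab; set lam := fun k => cumulant phi k a.
elim: n pre => [|n IH] pre nD.
  by rewrite mulr1 /= -(moment_read phi1 fab dab) // -[size pre]addn0.
have E1 c d : word_value a b pre * (letter_value a b c * letter_value a b d) =
    word_value a b (pre ++ [:: c; d]).
  by rewrite /word_value big_cat /= !big_cons big_nil mulr1.
have sz c d : (size (pre ++ [:: c; d]) + n.*2 <= D)%N.
  by move: nD; rewrite size_cat /= doubleS; lia.
have readD u v s : read lam D pre (fun s => u s + v s) s =
    read lam D pre u s + read lam D pre v s.
  have -> : (fun s => u s + v s) = (fun s => u s - (-1) * v s).
    by apply: funext => r; rewrite mulN1r opprK.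
  by rewrite read_sub mulN1r opprK.
rewrite exprS mulrA mulrDr mulrDl raddfD /=.
rewrite (E1 true false) (E1 false true) !IH //.
by rewrite readD /read !foldr_cat.
Qed.

Lemma cumulant_cactus (K : comNzRingType) (A : algType K) (phi : {scalar A}) (a b : A) n :
  phi 1 = 1 -> free_indep phi a b -> same_distribution phi a b -> (0 < n)%N ->
  cumulant phi n (a * b + b * a) = cactus_cumulant (fun k => cumulant phi k a) n n.
Proof.
(* Equal path sums force equal terms, and the path sums of the free cumulants of ab + ba are its
   moments. *)
move=> phi1 fab dab n0; apply: (@path_sum_inj _ (fun k => cumulant phi k _) _ n).
  move=> k /andP[_ kn]; rewrite -moment_path_sum // -read_pair_path_sum //.
  (* The words have 2k letters, which is within the bound 2n + 2 imposed by [read_pair_path_sum]. *)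
  have := @moment_read_pair K A phi a b n.*2.+2 k [::] phi1 fab dab.
  rewrite /word_value big_nil mul1r add0n => -> //.
  lia.
by rewrite n0 leqnn.
Qed.

Local Open Scope complex_scope.

Theorem corollary1p15 (R : realType) (A : algType R[i]) (phi : {scalar A})
    (phi1 : phi 1 = 1) (a b : A)
    (free_ab : free_indep phi a b) (dist_ab : same_distribution phi a b)
    (n : nat) (n_gt0 : (0 < n)%N) :
  let lambda := fun k => cumulant phi k a in
  cumulant phi n (a * b + b * a) =
  \sum_(q : OCG n | bipartite (OCG_graph q))
    2 ^+ (nflex (OCG_graph q) (OCG_cycle q)).+1 *
    \prod_v lambda (mdegree (OCG_graph q) v).
Proof.
move=> lambda; rewrite (cumulant_cactus phi1 free_ab dist_ab n_gt0).
apply/esym/(OCG_sum n_gt0 lambda); first by rewrite filter_uniq ?trees_uniq.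
by move=> t; apply: mem_bouquets.
Qed.
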